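(* Let $0<\nu_0<\nu_1<\infty$ and $\mathbf f\in C_b(V)$. Let $\mathbf u\in C_b(V)$, $\mathbf u\neq 0$, be a solution on $\mathbb R$ of the Navier--Stokes equations $\frac{d}{dt}\mathbf u+\nu A\mathbf u+B(\mathbf u,\mathbf u)=\mathbf f$ with viscosity $\nu\in[\nu_0,\nu_1]$. Choose $\mu_0\ge \nu_1/\nu_0$, let $N\ge 1$ and $\mu=\mu_0\nu_0\kappa_0^2N^2$. If $$N>\max\Big\{\tfrac{8}{\nu_0\kappa_0}M_V(\mathbf u),\ n_0(\mathbf u)\Big\}$$ and $$\frac{N}{\sqrt{\ln(N+1)}}>\frac{2\sqrt{5c}}{\nu_0\kappa_0^2\sqrt{|\Omega|}}\;\frac{M_H(\mathbf u)\,M_V(\mathbf u)}{\|P_N\mathbf u\|_{C_b(H)}},$$ then $\nu$ is the unique minimizer on $[\nu_0,\nu_1]$ of the cost functional $$\mathcal L(\gamma)=\|P_N\mathbb W(\gamma,P_N\mathbf u)-P_N\mathbf u\|_{C_b(H)}.$$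
   Context: Domain and spaces: $L>0$, $\Omega=[0,L]^2$ with periodic boundary conditions, $|\Omega|=L^2$, $\kappa_0=2\pi/L$. $H$ and $V$ are the closures, in $(L^2(\Omega))^2$ and $(H^1(\Omega))^2$ respectively, of the $L$-periodic, divergence-free, mean-zero, $\mathbb R^2$-valued trigonometric polynomials; $|\mathbf u|=\|\mathbf u\|_{L^2}$ is the norm of $H$ and $\|\mathbf u\|=\|\nabla\mathbf u\|_{L^2}$ the norm of $V$. $P_\sigma$ is the orthogonal (Helmholtz--Leray) projection of mean-zero periodic $L^2$ vector fields onto $H$; $A=-P_\sigma\Delta$ (which is $-\Delta$ here) and $B(\mathbf u,\mathbf v)=P_\sigma[(\mathbf u\cdot\nabla)\mathbf v]$, extended continuously with values in $V'$. For a normed space $X$, $C_b(X)$ is the space of bounded continuous maps $\mathbb R\to X$ with norm $\|\phi\|_{C_b(X)}=\sup_{t\in\mathbb R}\|\phi(t)\|_X$. Modal projection: for real $N\ge1$, $P_N$ keeps exactly the Fourier modes $\mathbf k\in\mathbb Z^2$ with $|\mathbf k|<N$ (Fourier modes $e^{i\kappa_0\mathbf k\cdot\mathbf x}$) and sets the others to zero. Determining map: for $\gamma>0$ and $\phi\in C_b(V)$, $\mathbb W(\gamma,\phi)$ denotes the solution $\mathbf v\in C_b(V)$, on all of $\mathbb R$, of $\frac{d}{dt}\mathbf v+\gamma A\mathbf v+B(\mathbf v,\mathbf v)=\mathbf f+\mu(\phi-P_N\mathbf v)$ (which exists and is unique for the data occurring in the claim). Constants: for $\phi\in C_b(V)$,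 $M_H(\phi)=\sqrt2\,\sqrt{\frac{1}{(\nu_0\kappa_0^2)^2}\|\mathbf f\|_{C_b(H)}^2+\mu_0^2\|\phi\|_{C_b(H)}^2}$ and $M_V(\phi)=\sqrt2\,\sqrt{\frac{1}{(\nu_0\kappa_0^2)^2}\|\mathbf f\|_{C_b(V)}^2+\mu_0^2\|\phi\|_{C_b(V)}^2}$. For $0\ne\phi\in C_b(H)$, $n_0(\phi)=\sup\{n\in\mathbb R: \|P_n\phi\|_{C_b(H)}=0\}$, so $1\le n_0(\phi)<\infty$. $c$ is an absolute constant such that $\sum_{\mathbf k\in\mathbb Z^2,\,0<|\mathbf k|\le N}|\mathbf k|^{-2}\le 8+2\pi(1+\ln N)\le c\ln(N+1)$ for all $N\ge1$. *)

(* Defs.v *)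
From mathcomp Require Import all_boot all_order all_algebra.
From mathcomp Require Import all_classical all_reals all_analysis.

Set Implicit Arguments.
Unset Strict Implicit.
Unset Printing Implicit Defensive.

Import Order.TTheory GRing.Theory Num.Theory.
Import numFieldNormedType.Exports.

Local Open Scope classical_set_scope.
Local Open Scope ring_scope.

(* A vector field is a plain function: component j, then point x.  Elements of
   L^2 are represented by functions on the plane of which only the restriction
   to the periodicity cell [torus L] = [0, L]^2 matters, up to a null set. *)
Definition vfield (R : realType) := 'I_2 -> R * R -> R.

Definition area2 (R : realType) :=
  (@lebesgue_measure R \x @lebesgue_measure R)%E.
Arguments area2 : clear implicits.

Definition torus (R : realType) (L : R) :
    set (measurableTypeR R * measurableTypeR R) :=
  `[0, L]%classic `*` `[0, L]%classic.

Definition area (R : realType) (L : R) : R := L ^+ 2.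

Definition kappa0 (R : realType) (L : R) : R := 2 * pi / L.

Definition inL2 (R : realType) (L : R) (u : vfield R) : Prop :=
  forall j : 'I_2,
    measurable_fun (torus L)
      (u j : measurableTypeR R * measurableTypeR R -> R) /\
    (area2 R).-integrable (torus L) (fun x => (u j x ^+ 2)%:E).

Definition innerH (R : realType) (L : R) (u w : vfield R) : R :=
  \int[area2 R]_(x in torus L) (\sum_(j < 2) u j x * w j x).

Definition normH (R : realType) (L : R) (u : vfield R) : R :=
  Num.sqrt (innerH L u u).

Definition knorm (R : realType) (k : int * int) : R :=
  Num.sqrt (k.1%:~R ^+ 2 + k.2%:~R ^+ 2).

Definition phase (R : realType) (L : R) (k : int * int) (x : R * R) : R :=
  kappa0 L * (k.1%:~R * x.1 + k.2%:~R * x.2).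

Definition partial (R : realType) (i : 'I_2) (g : R * R -> R) (x : R * R) : R :=
  'D_(((i == 0)%:R, (i == 1)%:R) : R * R) g x.

(* [grad u i] is the vector field of the derivatives of the components of [u]
   in direction i. *)
Definition grad (R : realType) (u : vfield R) : 'I_2 -> vfield R :=
  fun i j => partial i (u j).

Definition trig_poly (R : realType) (L : R) (p : vfield R) : Prop :=
  exists (m : nat) (a b : int * int -> 'I_2 -> R), forall j x,
    p j x = \sum_(k \in [set k : int * int | knorm R k <= m%:R])
              (a k j * cos (phase L k x) + b k j * sin (phase L k x)).

Definition solenoidal_trig_poly (R : realType) (L : R) (p : vfield R) : Prop :=
  [/\ trig_poly L p,
      forall x, \sum_(i < 2) partial i (p i) x = 0
    & forall j, \int[area2 R]_(x in torus L) p j x = 0].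

(* Closure in H^1: [u] is the H^1-limit of a sequence of solenoidal
   trigonometric polynomials, and [G] is its (a.e. unique) L^2 gradient. *)
Definition V_gradient (R : realType) (L : R) (u : vfield R) :
    set ('I_2 -> vfield R) :=
  [set G | [/\ inL2 L u, forall i, inL2 L (G i) &
    exists p : nat -> vfield R,
      [/\ forall n, solenoidal_trig_poly L (p n),
          normH L (p n - u) @[n --> \oo] --> (0 : R)
        & forall i, normH L (grad (p n) i - G i) @[n --> \oo] --> (0 : R)]]].

Definition inV (R : realType) (L : R) (u : vfield R) : Prop :=
  V_gradient L u !=set0.

Definition gradV (R : realType) (L : R) (u : vfield R) : 'I_2 -> vfield R :=
  get (V_gradient L u).

Definition innerV (R : realType) (L : R) (u w : vfield R) : R :=
  \sum_(i < 2) innerH L (gradV L u i) (gradV L w i).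

Definition normV (R : realType) (L : R) (u : vfield R) : R :=
  Num.sqrt (innerV L u u).

Definition inCbV (R : realType) (L : R) (phi : R -> vfield R) : Prop :=
  [/\ forall t, inV L (phi t),
      forall t, normV L (phi s - phi t) @[s --> t] --> (0 : R)
    & has_ubound (range (fun t => normV L (phi t)))].

Definition normCbH (R : realType) (L : R) (phi : R -> vfield R) : R :=
  sup (range (fun t => normH L (phi t))).

Definition normCbV (R : realType) (L : R) (phi : R -> vfield R) : R :=
  sup (range (fun t => normV L (phi t))).

Definition fcos (R : realType) (L : R) (g : R * R -> R) (k : int * int) : R :=
  (area L)^-1 * \int[area2 R]_(x in torus L) (g x * cos (phase L k x)).

Definition fsin (R : realType) (L : R) (g : R * R -> R) (k : int * int) : R :=
  (area L)^-1 * \int[area2 R]_(x in torus L) (g x * sin (phase L k x)).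

(* For a real field the k-th Fourier coefficient is [fcos k - i fsin k], and
   the imaginary parts of the modes k and -k cancel, so each mode contributes
   the real part of [(fcos k - i fsin k) exp(i (phase k x))]. *)
Definition PN (R : realType) (L N : R) (u : vfield R) : vfield R := fun j x =>
  \sum_(k \in [set k : int * int | knorm R k < N])
    (fcos L (u j) k * cos (phase L k x) + fsin L (u j) k * sin (phase L k x)).

(* <A u, w> in the V'-V duality: A = - P_sigma Delta extended to V -> V'. *)
Definition pairA (R : realType) (L : R) (u w : vfield R) : R := innerV L u w.

(* <B(u, v), w> for w in V: since P_sigma is self-adjoint and P_sigma w = w, it
   is the integral of ((u . grad) v) . w. *)
Definition pairB (R : realType) (L : R) (u v w : vfield R) : R :=
  \int[area2 R]_(x in torus L)
    (\sum_(i < 2) \sum_(j < 2) u i x * gradV L v i j x * w j x).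

(* v' + gamma A v + B(v, v) = g in V', at every time t. *)
Definition evolution (R : realType) (L gamma : R) (g v : R -> vfield R) : Prop :=
  forall (t : R) (w : vfield R), inV L w ->
    is_derive t 1 (fun s : R => innerH L (v s) w)
      (innerH L (g t) w - gamma * pairA L (v t) w - pairB L (v t) (v t) w).

Definition NSE_solution (R : realType) (L nu : R) (f u : R -> vfield R) : Prop :=
  inCbV L u /\ evolution L nu f u.

(* v is a value of the determining map at (gamma, phi). *)
Definition determining_solution (R : realType) (L mu N : R)
    (f : R -> vfield R) (gamma : R) (phi v : R -> vfield R) : Prop :=
  inCbV L v /\
  evolution L gamma (fun t => f t + mu *: (phi t - PN L N (v t))) v.

Definition MH (R : realType) (L nu0 mu0 : R) (f phi : R -> vfield R) : R :=
  Num.sqrt 2 * Num.sqrt (1 / (nu0 * kappa0 L ^+ 2) ^+ 2 * normCbH L f ^+ 2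
                         + mu0 ^+ 2 * normCbH L phi ^+ 2).

Definition MV (R : realType) (L nu0 mu0 : R) (f phi : R -> vfield R) : R :=
  Num.sqrt 2 * Num.sqrt (1 / (nu0 * kappa0 L ^+ 2) ^+ 2 * normCbV L f ^+ 2
                         + mu0 ^+ 2 * normCbV L phi ^+ 2).

Definition n0 (R : realType) (L : R) (phi : R -> vfield R) : R :=
  sup [set n : R | normCbH L (fun t => PN L n (phi t)) = 0].

Definition log_constant (R : realType) (c : R) : Prop :=
  forall N : R, 1 <= N ->
    \sum_(k \in [set k : int * int | 0 < knorm R k <= N]) (knorm R k) ^- 2
      <= 8 + 2 * pi * (1 + ln N) <= c * ln (N + 1).

Definition cost (R : realType) (L N : R)
    (W : R -> (R -> vfield R) -> R -> vfield R) (u : R -> vfield R)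
    (gamma : R) : R :=
  normCbH L (fun t => PN L N (W gamma (fun s => PN L N (u s)) t)
                      - PN L N (u t)).

Definition unique_minimizer_on (R : realType) (a b : R) (F : R -> R) (x : R) :
    Prop :=
  [/\ x \in `[a, b], forall y, y \in `[a, b] -> F x <= F y
    & forall y, y \in `[a, b] ->
        (forall z, z \in `[a, b] -> F y <= F z) -> y = x].

(* Main.v *)
(* At [gamma = nu] the data [P_N u] are reproduced by [u] itself: the energy
   inequality for [w = W(gamma, P_N u) - u], in which the nudging term damps the
   low modes and the Poincare inequality the high ones, combined with a Gronwall
   argument on the whole line, gives
   [|w| <= 2 |gamma - nu| ||u|| / (gamma kappa0 N)], hence [w = 0] at
   [gamma = nu].  If some [gamma <> nu] also reproduced [P_N u] exactly, the
   nudging term would vanish; testing the difference of the two equations with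
   [A^-1 P_N u] isolates [(gamma - nu) |P_N u|^2], and the remaining terms are
   controlled by [|w|] and [sup |grad (A^-1 P_N u)|].  The latter is at most
   [sqrt (c ln (N + 1)) / (kappa0 L) * |P_N u|] by Cauchy-Schwarz over the modes,
   which contradicts the second condition on [N]. *)
Require Import Defs.
From mathcomp Require Import all_boot all_order all_algebra.
From mathcomp Require Import finmap.
From mathcomp Require Import all_classical all_reals all_analysis measurable_realfun.
From mathcomp Require Import ring lra.

Set Implicit Arguments.
Unset Strict Implicit.
Unset Printing Implicit Defensive.

Import Order.TTheory GRing.Theory Num.Theory.
Import numFieldNormedType.Exports.

Local Open Scope classical_set_scope.
Local Open Scope ring_scope.

(** * Semi-inner products and square-integrable functions *)

(** Fields are plain functions, determined only up to null sets, and V is a closure. Most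
    inequalities are therefore proved first for trigonometric polynomials, where calculus is exact,
    and then carried to the limit as statements about seminorms. The obstacle is the trilinear form:
    for fields in V it is under control only once products of two components are known to be square
    integrable, and this is Ladyzhenskaya's inequality in H^1. Its constant 4 gives |B(w,u,w)| <= 2
    |w| ||w|| ||u||, and the 8 in the first condition on N lets viscosity and nudging absorb this
    term with enough left to damp |w|. Antisymmetry of B in its last two arguments is used twice: it
    removes B(v,w,w) from the energy estimate, and it moves the gradient onto A^-1 P_N u, so that u
    and v enter the final estimate through M_H. That estimate is made at one frozen time, so the
    test field is never differentiated in time; only its conclusion is passed to the supremum. It
    yields 4 times the sum of |k|^-2 under the root, to be compared with 5 c ln(N+1) in the second
    condition. *)

Section SemiInner.
Variables (R : realType) (E : lmodType R) (D : E -> Prop) (ip : E -> E -> R).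
Hypothesis DD : forall x y, D x -> D y -> D (x + y).
Hypothesis DZ : forall a x, D x -> D (a *: x).
Hypothesis ipC : forall x y, ip x y = ip y x.
Hypothesis ipD : forall x y z, D x -> D y -> D z -> ip (x + y) z = ip x z + ip y z.
Hypothesis ipZ : forall a x y, D x -> D y -> ip (a *: x) y = a * ip x y.
Hypothesis ip_ge0 : forall x, D x -> 0 <= ip x x.

Lemma seminner_sqrD x y t : D x -> D y ->
  ip (x + t *: y) (x + t *: y) = ip x x + 2 * t * ip x y + t ^+ 2 * ip y y.
Proof.
move=> Dx Dy; have Dty := DZ t Dy; have Dxy := DD Dx Dty.
rewrite ipD// (ipC x) (ipC (t *: y)) !ipD// !ipZ// (ipC y x) (ipC x (t *: y)) ipZ//.
rewrite (ipC y (t *: y)) ipZ// (ipC y x); ring.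
Qed.

(** The discriminant argument. Since [ip] may vanish on nonzero vectors (functions that are null
    almost everywhere), the case [ip y y = 0] needs its own treatment. *)
Lemma seminner_CS x y : D x -> D y -> ip x y ^+ 2 <= ip x x * ip y y.
Proof.
move=> Dx Dy.
have H t : 0 <= ip x x + 2 * t * ip x y + t ^+ 2 * ip y y.
  by rewrite -seminner_sqrD//; exact/ip_ge0/DD/DZ.
have [y0|yn0] := eqVneq (ip y y) 0.
  have [xy0|xyn0] := eqVneq (ip x y) 0; first by rewrite xy0 y0 mulr0 expr0n.
  (* With [ip y y = 0] the quadratic is affine in [t], and this [t] is where it takes the value
     -1. *)
  have := H (- (ip x x + 1) / (2 * ip x y)); rewrite y0.
  have -> : ip x x + 2 * (- (ip x x + 1) / (2 * ip x y)) * ip x y +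
    (- (ip x x + 1) / (2 * ip x y)) ^+ 2 * 0 = -1 by field.
  by rewrite ler0N1.
have y_gt0 : 0 < ip y y by rewrite lt_neqAle eq_sym yn0 ip_ge0.
(* The minimiser of the quadratic. *)
have := H (- ip x y / ip y y).
have -> : ip x x + 2 * (- ip x y / ip y y) * ip x y +
  (- ip x y / ip y y) ^+ 2 * ip y y = ip x x - ip x y ^+ 2 / ip y y by field.
by rewrite subr_ge0 ler_pdivrMr.
Qed.

Let nm x := Num.sqrt (ip x x).

Lemma seminner_sqr_norm x : D x -> nm x ^+ 2 = ip x x.
Proof. by move=> Dx; rewrite sqr_sqrtr// ip_ge0. Qed.

Lemma seminner_CSn x y : D x -> D y -> `|ip x y| <= nm x * nm y.
Proof.
move=> Dx Dy; rewrite -sqrtrM ?ip_ge0// -sqrtr_sqr ler_sqrt ?mulr_ge0 ?ip_ge0//.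
exact: seminner_CS.
Qed.

Lemma seminner_triangle x y : D x -> D y -> nm (x + y) <= nm x + nm y.
Proof.
move=> Dx Dy; rewrite -(@ler_pXn2r _ 2)// ?nnegrE ?addr_ge0 ?sqrtr_ge0//.
rewrite sqrrD !seminner_sqr_norm//; last exact: DD.
have := seminner_sqrD 1 Dx Dy; rewrite scale1r => ->.
have := le_trans (ler_norm _) (seminner_CSn Dx Dy); rewrite -mulr_natr; nra.
Qed.

Lemma seminner_normZ a x : D x -> nm (a *: x) = `|a| * nm x.
Proof.
move=> Dx; rewrite /nm ipZ//; last exact: DZ.
by rewrite ipC ipZ// mulrA sqrtrM ?sqr_ge0// -expr2 sqrtr_sqr.
Qed.

Lemma seminner_triangleB x y : D x -> D y -> nm (x - y) <= nm x + nm y.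
Proof.
move=> Dx Dy; rewrite -scaleN1r; have DNy := DZ (-1) Dy.
by rewrite (le_trans (seminner_triangle _ _))// seminner_normZ// normrN1 mul1r.
Qed.

Lemma seminner_cvg (F : nat -> E) G x : (forall n, D (F n)) -> D G -> D x ->
  nm (F n - G) @[n --> \oo] --> (0 : R) ->
  ip (F n) x @[n --> \oo] --> ip G x.
Proof.
move=> DF DG Dx FG.
have DFG n : D (F n - G) by rewrite -scaleN1r; apply: DD => //; exact: DZ.
apply/cvgrPdist_le => e e0.
(* Adding 1 keeps the divisor positive when [x] is null. *)
have nx0 : 0 < nm x + 1 by rewrite ltr_wpDl// sqrtr_ge0.
have e0' : 0 < e / (nm x + 1) by rewrite divr_gt0.
move/cvgrPdist_le : FG => /(_ _ e0'); apply: filterS => n /=.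
rewrite distrC subr0 ger0_norm ?sqrtr_ge0// ler_pdivlMr// => le_e.
rewrite distrC.
have -> : ip (F n) x - ip G x = ip (F n - G) x.
  by rewrite -[X in _ = ip (_ + X) _]scaleN1r ipD// ?ipZ ?mulN1r//; exact: DZ.
rewrite (le_trans (seminner_CSn _ _))//.
rewrite (le_trans _ le_e)// ler_wpM2l ?sqrtr_ge0// lerDl//.
Qed.

Lemma seminner_cvg_norm (F : nat -> E) G : (forall n, D (F n)) -> D G ->
  nm (F n - G) @[n --> \oo] --> (0 : R) ->
  nm (F n) @[n --> \oo] --> nm G.
Proof.
move=> DF DG FG.
have DFG n : D (F n - G) by rewrite -scaleN1r; apply: DD => //; exact: DZ.
apply/cvgrPdist_le => e e0.
move/cvgrPdist_le : FG => /(_ _ e0); apply: filterS => n /=.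
rewrite distrC subr0 ger0_norm ?sqrtr_ge0// => le_e.
rewrite distrC (le_trans _ le_e)// ler_norml.
have := seminner_triangle (DFG n) DG; rewrite subrK.
have := seminner_triangleB (DF n) (DFG n); rewrite opprB addrC subrK.
lra.
Qed.

End SemiInner.

Section SquareIntegrable.
Context d (T : measurableType d) (R : realType) (mu : {measure set T -> \bar R}).
Variable D : set T.
Hypotheses (mD : measurable D) (finD : (mu D < +oo)%E).
Implicit Types f g h : T -> R.

(** Measurability is asked for separately, since that of [g ^+ 2] would not imply it. By conversion,
    [inL2 L u] says this of each component of [u] on the torus. *)
Definition sqint g :=
  measurable_fun D g /\ mu.-integrable D (fun x => (g x ^+ 2)%:E).

Definition ipl2 g h : R := \int[mu]_(x in D) (g x * h x).


Lemma sqint_mul g h : sqint g -> sqint h ->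
  mu.-integrable D (EFin \o (fun x => g x * h x)).
Proof.
move=> [mg ig] [mh ih].
apply: (@le_integrable _ _ _ mu D mD _ (EFin \o (fun x => g x ^+ 2 + h x ^+ 2))).
- by apply/measurable_EFinP; exact: measurable_funM.
- move=> x _ /=; rewrite lee_fin ler_norml.
  rewrite (ger0_norm (addr_ge0 (sqr_ge0 _) (sqr_ge0 _))).
  apply/andP; split; nra.
- exact: integrableD ig ih.
Qed.

Lemma bounded_integrable f (C : R) : measurable_fun D f ->
  (forall x, D x -> `|f x| <= C) -> mu.-integrable D (EFin \o f).
Proof.
move=> mf bf; apply: measurable_bounded_integrable => //.
exists C; split; first exact: num_real.
by move=> M CM x /= Dx; rewrite (le_trans (bf x Dx))// ltW.
Qed.

Lemma bounded_sqint f (C : R) : measurable_fun D f ->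
  (forall x, D x -> `|f x| <= C) -> sqint f.
Proof.
move=> mf bf; split=> //; apply: (@bounded_integrable _ (C ^+ 2)).
  by apply: measurable_funX.
by move=> x Dx; rewrite normrX lerXn2r ?nnegrE// ?bf// (le_trans _ (bf _ Dx)).
Qed.

Lemma sqintD g h : sqint g -> sqint h -> sqint (g + h).
Proof.
move=> sg sh; have [mg ig] := sg; have [mh ih] := sh; split.
  exact: measurable_funD.
apply: (@le_integrable _ _ _ mu D mD _
    (EFin \o (fun x => 2 * (g x ^+ 2 + h x ^+ 2)))).
- by apply/measurable_EFinP; apply: measurable_funX; exact: measurable_funD.
- move=> x _ /=; rewrite lee_fin.
  have -> : (g + h) x = g x + h x by [].
  rewrite !ger0_norm ?sqr_ge0 ?mulr_ge0 ?addr_ge0 ?sqr_ge0//.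
  have := sqr_ge0 (g x - h x); rewrite sqrrB sqrrD !mulr2n; lra.
- exact: integrableZl (integrableD mD ig ih).
Qed.

Lemma sqintZ a g : sqint g -> sqint (a *: g).
Proof.
move=> [mg ig]; split; first exact: measurable_funM.
have -> : (fun x => (((a *: g) x) ^+ 2)%:E) =
    (fun x => (a ^+ 2)%:E * (g x ^+ 2)%:E)%E.
  by apply/funext => x; rewrite -EFinM; congr EFin; rewrite -exprMn.
exact: integrableZl.
Qed.

Lemma sqintB g h : sqint g -> sqint h -> sqint (g - h).
Proof. by move=> sg sh; rewrite -scaleN1r; exact/sqintD/sqintZ. Qed.

Lemma ipl2C g h : ipl2 g h = ipl2 h g.
Proof. by apply: eq_Rintegral => x _; rewrite mulrC. Qed.

Lemma ipl2D f g h : sqint f -> sqint g -> sqint h ->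
  ipl2 (f + g) h = ipl2 f h + ipl2 g h.
Proof.
move=> sf sg sh; rewrite /ipl2 -RintegralD//; last 2 first.
- exact: sqint_mul.
- exact: sqint_mul.
by apply: eq_Rintegral => x _; rewrite -mulrDl.
Qed.

Lemma ipl2Z a f g : sqint f -> sqint g -> ipl2 (a *: f) g = a * ipl2 f g.
Proof.
move=> sf sg; rewrite /ipl2 -RintegralZl//; last exact: sqint_mul.
by apply: eq_Rintegral => x _; rewrite mulrA.
Qed.

Lemma ipl2_ge0 f : 0 <= ipl2 f f.
Proof. by apply: Rintegral_ge0 => x _; rewrite -expr2 sqr_ge0. Qed.

End SquareIntegrable.

(** * A Gronwall inequality on the whole line *)

Section Gronwall.
Variable (R : realType).

Lemma le0_is_derive_nincr (y dy : R -> R) : (forall t : R, is_derive t (1:R) y (dy t)) ->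
  (forall t, dy t <= 0) -> forall s t, s <= t -> y t <= y s.
Proof.
move=> Hy dle s t; rewrite le_eqVlt => /predU1P[->//|st].
have Hc : {within `[s, t], continuous y}.
  apply: continuous_subspaceT => z.
  by apply: differentiable_continuous; apply/derivable1_diffP.
have [c _ E] := MVT st (fun x _ => Hy x) Hc.
by rewrite -subr_le0 E mulr_le0_ge0// subr_ge0 ltW.
Qed.

(* Going backwards in time, an excess of y over b/a would grow at least
   linearly, contradicting boundedness. *)
Lemma bounded_gronwall (y dy : R -> R) (a b C : R) : 0 < a ->
  (forall t : R, is_derive t (1:R) y (dy t)) -> (forall t, y t <= C) ->
  (forall t, dy t <= - a * y t + b) -> forall t, y t <= b / a.
Proof.
move=> a0 Hy yC dyle t0; rewrite leNgt; apply/negP => ylt.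
pose E t := expR (a * (t - t0)).
(* Integrating factor: the differential inequality makes [z] nonincreasing on the whole line. *)
pose z t := (y t - b / a) * E t.
pose dz t := dy t * E t + (y t - b / a) * (a * E t).
have HE (t : R) : is_derive t (1:R) E (a * E t).
  rewrite /E; apply: is_derive_eq; rewrite /GRing.scale/=; ring.
have Hz (t : R) : is_derive t (1:R) z (dz t).
  rewrite /z /dz; have H1 := Hy t; have H2 := HE t.
  apply: is_derive_eq; rewrite /GRing.scale/=; ring.
have dz0 t : dz t <= 0.
  have -> : dz t = (dy t - (- a * y t + b)) * E t.
    by rewrite /dz; field; rewrite gt_eqF.
  by rewrite mulr_le0_ge0 ?expR_ge0// subr_le0.
have e0 : 0 < y t0 - b / a by rewrite subr_gt0.
set e := y t0 - b / a in e0.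
have key s : 0 <= s -> e * (1 + a * s) <= C - b / a.
  move=> s0; have : t0 - s <= t0 by lra.
  move/(le0_is_derive_nincr Hz dz0); rewrite {1}/z /E subrr mulr0 expR0 mulr1 -/e.
  have Es0 : 0 < E (t0 - s) by exact: expR_gt0.
  move=> H; have {}H : e <= (C - b / a) * E (t0 - s).
    rewrite (le_trans H)//; apply: ler_wpM2r; first exact: ltW.
    by rewrite lerB ?yC.
  have : expR (a * s) * E (t0 - s) = 1.
    by rewrite /E -expRD -[RHS]expR0; congr expR; ring.
  have := expR_ge1Dx (a * s).
  have := expR_gt0 (a * s).
  move: H Es0; set P := expR _; set Q := E _ => H Q0 P0 P1 PQ.
  apply: (@le_trans _ _ (e * P)); first by apply: ler_wpM2l => //; exact: ltW.
  have := ler_wpM2r (ltW P0) H; rewrite -mulrA (mulrC Q) PQ mulr1; exact.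
have Cb : 0 <= C - b / a by rewrite subr_ge0 (le_trans (ltW ylt)).
(* For this [s], [e * (1 + a * s)] equals [e + (C - b / a)], more than [key] allows. *)
have := key ((C - b / a) / (e * a) ) (divr_ge0 Cb (ltW (mulr_gt0 e0 a0))).
rewrite mulrDr mulr1 mulrA -[e * a * _]mulrC divfK ?gt_eqF ?mulr_gt0//; lra.
Qed.

End Gronwall.

(** * Scalar trigonometric polynomials *)

Section TrigFun.
Variables (R : realType) (L : R).
Implicit Types (k l : int * int) (f g : R * R -> R) (x : R * R) (i : 'I_2).

(** An inductive form of the scalar trigonometric polynomials, so that facts about them follow by
    induction without coefficients or degrees; [trig_polyP] links it to [trig_poly]. *)
Inductive trigfun : (R * R -> R) -> Prop :=
| trigfun_cos k : trigfun (fun x => cos (phase L k x))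
| trigfun_sin k : trigfun (fun x => sin (phase L k x))
| trigfunD f g : trigfun f -> trigfun g -> trigfun (fun x => f x + g x)
| trigfunZ a f : trigfun f -> trigfun (fun x => a * f x).

Definition edir i : R * R := ((i == 0)%:R, (i == 1)%:R).

Definition wavenum k i : R := if i == 0 then k.1%:~R else k.2%:~R.

Lemma phaseDr k x y : phase L k (x + y) = phase L k x + phase L k y.
Proof. by rewrite /phase/=; ring. Qed.

Lemma phase_edir k i t : phase L k (t *: edir i) = kappa0 L * wavenum k i * t.
Proof.
rewrite /phase /wavenum /edir /= /GRing.scale/=.
by case: i => -[|[|//]] ? /=; ring.
Qed.

Lemma phaseDl k l x : phase L (k + l) x = phase L k x + phase L l x.
Proof. by rewrite /phase/= !intrD; ring. Qed.

Lemma phaseNl k x : phase L (- k) x = - phase L k x.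
Proof. by rewrite /phase/= !mulrNz; ring. Qed.

Lemma phase0 x : phase L 0 x = 0.
Proof. by rewrite /phase/= !mul0r addr0 mulr0. Qed.

(* The derivative along the coordinate direction [i], on every line parallel to
   it; unlike [partial], it can be integrated by the one-dimensional FTC. *)
Definition has_partial i f g := forall x (t : R),
  is_derive t (1:R) (fun s : R => f (s *: edir i + x)) (g (t *: edir i + x)).

Lemma has_partialE i f g : has_partial i f g -> partial i f = g.
Proof.
move=> H; apply/funext => x; have := H x 0; rewrite scale0r add0r => /@derive_val <-.
(* The directional derivative and the derivative of the line restriction at 0 are limits of the same
   difference quotient. *)
apply: (f_equal (fun F : R -> R => lim (F h @[h --> 0^']))).
by apply/funext => h; rewrite /= scale0r add0r addr0 [_%:A]mulr1.
Qed.

Lemma has_partial_cos k i : has_partial i (fun x => cos (phase L k x))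
  (fun x => - (kappa0 L * wavenum k i) * sin (phase L k x)).
Proof.
move=> x t.
rewrite (_ : (fun s : R => _) =
  (fun s : R => cos (kappa0 L * wavenum k i * s + phase L k x))); last first.
  by apply/funext => s; rewrite phaseDr phase_edir.
apply: is_derive_eq.
by rewrite phaseDr phase_edir /GRing.scale /=; ring.
Qed.

Lemma has_partial_sin k i : has_partial i (fun x => sin (phase L k x))
  (fun x => (kappa0 L * wavenum k i) * cos (phase L k x)).
Proof.
move=> x t.
rewrite (_ : (fun s : R => _) =
  (fun s : R => sin (kappa0 L * wavenum k i * s + phase L k x))); last first.
  by apply/funext => s; rewrite phaseDr phase_edir.
apply: is_derive_eq.
by rewrite phaseDr phase_edir /GRing.scale /=; ring.
Qed.

Lemma has_partialD i f g f' g' : has_partial i f f' -> has_partial i g g' ->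
  has_partial i (fun x => f x + g x) (fun x => f' x + g' x).
Proof. by move=> Hf Hg x t; have H1 := Hf x t; have H2 := Hg x t; exact: is_deriveD. Qed.

Lemma has_partialZ i a f f' : has_partial i f f' ->
  has_partial i (fun x => a * f x) (fun x => a * f' x).
Proof.
move=> Hf x t; have H1 := Hf x t.
by apply: is_derive_eq; rewrite /GRing.scale/=; ring.
Qed.

Lemma has_partialM i f g f' g' : has_partial i f f' -> has_partial i g g' ->
  has_partial i (fun x => f x * g x) (fun x => f' x * g x + f x * g' x).
Proof.
move=> Hf Hg x t; have H1 := Hf x t; have H2 := Hg x t.
by apply: is_derive_eq; rewrite /GRing.scale/=; ring.
Qed.

Lemma trigfun_has_partial f i : trigfun f -> has_partial i f (partial i f).
Proof.
suff H : trigfun f -> exists f', has_partial i f f'.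
  by move=> /H[f' Hf]; rewrite (has_partialE Hf).
elim=> [k|k|{}f g _ [f' Hf] _ [g' Hg]|a {}f _ [f' Hf]].
- by eexists; exact: has_partial_cos.
- by eexists; exact: has_partial_sin.
- by eexists; exact: has_partialD.
- by eexists; exact: has_partialZ.
Qed.

Lemma trigfun_partial f i : trigfun f -> trigfun (partial i f).
Proof.
elim=> [k|k|{}f g Tf T1 Tg T2|a {}f Tf T1].
- by rewrite (has_partialE (has_partial_cos k i)); do 2 constructor.
- by rewrite (has_partialE (has_partial_sin k i)); do 2 constructor.
- rewrite (has_partialE (has_partialD (trigfun_has_partial i Tf)
    (trigfun_has_partial i Tg))).
  exact: trigfunD.
- rewrite (has_partialE (has_partialZ a (trigfun_has_partial i Tf))).
  exact: trigfunZ.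
Qed.

Lemma partial_cos k i : partial i (fun x => cos (phase L k x)) =
  (fun x => - (kappa0 L * wavenum k i) * sin (phase L k x)).
Proof. exact/has_partialE/has_partial_cos. Qed.

Lemma partial_sin k i : partial i (fun x => sin (phase L k x)) =
  (fun x => (kappa0 L * wavenum k i) * cos (phase L k x)).
Proof. exact/has_partialE/has_partial_sin. Qed.

Lemma partialD i f g : trigfun f -> trigfun g ->
  partial i (fun x => f x + g x) = (fun x => partial i f x + partial i g x).
Proof.
by move=> Tf Tg; apply/has_partialE/has_partialD; exact: trigfun_has_partial.
Qed.

Lemma partialZ i a f : trigfun f ->
  partial i (fun x => a * f x) = (fun x => a * partial i f x).
Proof. by move=> Tf; apply/has_partialE/has_partialZ; exact: trigfun_has_partial. Qed.

Lemma partialM i f g : trigfun f -> trigfun g ->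
  partial i (fun x => f x * g x) =
  (fun x => partial i f x * g x + f x * partial i g x).
Proof.
by move=> Tf Tg; apply/has_partialE/has_partialM; exact: trigfun_has_partial.
Qed.

Lemma cosM (a b : R) : cos a * cos b = 2^-1 * (cos (a + b) + cos (a - b)).
Proof. by rewrite cosB cosD; field. Qed.
Lemma sinM (a b : R) : sin a * sin b = 2^-1 * (cos (a - b) - cos (a + b)).
Proof. by rewrite cosB cosD; field. Qed.
Lemma sincosM (a b : R) : sin a * cos b = 2^-1 * (sin (a + b) + sin (a - b)).
Proof. by rewrite sinB sinD; field. Qed.

Lemma trigfunB f g : trigfun f -> trigfun g -> trigfun (fun x => f x - g x).
Proof.
move=> Tf Tg; rewrite (_ : (fun x => _) = (fun x => f x + (-1) * g x)).
  exact/trigfunD/trigfunZ.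
by apply/funext => x; rewrite mulN1r.
Qed.

Lemma trigfun0 : trigfun (fun=> 0).
Proof.
rewrite (_ : (fun=> _) = (fun x => 0 * cos (phase L 0 x))).
  exact/trigfunZ/trigfun_cos.
by apply/funext => x; rewrite mul0r.
Qed.

Lemma trigfun_sum (I : Type) (s : seq I) (P : pred I) (F : I -> R * R -> R) :
  (forall j, trigfun (F j)) -> trigfun (fun x => \sum_(j <- s | P j) F j x).
Proof.
move=> TF; elim: s => [|j s IH].
  by under eq_fun do rewrite big_nil; exact: trigfun0.
under eq_fun do rewrite big_cons.
by case: (P j) => //; exact: trigfunD.
Qed.

Lemma trigfun_fsum (I : choiceType) (A : set I) (F : I -> R * R -> R) :
  (forall j, trigfun (F j)) -> finite_set A ->
  trigfun (fun x => \sum_(j \in A) F j x).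
Proof.
move=> TF fA; under eq_fun do rewrite fsbig_finite//.
exact: trigfun_sum.
Qed.

(** Product-to-sum formulas. The local [lin] reduces the second factor to a single cosine or sine,
    and the induction does the same for the first. *)
Lemma trigfunM f g : trigfun f -> trigfun g -> trigfun (fun x => f x * g x).
Proof.
have lin (h : R * R -> R) :
    (forall k, trigfun (fun x => h x * cos (phase L k x))) ->
    (forall k, trigfun (fun x => h x * sin (phase L k x))) ->
    forall g, trigfun g -> trigfun (fun x => h x * g x).
  move=> Hc Hs g'; elim=> [//|//|f1 g1 _ Tf _ Tg|a f1 _ Tf].
    by under eq_fun do rewrite mulrDr; exact: trigfunD.
  by under eq_fun do rewrite mulrCA; exact: trigfunZ.
move=> Tf; elim: Tf g => [k|k|{}f f2 _ H1 _ H2|a {}f _ H1].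
- apply: lin => l.
    under eq_fun do rewrite cosM -phaseDl -phaseNl -phaseDl.
    by apply/trigfunZ/trigfunD; exact: trigfun_cos.
  under eq_fun do rewrite mulrC sincosM -phaseDl -phaseNl -phaseDl.
  by apply/trigfunZ/trigfunD; exact: trigfun_sin.
- apply: lin => l.
    under eq_fun do rewrite sincosM -phaseDl -phaseNl -phaseDl.
    by apply/trigfunZ/trigfunD; exact: trigfun_sin.
  under eq_fun do rewrite sinM -phaseDl -phaseNl -phaseDl.
  by apply/trigfunZ/trigfunB; exact: trigfun_cos.
- move=> g Tg; under eq_fun do rewrite mulrDl.
  by apply: trigfunD; [exact: H1|exact: H2].
- move=> g Tg; under eq_fun do rewrite -mulrA.
  by apply: trigfunZ; exact: H1.
Qed.

Lemma trigfun_bounded f : trigfun f -> exists2 C, 0 <= C & forall x, `|f x| <= C.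
Proof.
elim=> [k|k|{}f g _ [C C0 HC] _ [D D0 HD]|a {}f _ [C C0 HC]].
- by exists 1 => // x; rewrite ler_norml cos_geN1 cos_le1.
- by exists 1 => // x; rewrite ler_norml sin_geN1 sin_le1.
- exists (C + D); first exact: addr_ge0.
  by move=> x; rewrite (le_trans (ler_normD _ _))// lerD.
- exists (`|a| * C); first exact: mulr_ge0.
  by move=> x; rewrite normrM ler_wpM2l.
Qed.

Lemma trigfun_measurable f : trigfun f -> measurable_fun setT
  (f : measurableTypeR R * measurableTypeR R -> R).
Proof.
have mp k : measurable_fun setT
    (phase L k : measurableTypeR R * measurableTypeR R -> R).
  rewrite /phase; apply: measurable_funM => //.
  by apply: measurable_funD; apply: measurable_funM => //.
elim=> [k|k|{}f g _ Hf _ Hg|a {}f _ Hf].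
- apply: (measurableT_comp _ (mp k)).
  by apply: continuous_measurable_fun; exact: continuous_cos.
- apply: (measurableT_comp _ (mp k)).
  by apply: continuous_measurable_fun; exact: continuous_sin.
- exact: measurable_funD.
- exact: measurable_funM.
Qed.

End TrigFun.

(** * Integration over the periodicity cell: Fubini and periodicity *)

Section TorusIntegral.
Variables (R : realType) (L : R).
Hypothesis L_gt0 : 0 < L.
Let plane := (measurableTypeR R * measurableTypeR R)%type.
Let leb := @lebesgue_measure R.
Let I0L : set (measurableTypeR R) := `[0, L]%classic.

Let mI0L : measurable I0L. Proof. exact: measurable_itv. Qed.

Let lebI0L : leb I0L = L%:E.
Proof.
rewrite /leb /I0L lebesgue_measure_itv/= lte_fin L_gt0 /=.
by rewrite sube0.
Qed.

Let lebI0L_lty : (leb I0L < +oo)%E.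
Proof. by rewrite lebI0L ltry. Qed.

Lemma measurable_torus : measurable (torus L).
Proof. exact: measurableX. Qed.

Lemma area2_torus : area2 R (torus L) = (L ^+ 2)%:E.
Proof.
transitivity (leb I0L * leb I0L)%E; first exact: product_measure1E.
by rewrite lebI0L -EFinM.
Qed.

Lemma area2_torus_lty : (area2 R (torus L) < +oo)%E.
Proof. by rewrite area2_torus ltry. Qed.

Definition bmfun (f : R * R -> R) := measurable_fun setT (f : plane -> R) /\
  exists2 C, 0 <= C & forall x, `|f x| <= C.

Lemma trigfun_bmfun f : trigfun L f -> bmfun f.
Proof. by move=> Tf; split; [exact: trigfun_measurable Tf|exact: trigfun_bounded Tf]. Qed.

Lemma bmfunM f g : bmfun f -> bmfun g -> bmfun (fun x => f x * g x).
Proof.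
move=> [mf [C C0 HC]] [mg [D D0 HD]]; split; first exact: measurable_funM.
exists (C * D); first exact: mulr_ge0.
by move=> x; rewrite normrM ler_pM.
Qed.

Lemma bmfun_norm f : bmfun f -> bmfun (fun x => `|f x|).
Proof.
move=> [mf [C C0 HC]]; split; first exact: measurableT_comp.
by exists C => // x; rewrite normr_id.
Qed.

Lemma bmfun_cst (a : R) : bmfun (fun=> a).
Proof. by split; [exact: measurable_cst|exists `|a|]. Qed.

Lemma bmfun_integrable f : bmfun f -> (area2 R).-integrable (torus L)
  (EFin \o f).
Proof.
move=> [mf [C C0 HC]]; apply: (@bounded_integrable _ _ _ _ _ _ _ _ C).
- exact: measurable_torus.
- exact: area2_torus_lty.
- exact: measurable_funS mf.
- by move=> x _; exact: HC.
Qed.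

Lemma bmfun_sqint f : bmfun f -> sqint (area2 R) (torus L) f.
Proof.
move=> [mf [C C0 HC]]; apply: (@bounded_sqint _ _ _ _ _ _ _ _ C).
- exact: measurable_torus.
- exact: area2_torus_lty.
- exact: measurable_funS mf.
- by move=> x _; exact: HC.
Qed.

Lemma bmfun_section2 f (x : R) : bmfun f ->
  leb.-integrable I0L (EFin \o (fun y => f (x, y))).
Proof.
move=> [mf [C C0 HC]]; apply: (@bounded_integrable _ _ _ _ _ _ _ _ C) => //.
apply: (@measurable_funS _ _ _ _ setT) => //.
by apply: (measurableT_comp mf); exact: measurable_pair1.
Qed.

Lemma bmfun_section1 f (y : R) : bmfun f ->
  leb.-integrable I0L (EFin \o (fun x => f (x, y))).
Proof.
move=> [mf [C C0 HC]]; apply: (@bounded_integrable _ _ _ _ _ _ _ _ C) => //.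
apply: (@measurable_funS _ _ _ _ setT) => //.
by apply: (measurableT_comp mf); exact: measurable_pair2.
Qed.

Definition intx (f : R * R -> R) (y : R) := \int[leb]_(x in I0L) f (x, y).
Definition inty (f : R * R -> R) (x : R) := \int[leb]_(y in I0L) f (x, y).

(** Extension by zero turns integrals over the cell into integrals over the plane, the form in which
    Fubini's theorem is applied. *)
Let fT (f : R * R -> R) : plane -> \bar R := (EFin \o f) \_ (torus L).

Let ifT f : bmfun f -> (area2 R).-integrable setT (fT f).
Proof.
move=> Bf; apply/integrable_restrict; first exact: measurable_torus.
  exact: measurableT.
by rewrite setTI; exact: bmfun_integrable.
Qed.

Let fT_section2 f x : bmfun f ->
  (\int[leb]_y fT f (x, y) = ((fun x => (inty f x)%:E) \_ I0L) x)%E.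
Proof.
move=> Bf; rewrite /patch; case: ifPn => xI.
  rewrite /inty /Rintegral fineK; last exact: integrable_fin_num (bmfun_section2 _ Bf).
  rewrite [RHS]integral_mkcond; apply: eq_integral => y _; rewrite /fT /patch.
  by rewrite /torus in_setX xI.
rewrite integral0_eq// => y _; rewrite /fT /patch /torus in_setX.
by rewrite (negbTE xI).
Qed.

Let fT_section1 f y : bmfun f ->
  (\int[leb]_x fT f (x, y) = ((fun y => (intx f y)%:E) \_ I0L) y)%E.
Proof.
move=> Bf; rewrite /patch; case: ifPn => yI.
  rewrite /intx /Rintegral fineK; last exact: integrable_fin_num (bmfun_section1 _ Bf).
  rewrite [RHS]integral_mkcond; apply: eq_integral => x _; rewrite /fT /patch.
  by rewrite /torus in_setX yI andbT.
rewrite integral0_eq// => x _; rewrite /fT /patch /torus in_setX.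
by rewrite (negbTE yI) andbF.
Qed.

Lemma torus_fubini_y f : bmfun f ->
  \int[area2 R]_(z in torus L) f z = \int[leb]_(x in I0L) inty f x.
Proof.
move=> Bf; rewrite /Rintegral; congr fine.
rewrite integral_mkcond [RHS]integral_mkcond.
rewrite -(integral12_prod_meas1 (ifT Bf)).
by apply: eq_integral => x _; exact: fT_section2.
Qed.

Lemma torus_fubini_x f : bmfun f ->
  \int[area2 R]_(z in torus L) f z = \int[leb]_(y in I0L) intx f y.
Proof.
move=> Bf; rewrite /Rintegral; congr fine.
rewrite integral_mkcond [RHS]integral_mkcond.
rewrite -(integral21_prod_meas1 (ifT Bf)).
by apply: eq_integral => x _; exact: fT_section1.
Qed.

Lemma inty_bounded f : bmfun f -> (forall x, 0 <= f x) ->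
  measurable_fun setT (inty f : measurableTypeR R -> R) /\
  exists2 C, 0 <= C & forall x, `|inty f x| <= C.
Proof.
move=> Bf f0; have [mf [C C0 HC]] := Bf; split.
  rewrite /inty /Rintegral; apply: measurableT_comp => //.
  (* Only [y] is cut off, because [inty f] must be measurable on the whole line and not just on the
     cell. Its measurability is then Tonelli's theorem for [g]. *)
  pose g : plane -> \bar R := fun z => (f z * \1_I0L z.2)%:E.
  have mg : measurable_fun setT g.
    apply/measurable_EFinP; apply: measurable_funM => //.
    by apply: measurableT_comp => //; exact: measurable_indic.
  have g0 z : (0 <= g z)%E by rewrite lee_fin mulr_ge0.
  have := measurable_fun_fubini_tonelli_F (m2 := leb) g mg g0.
  apply: eq_measurable_fun => x _.
  rewrite /fubini_F [RHS]integral_mkcond.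
  apply: eq_integral => y _; rewrite /g /patch indicE; case: ifPn => _.
    by rewrite mulr1.
  by rewrite mulr0.
exists (C * L) => [|x]; first by rewrite mulr_ge0// ltW.
rewrite ger0_norm; last exact: Rintegral_ge0.
have -> : C * L = \int[leb]_(y in I0L) C.
  transitivity (C * fine (leb I0L)); first by rewrite lebI0L.
  by rewrite -Rintegral_cst.
apply: le_Rintegral => //.
- exact: bmfun_section2.
- exact: (bmfun_section2 x (bmfun_cst C)).
- by move=> y _; rewrite (le_trans (ler_norm _)).
Qed.

Lemma intx_bounded f : bmfun f -> (forall x, 0 <= f x) ->
  measurable_fun setT (intx f : measurableTypeR R -> R) /\
  exists2 C, 0 <= C & forall x, `|intx f x| <= C.
Proof.
move=> [mf [C C0 HC]] f0.
have Bs : bmfun (fun z => f (z.2, z.1)).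
  split; last by exists C.
  by apply: (measurableT_comp mf); apply: measurable_fun_pair.
exact: (inty_bounded Bs).
Qed.

Lemma edir0E (s y : R) : s *: edir R 0 + (0, y) = (s, y).
Proof. by rewrite -[LHS]/(s * 1 + 0, s * 0 + y) mulr1 mulr0 addr0 add0r. Qed.

Lemma edir1E (s x : R) : s *: edir R 1 + (x, 0) = (x, s).
Proof. by rewrite -[LHS]/(s * 0 + x, s * 1 + 0) mulr1 mulr0 addr0 add0r. Qed.

Lemma trigfun_line_FTC f i (x : R * R) (a b : R) : trigfun L f -> a < b ->
  \int[leb]_(s in `[a, b]) partial i f (s *: edir R i + x) =
  f (b *: edir R i + x) - f (a *: edir R i + x).
Proof.
move=> Tf ab; have Hf := trigfun_has_partial i Tf.
have Hpf := trigfun_has_partial i (trigfun_partial i Tf).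
have cont (g g' : R * R -> R) : has_partial i g g' ->
    continuous (fun s : R => g (s *: edir R i + x)).
  move=> H s; apply: differentiable_continuous; apply/derivable1_diffP.
  by have := H x s.
have cf := cont _ _ Hf; have cpf := cont _ _ Hpf.
rewrite /Rintegral (@continuous_FTC2 _ _ (fun s => f (s *: edir R i + x)))//.
- exact: continuous_subspaceT.
- split.
  + by move=> s _; have := Hf x s.
  + by apply: cvg_at_right_filter; exact: cf.
  + by apply: cvg_at_left_filter; exact: cf.
- by move=> s _; rewrite derive1E; move: (Hf x s) => /@derive_val.
Qed.

(** As [kappa0 L * L = 2 pi] and the wave numbers are integers, a shift by [L] changes each phase by
    an integer multiple of 2 pi. *)
Lemma trigfun_periodic f i (x : R * R) : trigfun L f -> f (L *: edir R i + x) = f x.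
Proof.
have per (h : R -> R) (a : R) (m : int) : periodic h (pi *+ 2) ->
    h (2 * pi * m%:~R + a) = h a.
  move=> ph; case: m => n.
    rewrite -[RHS](periodicn ph n); congr h.
    rewrite -[(pi *+ 2) *+ n]mulr_natr -(mulr_natr pi 2); ring.
  rewrite -[LHS](periodicn ph n.+1); congr h.
  rewrite -[(pi *+ 2) *+ n.+1]mulr_natr -(mulr_natr pi 2) NegzE mulrNz; ring.
have ph k : phase L k (L *: edir R i + x) =
    2 * pi * (if i == 0 then k.1 else k.2)%:~R + phase L k x.
  by rewrite phaseDr phase_edir mulrAC divfK ?(gt_eqF L_gt0)//; rewrite /wavenum; case: (i == 0).
elim=> [k|k|{}f g _ Hf _ Hg|a {}f _ Hf].
- by rewrite ph per//; exact: cosD2pi.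
- by rewrite ph per//; exact: sinD2pi.
- by rewrite Hf Hg.
- by rewrite Hf.
Qed.

Lemma Rintegral0 (g : R -> R) : (forall x, g x = 0) -> \int[leb]_(x in I0L) g x = 0.
Proof. by move=> g0; under eq_Rintegral do rewrite g0; rewrite Rintegral_cst// mul0r. Qed.

(** Fubini with the direction of differentiation innermost: each line integral is a difference of
    end values, equal by periodicity. Orthogonality of the modes and integration by parts both come
    from here. *)
Lemma int_partial f i : trigfun L f ->
  \int[area2 R]_(z in torus L) partial i f z = 0.
Proof.
move=> Tf; have Bf j := trigfun_bmfun (trigfun_partial j Tf).
case/orP: (orbN (i == 0)) => [/eqP->|i0].
  rewrite (torus_fubini_x (Bf 0)); apply: Rintegral0 => y; rewrite /intx.
  under eq_Rintegral do rewrite -edir0E.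
  by rewrite (trigfun_line_FTC _ _ Tf L_gt0) trigfun_periodic// scale0r add0r subrr.
have -> : i = 1 by apply/val_inj; case: i i0 => -[|[|]].
rewrite (torus_fubini_y (Bf 1)); apply: Rintegral0 => y; rewrite /inty.
under eq_Rintegral do rewrite -edir1E.
by rewrite (trigfun_line_FTC _ _ Tf L_gt0) trigfun_periodic// scale0r add0r subrr.
Qed.

End TorusIntegral.

(** * Ladyzhenskaya's inequality for trigonometric polynomials *)

Section Ladyzhenskaya.
Variables (R : realType) (L : R).
Hypothesis L_gt0 : 0 < L.
Let leb := @lebesgue_measure R.
Let I0L : set (measurableTypeR R) := `[0, L]%classic.

Let mI0L : measurable I0L. Proof. exact: measurable_itv. Qed.

Let lebI0L : leb I0L = L%:E.
Proof.
rewrite /leb /I0L lebesgue_measure_itv/= lte_fin L_gt0 /=.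
by rewrite sube0.
Qed.

Let lebI0L_lty : (leb I0L < +oo)%E.
Proof. by rewrite lebI0L ltry. Qed.

Let cst_integral (C : R) : \int[leb]_(y in I0L) C = C * L.
Proof.
transitivity (C * fine (leb I0L)); last by rewrite lebI0L.
by rewrite -Rintegral_cst.
Qed.

Lemma bmfun_line f i (x : R * R) : bmfun f ->
  leb.-integrable I0L (EFin \o (fun s => f (s *: edir R i + x))).
Proof.
move=> [mf [C C0 HC]]; apply: (@bounded_integrable _ _ _ _ _ _ _ _ C) => //.
apply: (@measurable_funS _ _ _ _ setT) => //.
apply: (measurableT_comp mf); apply: measurable_fun_pair => /=.
  by apply: measurable_funD => //; exact: measurable_funM.
by apply: measurable_funD => //; exact: measurable_funM.
Qed.

Lemma trigfun_line_osc f i (x : R * R) (a b : R) : trigfun L f -> 0 <= a <= L ->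
  0 <= b <= L ->
  `|f (b *: edir R i + x) - f (a *: edir R i + x)| <=
  \int[leb]_(s in I0L) `|partial i f (s *: edir R i + x)|.
Proof.
move=> Tf; wlog ab : a b / a <= b => [H|].
  have [ab|/ltW ba] := leP a b; first exact: H.
  by move=> ? ?; rewrite distrC; exact: H.
move: ab; rewrite le_eqVlt => /predU1P[-> _ _|ab /andP[a0 aL] /andP[b0 bL]].
  by rewrite subrr normr0; exact: Rintegral_ge0.
have Bf := trigfun_bmfun (trigfun_partial i Tf).
have If := bmfun_line i x Bf.
have sub : `[a, b] `<=` I0L.
  by apply: subset_itv; rewrite bnd_simp.
have If' : leb.-integrable `[a, b] (EFin \o (fun s => partial i f (s *: edir R i + x))).
  exact: (integrableS mI0L _ sub).
rewrite -(trigfun_line_FTC _ _ Tf ab).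
apply: (le_trans (le_normr_Rintegral _ If')) => //.
have In := bmfun_line i x (bmfun_norm Bf).
have In' : leb.-integrable `[a, b]
    (EFin \o (fun s => `|partial i f (s *: edir R i + x)|)).
  exact: (integrableS mI0L _ sub).
rewrite /Rintegral fine_le//.
- exact: integrable_fin_num In'.
- exact: integrable_fin_num In.
- apply: ge0_subset_integral => //; first exact: measurable_int In.
Qed.

(** The oscillation bound is averaged over the base point [a] in the cell, so no zero of [f] on the
    line is required. *)
Lemma trigfun_line_sup f i (x : R * R) (b : R) : trigfun L f -> 0 <= b <= L ->
  f (b *: edir R i + x) <= L^-1 * \int[leb]_(s in I0L) f (s *: edir R i + x) +
  \int[leb]_(s in I0L) `|partial i f (s *: edir R i + x)|.
Proof.
move=> Tf b0L; set K := \int[leb]_(s in I0L) `|_|.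
have If := bmfun_line i x (trigfun_bmfun Tf).
rewrite -lerBlDr ler_pdivlMl// mulrBr [L * K]mulrC -cst_integral [L * _]mulrC.
rewrite -cst_integral lerBlDr -RintegralD//; last first.
  exact: (bmfun_line i x (bmfun_cst K)).
apply: le_Rintegral => //.
- exact: (bmfun_line i x (bmfun_cst _)).
- exact: (integrableD mI0L If (bmfun_line i x (bmfun_cst K))).
- move=> a; rewrite /I0L /= in_itv/= => a0L.
  have := trigfun_line_osc i x Tf a0L b0L; rewrite -/K.
  by rewrite ler_norml => /andP[_]; rewrite lerBlDl addrC.
Qed.

Lemma trigfun_sup_y f (x y : R) : trigfun L f -> 0 <= y <= L ->
  f (x, y) <= L^-1 * inty L f x + inty L (fun z => `|partial 1 f z|) x.
Proof.
move=> Tf y0L; have := trigfun_line_sup 1 (x, 0) Tf y0L; rewrite edir1E.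
have e (h : R * R -> R) : (fun s => h (s *: edir R 1 + (x, 0))) = (fun s => h (x, s)).
  by apply/funext => s; rewrite edir1E.
by rewrite (e f) (e (fun z => `|partial 1 f z|)).
Qed.

Lemma trigfun_sup_x f (y x : R) : trigfun L f -> 0 <= x <= L ->
  f (x, y) <= L^-1 * intx L f y + intx L (fun z => `|partial 0 f z|) y.
Proof.
move=> Tf x0L; have := trigfun_line_sup 0 (0, y) Tf x0L; rewrite edir0E.
have e (h : R * R -> R) : (fun s => h (s *: edir R 0 + (0, y))) = (fun s => h (s, y)).
  by apply/funext => s; rewrite edir0E.
by rewrite (e f) (e (fun z => `|partial 0 f z|)).
Qed.

Lemma int_separated (A B : R -> R) : bmfun (fun z => A z.1 * B z.2) ->
  leb.-integrable I0L (EFin \o A) -> leb.-integrable I0L (EFin \o B) ->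
  \int[area2 R]_(z in torus L) (A z.1 * B z.2) =
    \int[leb]_(x in I0L) A x * \int[leb]_(y in I0L) B y.
Proof.
move=> bAB IA IB; rewrite -(RintegralZr _ mI0L IA) (torus_fubini_y L_gt0 bAB).
by apply: eq_Rintegral => x _; rewrite -(RintegralZl (A x) mI0L IB).
Qed.

(* Each of the two factors [g^2] is bounded by its line average plus the
   total variation along one coordinate line. *)
Lemma trig_ladyzhenskaya g : trigfun L g ->
  \int[area2 R]_(z in torus L) (g z ^+ 2 * g z ^+ 2) <=
  (L^-1 * \int[area2 R]_(z in torus L) (g z ^+ 2) +
   \int[area2 R]_(z in torus L) `|partial 0 (fun z => g z ^+ 2) z|) *
  (L^-1 * \int[area2 R]_(z in torus L) (g z ^+ 2) +
   \int[area2 R]_(z in torus L) `|partial 1 (fun z => g z ^+ 2) z|).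
Proof.
pose G z := g z ^+ 2.
pose h i := \int[area2 R]_(z in torus L) `|partial i G z|.
pose m := L^-1 * \int[area2 R]_(z in torus L) (g z ^+ 2).
move=> Tg; rewrite -/m -/(h 0) -/(h 1).
have TG : trigfun L G.
  by rewrite /G; under eq_fun do rewrite expr2; exact: trigfunM.
have BG := trigfun_bmfun TG.
have BdG i : bmfun (fun z => `|partial i G z|).
  exact: bmfun_norm (trigfun_bmfun (trigfun_partial i TG)).
have G0 z : 0 <= G z by exact: sqr_ge0.
(* [A x] dominates [G (x, y)] for all [y] in the cell and [B y] dominates it for all [x], so the
   integral of [G ^+ 2] is at most that of [A x * B y], which separates. *)
pose A x := L^-1 * inty L G x + inty L (fun z => `|partial 1 G z|) x.
pose B y := L^-1 * intx L G y + intx L (fun z => `|partial 0 G z|) y.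
have dG0 i (z : R * R) : 0 <= `|partial i G z| by [].
have [mGy [CG CG0 HCG]] := inty_bounded L_gt0 BG G0.
have [mdGy [DG DG0 HDG]] := inty_bounded L_gt0 (BdG 1) (dG0 1).
have [mGx [CG' CG'0 HCG']] := intx_bounded L_gt0 BG G0.
have [mdGx [DG' DG'0 HDG']] := intx_bounded L_gt0 (BdG 0) (dG0 0).
have Li_gt0 : 0 < L^-1 by rewrite invr_gt0.
have mA : measurable_fun setT (A : measurableTypeR R -> R).
  exact: (measurable_funD (measurable_funM (measurable_cst L^-1) mGy) mdGy).
have mB : measurable_fun setT (B : measurableTypeR R -> R).
  exact: (measurable_funD (measurable_funM (measurable_cst L^-1) mGx) mdGx).
have bmA : bmfun (fun z => A z.1).
  split; first exact: (measurableT_comp mA).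
  exists (L^-1 * CG + DG); first by rewrite addr_ge0// mulr_ge0// invr_ge0 ltW.
  move=> z; rewrite (le_trans (ler_normD _ _))// lerD// normrM.
  by rewrite (ger0_norm (ltW Li_gt0)) (ler_pM2l Li_gt0).
have bmB : bmfun (fun z => B z.2).
  split; first exact: (measurableT_comp mB).
  exists (L^-1 * CG' + DG'); first by rewrite addr_ge0// mulr_ge0// invr_ge0 ltW.
  move=> z; rewrite (le_trans (ler_normD _ _))// lerD// normrM.
  by rewrite (ger0_norm (ltW Li_gt0)) (ler_pM2l Li_gt0).
have bmAB := bmfunM bmA bmB.
have IA : leb.-integrable I0L (EFin \o A) := bmfun_section1 L_gt0 0 bmA.
have IB : leb.-integrable I0L (EFin \o B) := bmfun_section2 L_gt0 0 bmB.
have BmdG i : bmfun (fun z => `|partial i G z|) := BdG i.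
have cstb (a : R) f : leb.-integrable I0L (EFin \o f) ->
  leb.-integrable I0L (EFin \o (fun x => a * f x)).
  by move=> If; exact: (integrableZl mI0L a If).
have mbint f : measurable_fun setT (f : measurableTypeR R -> R) ->
    (exists2 C, 0 <= C & forall x, `|f x| <= C) -> leb.-integrable I0L (EFin \o f).
  move=> mf [C _ HC]; apply: (@bounded_integrable _ _ _ _ _ _ _ _ C) => //.
  exact: measurable_funS mf.
have EA : \int[leb]_(x in I0L) A x = m + h 1.
  have I1 := mbint _ mGy (ex_intro2 _ _ CG CG0 HCG).
  have I2 := mbint _ mdGy (ex_intro2 _ _ DG DG0 HDG).
  rewrite (RintegralD mI0L (cstb L^-1 _ I1) I2) (RintegralZl _ mI0L I1).
  by rewrite /m /h (torus_fubini_y L_gt0 BG) (torus_fubini_y L_gt0 (BdG 1)).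
have EB : \int[leb]_(y in I0L) B y = m + h 0.
  have I1 := mbint _ mGx (ex_intro2 _ _ CG' CG'0 HCG').
  have I2 := mbint _ mdGx (ex_intro2 _ _ DG' DG'0 HDG').
  rewrite (RintegralD mI0L (cstb L^-1 _ I1) I2) (RintegralZl _ mI0L I1).
  by rewrite /m /h (torus_fubini_x L_gt0 BG) (torus_fubini_x L_gt0 (BdG 0)).
have E := int_separated bmAB IA IB.
have E2 := etrans E (etrans (f_equal2 *%R EA EB) (mulrC _ _)).
rewrite -[leRHS]E2.
apply: le_Rintegral.
- exact: measurable_torus.
- exact: (bmfun_integrable L_gt0 (bmfunM BG BG)).
- exact: (bmfun_integrable L_gt0 bmAB).
- move=> [x y] [/= ] ; rewrite !in_itv/= => x0L y0L.
  apply: ler_pM => //; rewrite -/(G (x, y)) //.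
  + exact: (trigfun_sup_y x TG y0L).
  + exact: (trigfun_sup_x y TG x0L).
Qed.

End Ladyzhenskaya.

(** * Fourier coefficients *)

Section Modes.
Variable R : realType.

Lemma knorm_ge0 (k : int * int) : 0 <= knorm R k.
Proof. exact: sqrtr_ge0. Qed.

Lemma knorm_sqr (k : int * int) :
  knorm R k ^+ 2 = k.1%:~R ^+ 2 + k.2%:~R ^+ 2.
Proof. by rewrite sqr_sqrtr// addr_ge0// sqr_ge0. Qed.

Lemma knormN (k : int * int) : knorm R (- k) = knorm R k.
Proof. by rewrite /knorm /= !mulrNz !sqrrN. Qed.

Lemma finite_knorm_lt (N : R) : finite_set [set k : int * int | knorm R k < N].
Proof.
pose m := Num.bound `|N|.
have Nm : N <= m%:R := le_trans (ler_norm N) (ltW (archi_boundP (normr_ge0 _))).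
have fz : finite_set [set z : int | (`|z| <= m)%N].
  (* [Negz i] is [-(i+1)], so the list runs from [-(m+1)] to [m]; the extra value is harmless for a
     finite superset. *)
  pose s := [seq Posz i | i <- iota 0 m.+1] ++ [seq Negz i | i <- iota 0 m.+1].
  apply: (@sub_finite_set _ _ [set` s]); last exact: finite_seq.
  move=> z zm; suff: z \in s by [].
  rewrite mem_cat; case: z zm => n nm; apply/orP; [left|right]; apply: map_f;
    rewrite mem_iota add0n; first exact: nm.
  exact: leqW nm.
apply: sub_finite_set (finite_setX fz fz) => -[a b] /= kN.
have lem (z : int) : z%:~R ^+ 2 <= knorm R (a, b) ^+ 2 -> (`|z| <= m)%N.
  move=> H; have : `|z%:~R| <= knorm R (a, b) :> R.
    by rewrite -(@ler_pXn2r _ 2)// ?nnegrE ?knorm_ge0// real_normK ?num_real.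
  move/le_trans => /(_ _ (ltW (lt_le_trans kN Nm))).
  by rewrite -intr_norm -[m%:R]/((m%:Z)%:~R) ler_int -lez_nat abszE.
by split; apply: lem; rewrite knorm_sqr /= ?lerDl ?lerDr sqr_ge0.
Qed.

Definition modes (N : R) := fset_set [set k : int * int | knorm R k < N].

Lemma mem_modes N k : (k \in modes N) = (knorm R k < N).
Proof.
rewrite in_fset_set; last exact: finite_knorm_lt.
by apply/idP/idP; rewrite inE.
Qed.

Lemma sum_delta (N : R) l (F : int * int -> R) : knorm R l < N ->
  \sum_(k <- modes N) (k == l)%:R * F k = F l.
Proof.
move=> lN; rewrite (big_fsetD1 l) ?mem_modes//= eqxx mul1r big1_fset ?addr0// => k.
by rewrite in_fsetD1 => /andP[/negbTE-> _] _; rewrite mul0r.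
Qed.

End Modes.

Section Fourier.
Variables (R : realType) (L : R).
Hypothesis L_gt0 : 0 < L.
Implicit Types (f g h q w : R * R -> R) (k l : int * int) (i : 'I_2).

Definition sq f := sqint (area2 R) (torus L) f.
Definition sip f g := ipl2 (area2 R) (torus L) f g.
Definition snorm f := Num.sqrt (sip f f).

Let mT := @measurable_torus R L.

Lemma sqD f g : sq f -> sq g -> sq (f + g).
Proof. exact: (sqintD mT). Qed.
Lemma sqZ a f : sq f -> sq (a *: f).
Proof. exact: (sqintZ mT). Qed.
Lemma sqB f g : sq f -> sq g -> sq (f - g).
Proof. exact: (sqintB mT). Qed.
Lemma sipC f g : sip f g = sip g f.
Proof. exact: ipl2C. Qed.
Lemma sipD f g h : sq f -> sq g -> sq h -> sip (f + g) h = sip f h + sip g h.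
Proof. exact: (ipl2D mT). Qed.
Lemma sipZ a f g : sq f -> sq g -> sip (a *: f) g = a * sip f g.
Proof. exact: (ipl2Z mT). Qed.
Lemma sip_ge0 f : sq f -> 0 <= sip f f.
Proof. by move=> _; exact: ipl2_ge0. Qed.
Lemma sq_trig f : trigfun L f -> sq f.
Proof. by move=> Tf; exact: (bmfun_sqint L_gt0 (trigfun_bmfun Tf)). Qed.

Lemma sipB f g h : sq f -> sq g -> sq h -> sip (f - g) h = sip f h - sip g h.
Proof.
by move=> sf sg sh; rewrite -scaleN1r sipD ?sipZ ?mulN1r//; exact: sqZ.
Qed.

Lemma snorm_sqr f : snorm f ^+ 2 = sip f f.
Proof. by rewrite sqr_sqrtr//; exact: ipl2_ge0. Qed.

Lemma sip_CS f g : sq f -> sq g -> `|sip f g| <= snorm f * snorm g.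
Proof. exact: (seminner_CSn sqD sqZ sipC sipD sipZ sip_ge0). Qed.

Lemma sq0 : sq 0. Proof. exact/sq_trig/trigfun0. Qed.

Lemma sip0l f : sip 0 f = 0.
Proof.
rewrite /sip /ipl2 (_ : (fun x => _) = (fun=> 0)); last first.
  by apply/funext => x; exact: mul0r.
by rewrite (Rintegral_cst _ mT) mul0r.
Qed.

Lemma sq_sum (s : seq (int * int)) (F : int * int -> R * R -> R) :
  (forall k, sq (F k)) -> sq (fun x => \sum_(k <- s) F k x).
Proof.
move=> sF; elim: s => [|k s IH].
  by under eq_fun do rewrite big_nil; exact: sq0.
by under eq_fun do rewrite big_cons; exact: (sqD (sF k) IH).
Qed.

Lemma sip_sum (s : seq (int * int)) (F : int * int -> R * R -> R) h :
  (forall k, sq (F k)) -> sq h ->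
  sip (fun x => \sum_(k <- s) F k x) h = \sum_(k <- s) sip (F k) h.
Proof.
move=> sF sh; elim: s => [|k s IH].
  rewrite big_nil (_ : (fun x => _) = 0 *: h) ?sipZ ?mul0r//.
  by apply/funext => x; rewrite big_nil [RHS]mul0r.
rewrite big_cons -IH -(sipD (sF k) (sq_sum s sF) sh); congr sip.
by apply/funext => x; rewrite big_cons.
Qed.

Definition ck k x := cos (phase L k x).
Definition sk k x := sin (phase L k x).

Lemma ck_trig k : trigfun L (ck k). Proof. exact: trigfun_cos. Qed.
Lemma sk_trig k : trigfun L (sk k). Proof. exact: trigfun_sin. Qed.
Hint Resolve ck_trig sk_trig : core.

Lemma area_gt0 : 0 < area L. Proof. by rewrite exprn_gt0. Qed.
Lemma kappa0_gt0 : 0 < kappa0 L.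
Proof. by rewrite divr_gt0// mulr_gt0// pi_gt0. Qed.

(** For nonzero [k] some component of [k] is nonzero, and the sine is then a nonzero multiple of a
    partial derivative of the cosine, whose integral vanishes. *)
Lemma int_sk k : \int[area2 R]_(x in torus L) sk k x = 0.
Proof.
have [/eqP k0|k0] := boolP (k == 0).
  have -> : sk k = (fun=> 0) by apply/funext => x; rewrite /sk k0 phase0 sin0.
  by rewrite (Rintegral_cst _ mT) mul0r.
have [i ki] : exists i, wavenum R k i != 0.
  have [k1|k1] := eqVneq k.1 0; [exists 1|exists 0]; rewrite /wavenum/= intr_eq0//.
  by apply: contra k0 => /eqP; case: k k1 => a b /= -> ->.
have := int_partial L_gt0 i (ck_trig k).
rewrite (partial_cos L k i).
have Ik := bmfun_integrable L_gt0 (trigfun_bmfun (sk_trig k)).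
rewrite (RintegralZl _ mT Ik) => /eqP.
by rewrite mulf_eq0 oppr_eq0 mulf_eq0 (negbTE ki) (gt_eqF kappa0_gt0) => /eqP.
Qed.

Lemma int_ck k : \int[area2 R]_(x in torus L) ck k x = area L * (k == 0)%:R.
Proof.
have [/eqP k0|k0] := boolP (k == 0).
  have -> : ck k = (fun=> 1) by apply/funext => x; rewrite /ck k0 phase0 cos0.
  rewrite (Rintegral_cst _ mT) mul1r mulr1; exact: (congr1 fine (area2_torus L_gt0)).
rewrite mulr0.
have [i ki] : exists i, wavenum R k i != 0.
  have [k1|k1] := eqVneq k.1 0; [exists 1|exists 0]; rewrite /wavenum/= intr_eq0//.
  by apply: contra k0 => /eqP; case: k k1 => a b /= -> ->.
have := int_partial L_gt0 i (sk_trig k).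
rewrite (partial_sin L k i).
have Ik := bmfun_integrable L_gt0 (trigfun_bmfun (ck_trig k)).
rewrite (RintegralZl _ mT Ik) => /eqP.
by rewrite mulf_eq0 mulf_eq0 (negbTE ki) (gt_eqF kappa0_gt0) => /eqP.
Qed.

Let itrig f : trigfun L f -> (area2 R).-integrable (torus L) (EFin \o f).
Proof. by move=> Tf; exact: (bmfun_integrable L_gt0 (trigfun_bmfun Tf)). Qed.

Let int_half f g : trigfun L f -> trigfun L g ->
  \int[area2 R]_(x in torus L) (2^-1 * (f x + g x)) =
  2^-1 * (\int[area2 R]_(x in torus L) f x + \int[area2 R]_(x in torus L) g x).
Proof.
move=> Tf Tg; rewrite (RintegralZl _ mT (itrig (trigfunD Tf Tg))).
by rewrite (RintegralD mT (itrig Tf) (itrig Tg)).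
Qed.

(** Modes [k] and [-k] carry the same cosine, hence two Kronecker symbols; at [k = l = 0] both are 1
    and the value is the full area. *)
Lemma sip_ck_ck k l :
  sip (ck k) (ck l) = area L * (2^-1 * ((k == l)%:R + (k == - l)%:R)).
Proof.
rewrite /sip /ipl2 (_ : (fun x => ck k x * ck l x) =
    (fun x => 2^-1 * (ck (k + l) x + ck (k - l) x))); last first.
  by apply/funext => x; rewrite /ck !phaseDl phaseNl cosM.
rewrite int_half// !int_ck subr_eq0 addr_eq0; ring.
Qed.

Lemma sip_sk_sk k l :
  sip (sk k) (sk l) = area L * (2^-1 * ((k == l)%:R - (k == - l)%:R)).
Proof.
rewrite /sip /ipl2 (_ : (fun x => sk k x * sk l x) =
    (fun x => 2^-1 * (ck (k - l) x + (-1) * ck (k + l) x))); last first.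
  by apply/funext => x; rewrite /ck /sk !phaseDl phaseNl sinM mulN1r.
rewrite int_half//; last exact: trigfunZ.
rewrite (RintegralZl _ mT (itrig (ck_trig _))) !int_ck subr_eq0 addr_eq0; ring.
Qed.

Lemma sip_sk_ck k l : sip (sk k) (ck l) = 0.
Proof.
rewrite /sip /ipl2 (_ : (fun x => sk k x * ck l x) =
    (fun x => 2^-1 * (sk (k + l) x + sk (k - l) x))); last first.
  by apply/funext => x; rewrite /ck /sk !phaseDl phaseNl sincosM.
by rewrite int_half// !int_sk addr0 mulr0.
Qed.

Lemma fcosE g k : fcos L g k = (area L)^-1 * sip g (ck k). Proof. by []. Qed.
Lemma fsinE g k : fsin L g k = (area L)^-1 * sip g (sk k). Proof. by []. Qed.

Lemma sip_fcos g k : sip g (ck k) = area L * fcos L g k.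
Proof. by rewrite fcosE mulVKf// gt_eqF// area_gt0. Qed.
Lemma sip_fsin g k : sip g (sk k) = area L * fsin L g k.
Proof. by rewrite fsinE mulVKf// gt_eqF// area_gt0. Qed.

Definition sPN (N : R) g : R * R -> R := fun x =>
  \sum_(k <- modes N) (fcos L g k * ck k x + fsin L g k * sk k x).

Lemma PN_sPN N u j : PN L N u j = sPN N (u j).
Proof.
by apply/funext => x; rewrite /PN /sPN fsbig_finite//; exact: finite_knorm_lt.
Qed.

Lemma sPN_trig N g : trigfun L (sPN N g).
Proof. by apply: trigfun_sum => k; apply: trigfunD; exact: trigfunZ. Qed.
Hint Resolve sPN_trig : core.

Lemma sPN_lin N a f g : sq f -> sq g -> sPN N (a *: f + g) = a *: sPN N f + sPN N g.
Proof.
move=> sf sg; apply/funext => x.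
rewrite -[RHS]/(a * sPN N f x + sPN N g x) /sPN mulr_sumr -big_split/=.
apply: eq_bigr => k _; rewrite !fcosE !fsinE.
rewrite !(sipD (sqZ _ sf) sg) ?(sipZ _ sf); try exact: sq_trig.
ring.
Qed.

(** The terms [k = l] and [k = -l] of the projection each return half of the cosine, and both are
    kept because [knorm] is even. *)
Lemma sPN_ck N l : knorm R l < N -> sPN N (ck l) = ck l.
Proof.
move=> lN; apply/funext => x; rewrite /sPN.
transitivity (\sum_(k <- modes N) ((k == l)%:R * (2^-1 * ck k x) +
    (k == - l)%:R * (2^-1 * ck k x))).
  apply: eq_bigr => k _; rewrite fcosE fsinE sip_ck_ck sipC sip_sk_ck.
  rewrite [l == k]eq_sym [l == - k]eq_sym eqr_oppLR.
  by field; rewrite gt_eqF// area_gt0.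
by rewrite big_split/= !sum_delta ?knormN// /ck phaseNl cosN; field.
Qed.

Lemma sPN_sk N l : knorm R l < N -> sPN N (sk l) = sk l.
Proof.
move=> lN; apply/funext => x; rewrite /sPN.
transitivity (\sum_(k <- modes N) ((k == l)%:R * (2^-1 * sk k x) +
    (k == - l)%:R * (- 2^-1 * sk k x))).
  apply: eq_bigr => k _; rewrite fcosE fsinE sip_sk_sk sip_sk_ck.
  rewrite [l == k]eq_sym [l == - k]eq_sym eqr_oppLR.
  by field; rewrite gt_eqF// area_gt0.
by rewrite big_split/= !sum_delta ?knormN// /sk phaseNl sinN; field.
Qed.

(** This replaces a notion of degree: a trigonometric polynomial is fixed by every sufficiently
    large projection. *)
Lemma sPN_trig_id q : trigfun L q ->
  exists M0, forall M, M0 <= M -> sPN M q = q.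
Proof.
elim=> [k|k|f g Tf [M1 H1] Tg [M2 H2]|a f Tf [M1 H1]].
- exists (knorm R k + 1) => M kM; apply: sPN_ck; lra.
- exists (knorm R k + 1) => M kM; apply: sPN_sk; lra.
- exists (Num.max M1 M2) => M; rewrite ge_max => /andP[M1M M2M].
  have := sPN_lin M 1 (sq_trig Tf) (sq_trig Tg).
  by rewrite !scale1r H1// H2.
- exists M1 => M M1M; have := sPN_lin M a (sq_trig Tf) sq0.
  have -> : a *: f + 0 = (fun x => a * f x) by rewrite addr0.
  rewrite H1// => ->.
  have -> : sPN M 0 = 0.
    apply/funext => x; rewrite /sPN big1// => k _; rewrite fcosE fsinE.
    by rewrite !sip0l !mulr0 !mul0r addr0.
  by rewrite addr0.
Qed.

Lemma sip_sPN N g h : sq g -> sq h -> sip (sPN N g) h =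
  area L * \sum_(k <- modes N) (fcos L g k * fcos L h k + fsin L g k * fsin L h k).
Proof.
move=> sg sh; rewrite /sPN sip_sum//; last first.
  by move=> k; apply: sq_trig; apply: trigfunD; exact: trigfunZ.
rewrite mulr_sumr; apply: eq_bigr => k _.
have -> : (fun x => fcos L g k * ck k x + fsin L g k * sk k x) =
    fcos L g k *: ck k + fsin L g k *: sk k by [].
have [s1 s2] := (sq_trig (ck_trig k), sq_trig (sk_trig k)).
rewrite (sipD (sqZ _ s1) (sqZ _ s2) sh) !sipZ// ![sip _ h]sipC sip_fcos sip_fsin.
ring.
Qed.

Lemma sPN_sym N g h : sq g -> sq h -> sip (sPN N g) h = sip g (sPN N h).
Proof.
move=> sg sh; rewrite sip_sPN// [RHS]sipC sip_sPN//.
by congr (_ * _); apply: eq_bigr => k _; ring.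
Qed.

Lemma fcos_sPN N g k : sq g -> knorm R k < N -> fcos L (sPN N g) k = fcos L g k.
Proof.
move=> sg kN; rewrite !fcosE sPN_sym//; last exact: sq_trig.
by rewrite sPN_ck.
Qed.

Lemma fsin_sPN N g k : sq g -> knorm R k < N -> fsin L (sPN N g) k = fsin L g k.
Proof.
move=> sg kN; rewrite !fsinE sPN_sym//; last exact: sq_trig.
by rewrite sPN_sk.
Qed.

Lemma sPN_idem N g : sq g -> sPN N (sPN N g) = sPN N g.
Proof.
move=> sg; apply/funext => x; rewrite /sPN; rewrite big_seq [RHS]big_seq.
apply: eq_bigr => k; rewrite mem_modes => kN.
by rewrite -/(sPN N g) fcos_sPN// fsin_sPN.
Qed.

Lemma sip_sPN_sPN N g h : sq g -> sq h ->
  sip (sPN N g) (sPN N h) = sip (sPN N g) h.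
Proof. by move=> sg sh; rewrite -sPN_sym ?sPN_idem//; exact: sq_trig. Qed.

Lemma sip_sPN_le N g : sq g -> sip (sPN N g) (sPN N g) <= sip g g.
Proof.
move=> sg; have sp := sq_trig (sPN_trig N g).
have := sip_ge0 (sqB sg sp).
rewrite sipB// ?[sip _ (g - _)]sipC ?sipB//; try exact: sqB.
by rewrite sip_sPN_sPN// [sip g (sPN N g)]sipC; lra.
Qed.

Definition coefsq g k := fcos L g k ^+ 2 + fsin L g k ^+ 2.

Lemma sip_sPN_coef N g : sq g ->
  sip (sPN N g) (sPN N g) = area L * \sum_(k <- modes N) coefsq g k.
Proof.
by move=> sg; rewrite sip_sPN_sPN// sip_sPN.
Qed.

(** A weak derivative tested only against trigonometric polynomials, which is enough to determine
    Fourier coefficients and suits periodic functions. *)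
Definition wpartial i w g := forall q, trigfun L q -> sip g q = - sip w (partial i q).

Lemma trig_wpartial i q : trigfun L q -> wpartial i q (partial i q).
Proof.
move=> Tq r Tr; apply/eqP; rewrite -addr_eq0; apply/eqP.
rewrite /sip /ipl2 -(RintegralD mT); first last.
- exact: itrig (trigfunM Tq (trigfun_partial i Tr)).
- exact: itrig (trigfunM (trigfun_partial i Tq) Tr).
by rewrite -[RHS](int_partial L_gt0 i (trigfunM Tq Tr)) (partialM i Tq Tr).
Qed.

Lemma fcos_wpartial i w g k : sq w -> wpartial i w g ->
  fcos L g k = kappa0 L * wavenum R k i * fsin L w k.
Proof.
move=> sw H; rewrite fcosE H// (partial_cos L k i).
have -> : (fun x => - (kappa0 L * wavenum R k i) * sin (phase L k x)) =
  (- (kappa0 L * wavenum R k i)) *: sk k by [].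
rewrite sipC sipZ//; last exact: sq_trig.
by rewrite [sip _ w]sipC fsinE; ring.
Qed.

Lemma fsin_wpartial i w g k : sq w -> wpartial i w g ->
  fsin L g k = - (kappa0 L * wavenum R k i * fcos L w k).
Proof.
move=> sw H; rewrite fsinE H// (partial_sin L k i).
have -> : (fun x => (kappa0 L * wavenum R k i) * cos (phase L k x)) =
  (kappa0 L * wavenum R k i) *: ck k by [].
rewrite sipC sipZ//; last exact: sq_trig.
by rewrite [sip _ w]sipC fcosE; ring.
Qed.

Lemma coefsq_grad w G k : sq w -> (forall i, wpartial i w (G i)) ->
  \sum_(i < 2) coefsq (G i) k = kappa0 L ^+ 2 * knorm R k ^+ 2 * coefsq w k.
Proof.
move=> sw H; rewrite !big_ord_recl big_ord0 /coefsq.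
rewrite !(fcos_wpartial _ sw (H _)) !(fsin_wpartial _ sw (H _)) knorm_sqr.
by rewrite /wavenum/=; ring.
Qed.

Definition trig_approx w := forall e, 0 < e -> exists2 q, trigfun L q & snorm (q - w) <= e.

(** Completeness of the Fourier modes, obtained for functions that are approximable by definition: a
    large projection fixes the approximant. *)
Lemma sPN_exhaust w : sq w -> trig_approx w -> forall e, 0 < e ->
  exists M0, forall M, M0 <= M -> sip w w <= sip (sPN M w) (sPN M w) + e.
Proof.
move=> sw aw e e0; pose e' := e / (2 * snorm w + 1).
have w1 : 0 < 2 * snorm w + 1 by rewrite ltr_wpDl// mulr_ge0// sqrtr_ge0.
have e'0 : 0 < e' by rewrite divr_gt0.
have [q Tq qw] := aw _ e'0; have [M0 HM] := sPN_trig_id Tq.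
exists M0 => M /HM qM; have sp := sq_trig (sPN_trig M w); have sqq := sq_trig Tq.
have E : sip w w - sip (sPN M w) (sPN M w) = sip (q - w) (sPN M w) - sip (q - w) w.
  have e1 : sip q (sPN M w) = sip q w by rewrite -(sPN_sym M sqq sw) qM.
  have e2 : sip (sPN M w) (sPN M w) = sip w (sPN M w) by rewrite sip_sPN_sPN// sipC.
  by rewrite (sipB sqq sw sp) (sipB sqq sw sw) e1 e2; ring.
have sd := sqB sqq sw.
have pw : snorm (sPN M w) <= snorm w by rewrite ler_wsqrtr// sip_sPN_le.
have := sip_CS sd sp; have := sip_CS sd sw; rewrite !ler_norml.
move=> /andP[H1 _] /andP[_ H2].
have : snorm (q - w) * (2 * snorm w) <= e.
  rewrite (@le_trans _ _ (e' * (2 * snorm w)))//.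
    by rewrite ler_wpM2r// mulr_ge0// sqrtr_ge0.
  rewrite /e' mulrAC ler_pdivrMr// ler_wpM2l ?ltW//; lra.
have := ler_wpM2l (sqrtr_ge0 _ : 0 <= snorm (q - w)) pw.
lra.
Qed.

Lemma sip_sPN_grad_le N w G : 0 <= N -> sq w -> (forall i, sq (G i)) ->
  (forall i, wpartial i w (G i)) -> trig_approx w ->
  (kappa0 L * N) ^+ 2 * (sip w w - sip (sPN N w) (sPN N w)) <=
  \sum_(i < 2) sip (G i) (G i).
Proof.
move=> N0 sw sG wG aw; apply/ler_addgt0Pr => e e0.
pose K := (kappa0 L * N) ^+ 2.
have K0 : 0 <= K by exact: sqr_ge0.
have K1 : 0 < K + 1 by rewrite ltr_wpDl.
(* The tolerance [e / (K + 1)] is chosen so that it is still at most [e] after multiplication by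
   [K]; the comparison itself takes place among finitely many modes below [M]. *)
have [M0 HM] := sPN_exhaust sw aw (divr_gt0 e0 K1).
pose M := Num.max M0 N; have M0M : M0 <= M by rewrite le_max lexx.
have NM : N <= M by rewrite le_max lexx orbT.
have {HM}H1 := HM _ M0M.
suff H2 : K * (sip (sPN M w) (sPN M w) - sip (sPN N w) (sPN N w)) <=
    \sum_(i < 2) sip (G i) (G i).
  rewrite -/K (le_trans _ (lerD H2 (lexx e)))//.
  have : K * (e / (K + 1)) <= e.
    by rewrite mulrCA ler_piMr ?ltW// ltr_pdivrMr// mul1r ltrDl.
  nra.
apply: (@le_trans _ _ (\sum_(i < 2) sip (sPN M (G i)) (sPN M (G i)))); last first.
  by apply: ler_sum => i _; exact: sip_sPN_le.
have -> : \sum_(i < 2) sip (sPN M (G i)) (sPN M (G i)) =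
    area L * \sum_(k <- modes M) (kappa0 L ^+ 2 * knorm R k ^+ 2 * coefsq w k).
  under eq_bigr => i _ do rewrite sip_sPN_coef//.
  rewrite -mulr_sumr exchange_big/=; congr (_ * _).
  by apply: eq_bigr => k _; exact: coefsq_grad.
rewrite !sip_sPN_coef// -mulrBr mulrCA ler_wpM2l ?(ltW area_gt0)//.
have cge0 k : 0 <= coefsq w k by rewrite addr_ge0// sqr_ge0.
rewrite [X in X - _](bigID (fun k => knorm R k < N))/=.
have -> : \sum_(k <- modes M | knorm R k < N) coefsq w k =
    \sum_(k <- modes N) coefsq w k.
  rewrite -big_filter; apply: perm_big; apply: uniq_perm.
  - exact/filter_uniq/fset_uniq.
  - exact: fset_uniq.
  - move=> k; rewrite mem_filter !mem_modes; apply/andP/idP => [[]//|kN].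
    by split=> //; exact: lt_le_trans NM.
rewrite addrAC subrr add0r mulr_sumr.
rewrite [leRHS](bigID (fun k => knorm R k < N))/=.
apply: ler_wpDl.
  by apply: sumr_ge0 => k _; exact: mulr_ge0 (mulr_ge0 (sqr_ge0 _) (sqr_ge0 _)) (cge0 k).
(* Every mode left has [|k| >= N], so its gradient factor is at least [(kappa0 N)^2]. *)
apply: ler_sum => k; rewrite -leNgt => Nk.
rewrite ler_wpM2r// /K exprMn ler_wpM2l ?sqr_ge0//.
by rewrite lerXn2r// ?nnegrE// knorm_ge0.
Qed.

End Fourier.

(** * Ladyzhenskaya's inequality in H^1 *)

Section Truncation.
Variable R : realType.
Implicit Types (M x y : R).

Definition trunc M x := Num.max (- M) (Num.min M x).

Lemma truncP M x : 0 <= M ->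
  [\/ x < - M /\ trunc M x = - M, - M <= x <= M /\ trunc M x = x |
      M < x /\ trunc M x = M].
Proof.
move=> M0; rewrite /trunc; case: (ltP x (- M)) => [xM|Mx].
  apply: Or31; split=> //; rewrite min_r; last lra.
  by rewrite max_l// ltW.
case: (ltP M x) => [Mx'|xM].
  by apply: Or33; split=> //; rewrite max_r//; lra.
by apply: Or32; split=> //; rewrite ?Mx ?max_r.
Qed.

Lemma trunc_bounded M x : 0 <= M -> `|trunc M x| <= M.
Proof.
by move=> M0; rewrite ler_norml; case: (truncP x M0) => -[H ->]; move: H => *; lra.
Qed.

Lemma trunc_nondecr M M' x : 0 <= M -> M <= M' ->
  trunc M x ^+ 2 <= trunc M' x ^+ 2.
Proof.
move=> M0 MM'; have M'0 := le_trans M0 MM'.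
case: (truncP x M0) => -[H ->]; case: (truncP x M'0) => -[H' ->]; move: H H' => *; nra.
Qed.

Lemma trunc_id M x : `|x| <= M -> trunc M x = x.
Proof.
move=> xM; have M0 := le_trans (normr_ge0 x) xM; move: xM; rewrite ler_norml.
by case: (truncP x M0) => -[H ->]; move: H => *; lra.
Qed.

Lemma trunc_cube_ge0 M x : 0 <= M -> 0 <= trunc M x ^+ 3 * (x - trunc M x).
Proof.
move=> M0; case: (truncP x M0) => -[H ->].
- have : 0 <= M ^+ 3 by exact: exprn_ge0.
  have -> : (- M) ^+ 3 * (x - - M) = M ^+ 3 * (- M - x) by ring.
  by move=> ?; rewrite mulr_ge0//; lra.
- by rewrite subrr mulr0.
- by rewrite mulr_ge0 ?exprn_ge0//; lra.
Qed.

(** Convexity of the fourth power. The left side is affine in [y], so its integral is continuous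
    under L^2 convergence of [y] when [x] is bounded. *)
Lemma quartic_tangent x y :
  x ^+ 2 * x ^+ 2 + 4 * (x ^+ 3 * (y - x)) <= y ^+ 2 * y ^+ 2.
Proof.
rewrite -subr_ge0.
have -> : y ^+ 2 * y ^+ 2 - (x ^+ 2 * x ^+ 2 + 4 * (x ^+ 3 * (y - x))) =
  (y - x) ^+ 2 * ((y + x) ^+ 2 + 2 * x ^+ 2) by ring.
by apply: mulr_ge0; [exact: sqr_ge0|
  apply: addr_ge0; [exact: sqr_ge0|apply: mulr_ge0 => //; exact: sqr_ge0]].
Qed.

End Truncation.

Section TruncIntegral.
Context d (T : measurableType d) (R : realType) (mu : {measure set T -> \bar R}).
Variable D : set T.
Hypotheses (mD : measurable D) (finD : (mu D < +oo)%E).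

Lemma measurable_trunc (M : R) (w : T -> R) : measurable_fun D w ->
  measurable_fun D (fun x => trunc M (w x)).
Proof.
by move=> mw; apply: measurable_maxr => //; exact: measurable_minr.
Qed.

Lemma sqint_trunc (M : R) w : 0 <= M -> measurable_fun D w ->
  sqint mu D (fun x => trunc M (w x)).
Proof.
move=> M0 mw; apply: (bounded_sqint mD finD (C := M)).
  exact: measurable_trunc.
by move=> x _; exact: trunc_bounded.
Qed.

(** Monotone convergence in the truncation height: the truncated quartics increase to the full one,
    so a uniform bound gives integrability and passes to the limit. *)
Lemma sqint_sqr_trunc (w : T -> R) (B : R) : measurable_fun D w ->
  (forall n : nat, \int[mu]_(x in D) (trunc n%:R (w x) ^+ 2 * trunc n%:R (w x) ^+ 2) <= B) ->
  sqint mu D (fun x => w x ^+ 2) /\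
  ipl2 mu D (fun x => w x ^+ 2) (fun x => w x ^+ 2) <= B.
Proof.
move=> mw HB.
pose h (n : nat) x : \bar R := (trunc n%:R (w x) ^+ 2 * trunc n%:R (w x) ^+ 2)%:E.
have mh n : measurable_fun D (h n).
  by apply/measurable_EFinP; apply: measurable_funM;
    apply: measurable_funX; exact: measurable_trunc.
have h0 n x : D x -> (0 <= h n x)%E by move=> _; rewrite lee_fin mulr_ge0 ?sqr_ge0.
have ndh x : D x -> nondecreasing_seq (h ^~ x).
  move=> _ n m nm; rewrite lee_fin ler_pM ?sqr_ge0//;
  by apply: trunc_nondecr => //; rewrite ler_nat.
have := @cvg_monotone_convergence _ _ _ mu D mD h mh h0 ndh.
rewrite (_ : (fun x => limn (h ^~ x)) = (fun x => (w x ^+ 2 * w x ^+ 2)%:E)); last first.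
  apply/funext => x; apply/cvg_lim => //; apply: cvg_near_cst.
  near=> n; rewrite /h trunc_id//.
  by near: n; exact: nbhs_infty_ger.
set I := (\int[mu]_(x in D) (w x ^+ 2 * w x ^+ 2)%:E)%E => cvI.
have hB n : (\int[mu]_(x in D) h n x <= B%:E)%E.
  have Ih : mu.-integrable D (h n).
    have sh := sqint_trunc (ler0n R n) mw.
    apply: (bounded_integrable mD finD (C := (n%:R ^+ 2 * n%:R ^+ 2))).
      by apply: measurable_funM; apply: measurable_funX; exact: measurable_trunc.
    move=> x _; rewrite normrM !normrX.
    have := @trunc_bounded _ n%:R (w x) (ler0n _ _) => tb.
    by rewrite ler_pM ?sqr_ge0// lerXn2r ?nnegrE// ?ler0n.
  rewrite -(fineK (integrable_fin_num mD Ih)) lee_fin; exact: HB.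
have IB : (I <= B%:E)%E.
  rewrite -(cvg_lim _ cvI)//; apply: lime_le; first by apply/cvg_ex; exists I.
  by apply: nearW => n; exact: hB.
have m2 : measurable_fun D (fun x => w x ^+ 2) by exact: measurable_funX.
have I0 : (0 <= I)%E by apply: integral_ge0 => x _; rewrite lee_fin mulr_ge0 ?sqr_ge0.
have Ifin : I \is a fin_num by rewrite ge0_fin_numE// (le_lt_trans IB)// ltry.
split; first split=> //.
  apply/integrableP; split; first by apply/measurable_EFinP; exact: measurable_funX.
  rewrite (le_lt_trans _ (le_lt_trans IB (ltry B)))//.
  rewrite /I le_eqVlt; apply/orP; left; apply/eqP; apply: eq_integral => x _.
  by rewrite gee0_abs ?lee_fin ?sqr_ge0// expr2.
by rewrite /ipl2 /Rintegral -lee_fin fineK.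
Unshelve. all: by end_near. Qed.

End TruncIntegral.

Lemma le_of_sqr (R : realDomainType) (a b : R) : 0 <= b -> a ^+ 2 <= b ^+ 2 -> a <= b.
Proof.
by move=> b0 ab; rewrite leNgt; apply/negP => ba; move: ab; apply/negP; rewrite -ltNge; nra.
Qed.

(** [n], [a], [b] are the norms of a function and of its two partial derivatives, [m] the mean term,
    [h0] and [h1] the variation integrals. The product is at most 45/16 of [n^2 (a^2 + b^2)],
    rounded up to 4. *)
Lemma L4_arith (R : rcfType) (n a b m h0 h1 : R) :
  0 <= n -> 0 <= a -> 0 <= b -> 0 <= m -> 0 <= h0 -> 0 <= h1 ->
  h0 <= 2 * (n * a) -> h1 <= 2 * (n * b) -> m <= n * Num.sqrt (a ^+ 2 + b ^+ 2) / 4 ->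
  (m + h0) * (m + h1) <= 4 * (n ^+ 2 * (a ^+ 2 + b ^+ 2)).
Proof.
move=> n0 a0 b0 m0 h00 h10 h0le h1le; set s := Num.sqrt _ => mle.
have s0 : 0 <= s by exact: sqrtr_ge0.
have s2 : s ^+ 2 = a ^+ 2 + b ^+ 2 by rewrite sqr_sqrtr// addr_ge0// sqr_ge0.
rewrite -s2.
have H1 : (m + h0) * (m + h1) <= (n * s / 4 + 2 * (n * a)) * (n * s / 4 + 2 * (n * b)).
  by apply: ler_pM; rewrite ?addr_ge0// lerD.
apply: (le_trans H1).
have -> : (n * s / 4 + 2 * (n * a)) * (n * s / 4 + 2 * (n * b)) =
  n ^+ 2 * (s ^+ 2 / 16 + s * (a + b) / 2 + 4 * (a * b)) by field.
rewrite [leRHS]mulrCA; apply: ler_wpM2l; first exact: sqr_ge0.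
have ab : a * b <= s ^+ 2 / 2 by rewrite s2; have := sqr_ge0 (a - b); nra.
have sab : s * (a + b) <= s ^+ 2 * (3 / 2).
  rewrite expr2 -mulrA ler_wpM2l//.
  apply: le_of_sqr; first by rewrite mulr_ge0.
  by rewrite exprMn s2; have := sqr_ge0 (a - b); nra.
have := sqr_ge0 s; lra.
Qed.

(** Poincare turns the mean term into a gradient term; the divisor 4 comes from [2 pi >= 4]. *)
Lemma mean_arith (R : realType) (L n s : R) : 0 < L -> 0 <= n ->
  2 * pi / L * n <= s -> L^-1 * n ^+ 2 <= n * s / 4.
Proof.
move=> L0 n0 P; have {}P : 2 * pi * (n / L) <= s by rewrite mulrA mulrAC.
have pi2 := @pi_ge2 R.
have nL0 : 0 <= n / L by rewrite divr_ge0// ltW.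
have P4 : 4 * (n / L) <= s by apply: (le_trans _ P); apply: ler_wpM2r => //; lra.
have -> : L^-1 * n ^+ 2 = n * (n / L) by ring.
by have := ler_wpM2l n0 P4; lra.
Qed.

Lemma cvg_sqr (R : realType) (F : nat -> R) (l : R) :
  F n @[n --> \oo] --> l -> F n ^+ 2 @[n --> \oo] --> l ^+ 2.
Proof. by move=> Fl; rewrite expr2; under eq_fun do rewrite expr2; exact: cvgM. Qed.

Section H1.
Variables (R : realType) (L : R).
Hypothesis L_gt0 : 0 < L.
Implicit Types (f g h q w : R * R -> R) (k l : int * int) (i : 'I_2).
Let mT := @measurable_torus R L.
Let finT := @area2_torus_lty R L L_gt0.

Lemma snorm_cvg (F : nat -> R * R -> R) g : (forall n, sq L (F n)) -> sq L g ->
  snorm L (F n - g) @[n --> \oo] --> (0 : R) ->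
  snorm L (F n) @[n --> \oo] --> snorm L g.
Proof.
exact: (seminner_cvg_norm (@sqD _ _) (@sqZ _ _) (@sipC _ _) (@sipD _ _)
  (@sipZ _ _) (@sip_ge0 _ _)).
Qed.

Lemma sip_cvg (F : nat -> R * R -> R) g h : (forall n, sq L (F n)) -> sq L g ->
  sq L h -> snorm L (F n - g) @[n --> \oo] --> (0 : R) ->
  sip L (F n) h @[n --> \oo] --> sip L g h.
Proof.
exact: (seminner_cvg (@sqD _ _) (@sqZ _ _) (@sipC _ _) (@sipD _ _)
  (@sipZ _ _) (@sip_ge0 _ _)).
Qed.

(** The scalar counterpart of [V_gradient], without the divergence condition, so that Poincare and
    Ladyzhenskaya can be applied to each component. [ck L 0] is the constant 1, so the approximants
    have mean zero. *)
Definition h1fun w (G : 'I_2 -> R * R -> R) :=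
  [/\ sq L w, forall i, sq L (G i), forall i, wpartial L i w (G i) &
   exists q : nat -> R * R -> R,
   [/\ forall n, trigfun L (q n), forall n, sip L (q n) (ck L 0) = 0,
       snorm L (q n - w) @[n --> \oo] --> (0 : R) &
       forall i, snorm L (partial i (q n) - G i) @[n --> \oo] --> (0 : R)]].

Definition genergy (G : 'I_2 -> R * R -> R) := \sum_(i < 2) sip L (G i) (G i).

Lemma genergyE G : genergy G = snorm L (G 0) ^+ 2 + snorm L (G 1) ^+ 2.
Proof.
rewrite /genergy !big_ord_recl big_ord0 addr0 (_ : lift ord0 ord0 = 1); last exact/val_inj.
by rewrite !snorm_sqr.
Qed.

Lemma genergy_ge0 G : 0 <= genergy G.
Proof. by rewrite genergyE addr_ge0// sqr_ge0. Qed.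

Lemma h1fun_trig q : trigfun L q -> sip L q (ck L 0) = 0 ->
  h1fun q (fun i => partial i q).
Proof.
move=> Tq q0; split=> [|i|i|].
- exact: sq_trig.
- exact: (sq_trig L_gt0 (trigfun_partial i Tq)).
- exact: trig_wpartial.
- exists (fun=> q); split=> //.
    rewrite subrr /snorm sip0l sqrtr0; exact: cvg_cst.
  by move=> i; rewrite subrr /snorm sip0l sqrtr0; exact: cvg_cst.
Qed.

Lemma h1fun_mean0 w G : h1fun w G -> sip L w (ck L 0) = 0.
Proof.
move=> [sw _ _ [q [Tq q0 qw _]]].
have sc := sq_trig L_gt0 (ck_trig L 0).
have sqn n := sq_trig L_gt0 (Tq n).
have := sip_cvg sqn sw sc qw.
under eq_fun do rewrite q0.
by move/cvg_lim => <- //; rewrite lim_cst.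
Qed.

Lemma h1fun_tail N w G : 0 <= N -> h1fun w G ->
  (kappa0 L * N) ^+ 2 * (sip L w w - sip L (sPN L N w) (sPN L N w)) <= genergy G.
Proof.
move=> N0 [sw sG wG [q [Tq q0 qw qG]]].
apply: (sip_sPN_grad_le L_gt0 N0 sw sG wG) => e e0.
move/cvgrPdist_le : qw => /(_ _ e0)[n _ /(_ n)] /=.
rewrite leqnn distrC subr0 ger0_norm ?sqrtr_ge0// => /(_ isT) H.
by exists (q n).
Qed.

(** The only integer mode of length below 1 is zero. Hence Poincare's inequality is the tail
    estimate at [N = 1]. *)
Lemma sPN1_mean0 w : sip L w (ck L 0) = 0 -> sPN L 1 w = 0.
Proof.
move=> w0; apply/funext => x; rewrite /sPN big_seq big1// => k.
rewrite mem_modes => k1; have -> : k = 0.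
  apply/eqP; move: k1; rewrite -(@ltr_pXn2r _ 2)// ?nnegrE ?knorm_ge0//.
  rewrite knorm_sqr expr1n -!rmorphXn -intrD ltrz1.
  case: k => a b /= ab.
  have sqr0 (c d : int) : c ^+ 2 + d ^+ 2 < 1 -> c = 0.
    move=> cd; apply/eqP; rewrite -sqrf_eq0 eq_le sqr_ge0 andbT -ltzD1 add0r.
    by rewrite (le_lt_trans _ cd)// lerDl sqr_ge0.
  by rewrite (sqr0 _ _ ab) (sqr0 b a)// addrC.
rewrite fcosE w0 mulr0 mul0r add0r /sk phase0 sin0 mulr0//.
Qed.

Lemma h1fun_poincare w G : h1fun w G ->
  kappa0 L * snorm L w <= Num.sqrt (genergy G).
Proof.
move=> H; have := h1fun_tail ler01 H.
rewrite (sPN1_mean0 (h1fun_mean0 H)) sip0l subr0 mulr1 -snorm_sqr -exprMn.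
move=> H1; apply: le_of_sqr; first exact: sqrtr_ge0.
by rewrite sqr_sqrtr// genergy_ge0.
Qed.

(** The derivative of [q^2] is [2 q] times that of [q], so Cauchy-Schwarz bounds the variation
    integrals, and Poincare disposes of the mean. *)
Lemma trig_L4 q : trigfun L q -> sip L q (ck L 0) = 0 ->
  sip L (fun x => q x ^+ 2) (fun x => q x ^+ 2) <=
  4 * (snorm L q ^+ 2 * genergy (fun i => partial i q)).
Proof.
move=> Tq q0; have sqq := sq_trig L_gt0 Tq.
have sd i := sq_trig L_gt0 (trigfun_partial i Tq).
have := trig_ladyzhenskaya L_gt0 Tq.
pose m := L^-1 * sip L q q.
have -> : L^-1 * \int[area2 R]_(z in torus L) q z ^+ 2 = m.
  by rewrite /m /sip /ipl2; congr (_ * _); apply: eq_Rintegral => x _; rewrite expr2.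
have HI i : 0 <= \int[area2 R]_(z in torus L) `|partial i (fun z => q z ^+ 2) z| <=
    2 * (snorm L q * snorm L (partial i q)).
  apply/andP; split; first exact: Rintegral_ge0.
  have -> : (fun z => q z ^+ 2) = (fun z => q z * q z).
    by apply/funext => z; rewrite expr2.
  rewrite (partialM i Tq Tq).
  pose a x := `|q x|; pose b x := `|partial i q x|.
  have Ba : bmfun a := bmfun_norm (trigfun_bmfun Tq).
  have Bb : bmfun b := bmfun_norm (trigfun_bmfun (trigfun_partial i Tq)).
  have sa : sq L a := bmfun_sqint L_gt0 Ba.
  have sb : sq L b := bmfun_sqint L_gt0 Bb.
  have na : snorm L a = snorm L q.
    by congr Num.sqrt; apply: eq_Rintegral => x _; rewrite -normrM ger0_norm// -expr2 sqr_ge0.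
  have nb : snorm L b = snorm L (partial i q).
    by congr Num.sqrt; apply: eq_Rintegral => x _; rewrite -normrM ger0_norm// -expr2 sqr_ge0.
  have -> : \int[area2 R]_(z in torus L) `|partial i q z * q z + q z * partial i q z| =
      2 * sip L a b.
    rewrite /sip /ipl2 -(RintegralZl _ mT (sqint_mul mT sa sb)).
    apply: eq_Rintegral => x _; rewrite /a /b.
    have -> : partial i q x * q x + q x * partial i q x = 2 * (q x * partial i q x) by ring.
    by rewrite !normrM (ger0_norm (ler0n R 2)).
  rewrite ler_wpM2l// -na -nb (le_trans (ler_norm _))//; exact: sip_CS.
have /andP[h00 h0le] := HI 0; have /andP[h10 h1le] := HI 1.
move=> /le_trans; apply.
have m0 : 0 <= m by apply: mulr_ge0; [rewrite invr_ge0 ltW|exact: sip_ge0].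
rewrite genergyE.
apply: (@L4_arith _ (snorm L q) (snorm L (partial 0 q)) (snorm L (partial 1 q))
  _ _ _ (sqrtr_ge0 _) (sqrtr_ge0 _) (sqrtr_ge0 _) m0 h00 h10 h0le h1le).
have := h1fun_poincare (h1fun_trig Tq q0); rewrite genergyE /m.
have -> : sip L q q = snorm L q ^+ 2 by rewrite snorm_sqr.
by apply: mean_arith => //; exact: sqrtr_ge0.
Qed.

(* An [L^2]-convergent sequence of quartics need not converge in [L^4], so the
   quartic is truncated at height M: [quartic_tangent] bounds the truncated
   integral by the limit of the trigonometric ones, and M then goes to
   infinity. *)
Lemma h1fun_L4 w G : h1fun w G -> sq L (fun x => w x ^+ 2) /\
  sip L (fun x => w x ^+ 2) (fun x => w x ^+ 2) <= 4 * (snorm L w ^+ 2 * genergy G).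
Proof.
move=> [sw sG wG [q [Tq q0 qw qG]]].
apply: (sqint_sqr_trunc mT finT sw.1) => M.
pose h x := trunc M%:R (w x).
have M0 : (0 : R) <= M%:R by exact: ler0n.
have mh : measurable_fun (torus L) h by exact: measurable_trunc sw.1.
have sh : sq L h := sqint_trunc mT finT M0 sw.1.
have sh2 : sq L (fun x => h x ^+ 2).
  apply: (bounded_sqint mT finT (C := M%:R ^+ 2)); first exact: measurable_funX.
  by move=> x _; rewrite normrX lerXn2r ?nnegrE// trunc_bounded.
have sh3 : sq L (fun x => h x ^+ 3).
  apply: (bounded_sqint mT finT (C := M%:R ^+ 3)); first exact: measurable_funX.
  by move=> x _; rewrite normrX lerXn2r ?nnegrE// trunc_bounded.
change (sip L (fun x => h x ^+ 2) (fun x => h x ^+ 2) <= 4 * (snorm L w ^+ 2 * genergy G)).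
set I := sip L _ _.
have sqn n := sq_trig L_gt0 (Tq n).
have sqd n i := sq_trig L_gt0 (trigfun_partial i (Tq n)).
have step n : I + 4 * (sip L (q n) (fun x => h x ^+ 3) - sip L h (fun x => h x ^+ 3)) <=
    4 * (snorm L (q n) ^+ 2 * genergy (fun i => partial i (q n))).
  apply: le_trans (trig_L4 (Tq n) (q0 n)).
  have sq2 : sq L (fun x => q n x ^+ 2).
    by apply: (sq_trig L_gt0); under eq_fun do rewrite expr2; exact: trigfunM.
  rewrite -(sipB (sqn n) sh sh3).
  rewrite /I /sip /ipl2.
  have I1 := sqint_mul mT sh2 sh2.
  have I2 := sqint_mul mT (sqB (sqn n) sh) sh3.
  have I3 := sqint_mul mT sq2 sq2.
  have I4 := integrableZl mT 4 I2.
  rewrite -(RintegralZl _ mT I2) -(RintegralD mT I1 I4).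
  apply: (le_Rintegral mT (integrableD mT I1 I4) I3) => x _.
  have := quartic_tangent (h x) (q n x).
  by rewrite -[(q n - h) x]/(q n x - h x) [(q n x - h x) * _]mulrC.
have c1 := sip_cvg sqn sw sh3 qw.
have c2 := snorm_cvg sqn sw qw.
have c3 i := snorm_cvg (sqd^~ i) (sG i) (qG i).
have cl : I + 4 * (sip L (q n) (fun x => h x ^+ 3) - sip L h (fun x => h x ^+ 3))
    @[n --> \oo] --> I + 4 * (sip L w (fun x => h x ^+ 3) - sip L h (fun x => h x ^+ 3)).
  apply: cvgD; first exact: cvg_cst.
  by apply: cvgM; [exact: cvg_cst|apply: cvgB => //; exact: cvg_cst].
have cr : 4 * (snorm L (q n) ^+ 2 * genergy (fun i => partial i (q n)))
    @[n --> \oo] --> 4 * (snorm L w ^+ 2 * genergy G).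
  have -> : (fun n => 4 * (snorm L (q n) ^+ 2 * genergy (fun i => partial i (q n)))) =
      (fun n => 4 * (snorm L (q n) ^+ 2 * (snorm L (partial 0 (q n)) ^+ 2 +
        snorm L (partial 1 (q n)) ^+ 2))) by apply/funext => n; rewrite genergyE.
  rewrite genergyE; apply: cvgM; first exact: cvg_cst.
  exact: (cvgM (cvg_sqr c2) (cvgD (cvg_sqr (c3 0)) (cvg_sqr (c3 1)))).
have H := ler_cvg_to cl cr (nearW _ step).
apply: (le_trans _ (H _ _)); rewrite lerDl; apply: mulr_ge0 => //.
rewrite -(sipB sw sh sh3) sipC; apply: Rintegral_ge0 => x _; exact: trunc_cube_ge0.
Qed.

End H1.

(** * The spaces H and V *)

Section VectorFields.
Variables (R : realType) (L : R).
Hypothesis L_gt0 : 0 < L.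
Implicit Types (f g h q : R * R -> R) (u v w p : vfield R) (k : int * int) (i j : 'I_2).
Implicit Types G : 'I_2 -> vfield R.
Let mT := @measurable_torus R L.

Lemma sum2 (F : 'I_2 -> R) : \sum_(i < 2) F i = F 0 + F 1.
Proof.
by rewrite !big_ord_recl big_ord0 addr0 (_ : lift ord0 ord0 = 1)//; exact/val_inj.
Qed.

Lemma inL2D u w : inL2 L u -> inL2 L w -> inL2 L (u + w).
Proof. by move=> hu hw j; exact: (sqD (hu j) (hw j)). Qed.
Lemma inL2Z a u : inL2 L u -> inL2 L (a *: u).
Proof. by move=> hu j; exact: (sqZ a (hu j)). Qed.
Lemma inL2B u w : inL2 L u -> inL2 L w -> inL2 L (u - w).
Proof. by move=> hu hw j; exact: (sqB (hu j) (hw j)). Qed.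

Lemma innerHE u w : inL2 L u -> inL2 L w ->
  innerH L u w = \sum_(j < 2) sip L (u j) (w j).
Proof.
move=> hu hw; rewrite /innerH sum2.
under eq_Rintegral do rewrite sum2.
exact: (RintegralD mT (sqint_mul mT (hu 0) (hw 0)) (sqint_mul mT (hu 1) (hw 1))).
Qed.

Lemma innerHC u w : innerH L u w = innerH L w u.
Proof.
by apply: eq_Rintegral => x _; apply: eq_bigr => j _; rewrite mulrC.
Qed.

Lemma innerHD u v w : inL2 L u -> inL2 L v -> inL2 L w ->
  innerH L (u + v) w = innerH L u w + innerH L v w.
Proof.
move=> hu hv hw; rewrite !innerHE//; last exact: inL2D.
by rewrite -big_split/=; apply: eq_bigr => j _; exact: sipD.
Qed.

Lemma innerHZ a u w : inL2 L u -> inL2 L w ->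
  innerH L (a *: u) w = a * innerH L u w.
Proof.
move=> hu hw; rewrite !innerHE//; last exact: inL2Z.
by rewrite mulr_sumr; apply: eq_bigr => j _; exact: sipZ.
Qed.

Lemma innerH_ge0 u : inL2 L u -> 0 <= innerH L u u.
Proof. by move=> hu; rewrite innerHE// sumr_ge0// => j _; exact: sip_ge0. Qed.

Lemma innerHB u v w : inL2 L u -> inL2 L v -> inL2 L w ->
  innerH L (u - v) w = innerH L u w - innerH L v w.
Proof.
by move=> hu hv hw; rewrite -scaleN1r innerHD ?innerHZ ?mulN1r//; exact: inL2Z.
Qed.

Lemma normH_sqr u : inL2 L u -> normH L u ^+ 2 = innerH L u u.
Proof. by move=> hu; rewrite sqr_sqrtr//; exact: innerH_ge0. Qed.

Lemma normH_ge0 u : 0 <= normH L u.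
Proof. exact: sqrtr_ge0. Qed.

Lemma innerH_CS u w : inL2 L u -> inL2 L w ->
  `|innerH L u w| <= normH L u * normH L w.
Proof. exact: (seminner_CSn inL2D inL2Z innerHC innerHD innerHZ innerH_ge0). Qed.

Lemma normHD u w : inL2 L u -> inL2 L w -> normH L (u + w) <= normH L u + normH L w.
Proof. exact: (seminner_triangle inL2D inL2Z innerHC innerHD innerHZ innerH_ge0). Qed.

Lemma normHB u w : inL2 L u -> inL2 L w -> normH L (u - w) <= normH L u + normH L w.
Proof. exact: (seminner_triangleB inL2D inL2Z innerHC innerHD innerHZ innerH_ge0). Qed.

Lemma normHZ a u : inL2 L u -> normH L (a *: u) = `|a| * normH L u.
Proof. exact: (seminner_normZ inL2Z innerHC innerHZ). Qed.

Lemma normH_comp u : inL2 L u ->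
  normH L u ^+ 2 = snorm L (u 0) ^+ 2 + snorm L (u 1) ^+ 2.
Proof. by move=> hu; rewrite normH_sqr// innerHE// sum2 !snorm_sqr. Qed.

Lemma snorm_le_normH u j : inL2 L u -> snorm L (u j) <= normH L u.
Proof.
move=> hu; apply: le_of_sqr; first exact: normH_ge0.
rewrite normH_comp//; case/orP: (orbN (j == 0)) => [/eqP->|j0].
  by rewrite lerDl sqr_ge0.
have -> : j = 1 by apply/val_inj; case: j j0 => -[|[|]].
by rewrite lerDr sqr_ge0.
Qed.

Lemma cvg0_le (F G : nat -> R) : (forall n, 0 <= F n <= G n) ->
  G n @[n --> \oo] --> (0 : R) -> F n @[n --> \oo] --> (0 : R).
Proof.
by move=> H; apply: squeeze_cvgr (cvg_cst 0); apply: nearW.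
Qed.

Lemma snorm_cvg_comp (F : nat -> vfield R) j u : (forall n, inL2 L (F n)) -> inL2 L u ->
  normH L (F n - u) @[n --> \oo] --> (0 : R) ->
  snorm L (F n j - u j) @[n --> \oo] --> (0 : R).
Proof.
move=> hF hu; apply: cvg0_le => n; rewrite sqrtr_ge0/=.
exact: (snorm_le_normH j (inL2B (hF n) hu)).
Qed.

(** Proved for all large [m], so that the two components of a field can share one degree. *)
Lemma trigfun_coef f : trigfun L f ->
  exists (m0 : nat), forall m : nat, (m0 <= m)%N -> exists (a b : int * int -> R), forall x,
    f x = \sum_(k \in [set k : int * int | knorm R k <= m%:R])
              (a k * cos (phase L k x) + b k * sin (phase L k x)).
Proof.
move=> Tf; have [M0 HM] := sPN_trig_id L_gt0 Tf.
exists (Num.bound `|M0|) => m M0m.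
(* [sPN] keeps [|k| < m] while [trig_poly] sums over [|k| <= m]; this mask kills the modes on the
   circle [|k| = m]. *)
pose c k : R := if knorm R k < m%:R then 1 else 0.
exists (fun k => c k * fcos L f k), (fun k => c k * fsin L f k) => x.
have M0M : M0 <= m%:R.
  apply: (le_trans (ler_norm _)); apply: ltW.
  by apply: (lt_le_trans (archi_boundP (normr_ge0 _))); rewrite ler_nat.
rewrite -[in LHS](HM _ M0M) /sPN -fsbig_finite; last exact: finite_knorm_lt.
transitivity (\sum_(k \in [set k : int * int | knorm R k < m%:R])
    (c k * fcos L f k * cos (phase L k x) + c k * fsin L f k * sin (phase L k x))).
  by apply: eq_fsbigr => k; rewrite inE /= => km; rewrite /c km !mul1r.
apply: fsbig_widen => [k /= /ltW//|k [_ /= /negP/negbTE km]].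
by rewrite /= /c km !mul0r addr0.
Qed.

Lemma trig_polyP p : trig_poly L p <-> forall j, trigfun L (p j).
Proof.
split=> [[m [a [b pE]]] j|Tp].
  have -> : p j = (fun x => \sum_(k \in [set k : int * int | knorm R k <= m%:R])
      (a k j * cos (phase L k x) + b k j * sin (phase L k x))).
    by apply/funext => x; exact: pE.
  apply: trigfun_fsum => [k|].
    by apply: trigfunD; apply: trigfunZ; [exact: trigfun_cos|exact: trigfun_sin].
  apply: sub_finite_set (finite_knorm_lt (m%:R + 1)) => k /= km.
  by apply: (le_lt_trans km); rewrite ltrDl.
have [m0 H0] := trigfun_coef (Tp 0); have [m1 H1] := trigfun_coef (Tp 1).
have [a0 [b0 E0]] := H0 _ (leq_maxl m0 m1); have [a1 [b1 E1]] := H1 _ (leq_maxr m0 m1).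
exists (maxn m0 m1), (fun k j => if j == 0 then a0 k else a1 k),
  (fun k j => if j == 0 then b0 k else b1 k) => j x.
case/orP: (orbN (j == 0)) => [/eqP->|j0]; first exact: E0.
have -> : j = 1 by apply/val_inj; case: j j0 => -[|[|]].
exact: E1.
Qed.

Lemma solenoidalP p : solenoidal_trig_poly L p <->
  [/\ forall j, trigfun L (p j), forall x, \sum_(i < 2) partial i (p i) x = 0 &
   forall j, sip L (p j) (ck L 0) = 0].
Proof.
have H j : sip L (p j) (ck L 0) = \int[area2 R]_(x in torus L) p j x.
  by apply: eq_Rintegral => x _; rewrite /ck phase0 cos0 mulr1.
split=> -[H1 H2 H3]; split=> //.
- exact/trig_polyP.
- by move=> j; rewrite H.
- exact/trig_polyP.
- by move=> j; rewrite -H.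
Qed.

Lemma solenoidalD (a : R) p v : solenoidal_trig_poly L p -> solenoidal_trig_poly L v ->
  solenoidal_trig_poly L (a *: p + v).
Proof.
move=> /solenoidalP[Tp dp mp] /solenoidalP[Tv dv mv]; apply/solenoidalP.
have E j : (a *: p + v) j = (fun x => a * p j x + v j x) by [].
split.
- by move=> j; rewrite E; apply: trigfunD => //; exact: trigfunZ.
- move=> x; under eq_bigr => i _ do
    rewrite E (partialD i (trigfunZ a (Tp i)) (Tv i)) (partialZ i a (Tp i)).
  by rewrite big_split/= -mulr_sumr dp dv mulr0 addr0.
- move=> j; have sp := sq_trig L_gt0 (Tp j); have sv := sq_trig L_gt0 (Tv j).
  have sc := sq_trig L_gt0 (ck_trig L 0).
  rewrite -[(a *: p + v) j]/(a *: p j + v j) (sipD (sqZ a sp) sv sc) sipZ//.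
  by rewrite mp mv mulr0 addr0.
Qed.

Lemma grad_lin (a : R) p v i : (forall j, trigfun L (p j)) -> (forall j, trigfun L (v j)) ->
  grad (a *: p + v) i = a *: grad p i + grad v i.
Proof.
move=> Tp Tv; apply/funext => j; rewrite /grad.
have -> : (a *: p + v) j = (fun x => a * p j x + v j x) by [].
by rewrite (partialD i (trigfunZ a (Tp j)) (Tv j)) (partialZ i a (Tp j)).
Qed.

Lemma solenoidal_inL2 p : solenoidal_trig_poly L p -> inL2 L p.
Proof. by move=> /solenoidalP[Tp _ _] j; exact: (sq_trig L_gt0 (Tp j)). Qed.

Lemma solenoidal_grad_inL2 p i : solenoidal_trig_poly L p -> inL2 L (grad p i).
Proof.
by move=> /solenoidalP[Tp _ _] j; exact: (sq_trig L_gt0 (trigfun_partial i (Tp j))).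
Qed.

Lemma normH0 : normH L 0 = 0.
Proof.
rewrite /normH innerHE; try by move=> j; exact: (sq0 L_gt0).
by rewrite big1 ?sqrtr0// => j _; exact: sip0l.
Qed.

Lemma V_gradient_solenoidal p : solenoidal_trig_poly L p -> V_gradient L p (grad p).
Proof.
move=> Sp; split; first exact: solenoidal_inL2.
  by move=> i; exact: solenoidal_grad_inL2.
exists (fun=> p); split=> //.
  by rewrite subrr normH0; exact: cvg_cst.
by move=> i; rewrite subrr normH0; exact: cvg_cst.
Qed.

Lemma V_gradient_inL2 u G : V_gradient L u G -> inL2 L u.
Proof. by case. Qed.

Lemma V_gradient_lin (a : R) u v G G' : V_gradient L u G -> V_gradient L v G' ->
  V_gradient L (a *: u + v) (a *: G + G').
Proof.
move=> [hu hG [p [Sp pu pG]]] [hv hG' [r [Sr rv rG]]].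
split; first by apply: inL2D => //; exact: inL2Z.
  by move=> i; apply: (inL2D (inL2Z a (hG i)) (hG' i)).
have lin (x y x' y' : vfield R) : a *: x + y - (a *: x' + y') = a *: (x - x') + (y - y').
  by rewrite opprD scalerBr addrACA.
have bound (x x' : nat -> vfield R) y y' : (forall n, inL2 L (x n)) -> inL2 L y ->
    (forall n, inL2 L (x' n)) -> inL2 L y' ->
    normH L (x n - y) @[n --> \oo] --> (0 : R) ->
    normH L (x' n - y') @[n --> \oo] --> (0 : R) ->
    normH L (a *: x n + x' n - (a *: y + y')) @[n --> \oo] --> (0 : R).
  move=> hx hy hx' hy' c1 c2.
  apply: (@cvg0_le _ (fun n => `|a| * normH L (x n - y) + normH L (x' n - y'))).
    move=> n; rewrite normH_ge0/= lin.
    have h1 := inL2B (hx n) hy; have h2 := inL2B (hx' n) hy'.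
    by rewrite (le_trans (normHD (inL2Z a h1) h2))// normHZ.
  rewrite -[X in _ --> X](addr0 (0 : R)) -[X in _ --> X + _](mulr0 `|a|).
  by apply: cvgD => //; apply: cvgM => //; exact: cvg_cst.
exists (fun n => a *: p n + r n); split.
- by move=> n; exact: solenoidalD.
- by apply: bound => // n; exact: solenoidal_inL2.
- move=> i.
  have -> : (fun n => normH L (grad (a *: p n + r n) i - (a *: G + G') i)) =
     (fun n => normH L (a *: grad (p n) i + grad (r n) i - (a *: G i + G' i))).
    apply/funext => n; rewrite grad_lin//.
      by have /solenoidalP[] := Sp n.
    by have /solenoidalP[] := Sr n.
  by apply: bound => // n; exact: solenoidal_grad_inL2.
Qed.

(** Integration by parts holds for each approximating polynomial, and both of its sides converge
    under the H^1 convergence. *)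
Lemma V_gradient_h1fun u G j : V_gradient L u G ->
  h1fun L (u j) (fun i => G i j).
Proof.
move=> [hu hG [p [Sp pu pG]]].
have Tp n j' : trigfun L (p n j') by have /solenoidalP[] := Sp n.
have pn n : inL2 L (p n) := solenoidal_inL2 (Sp n).
have gn n i : inL2 L (grad (p n) i) := solenoidal_grad_inL2 i (Sp n).
have c1 := snorm_cvg_comp j pn hu pu.
have c2 i := snorm_cvg_comp j (gn^~ i) (hG i) (pG i).
split=> [|i|i q Tq|]; [exact: hu|exact: hG| |].
  have sqq := sq_trig L_gt0 Tq.
  have sdq := sq_trig L_gt0 (trigfun_partial i Tq).
  have l1 := sip_cvg (fun n => gn n i j) (hG i j) sqq (c2 i).
  have l2 : - sip L (p n j) (partial i q) @[n --> \oo] --> - sip L (u j) (partial i q).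
    by apply: cvgN; exact: (sip_cvg (pn^~ j) (hu j) sdq c1).
  have E n : sip L (grad (p n) i j) q = - sip L (p n j) (partial i q).
    exact: (trig_wpartial L_gt0 i (Tp n j) Tq).
  move: l1; under eq_fun do rewrite E.
  move=> l1; exact: (etrans (esym (cvg_lim (@Rhausdorff R) l1)) (cvg_lim (@Rhausdorff R) l2)).
exists (fun n => p n j); split=> // n.
by have /solenoidalP[_ _] := Sp n.
Qed.

(** The difference of two gradients of [u] is orthogonal to all trigonometric polynomials and is
    also a limit of such, hence orthogonal to itself. *)
Lemma V_gradient_unique u G G' i j : V_gradient L u G -> V_gradient L u G' ->
  snorm L (G i j - G' i j) = 0.
Proof.
move=> HG HG'.
have [su sG wG _] := V_gradient_h1fun j HG.
have [_ sG' wG' _] := V_gradient_h1fun j HG'.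
have := V_gradient_h1fun j (V_gradient_lin (-1) HG' HG).
set D := (fun i : 'I_2 => _) => -[_ sD _ [q [Tq _ _ qD]]].
have -> : G i j - G' i j = D i.
  by rewrite /D -[(_ + _) i j]/(-1 *: G' i j + G i j) scaleN1r addrC.
have ort r : trigfun L r -> sip L (D i) r = 0.
  move=> Tr; have sr := sq_trig L_gt0 Tr.
  have -> : D i = -1 *: G' i j + G i j by [].
  by rewrite (sipD (sqZ _ (sG' i)) (sG i) sr) sipZ// (wG _ _ Tr) (wG' _ _ Tr); ring.
have sqd n := sq_trig L_gt0 (trigfun_partial i (Tq n)).
have := sip_cvg sqd (sD i) (sD i) (qD i).
under eq_fun => n do rewrite sipC (ort _ (trigfun_partial i (Tq n))).
by move/cvg_lim => E; rewrite /snorm -E // lim_cst // sqrtr0.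
Qed.

Lemma gradV_gradient u : inV L u -> V_gradient L u (gradV L u).
Proof. by move=> [G HG]; apply: (getPex (ex_intro _ G HG)). Qed.

Lemma inV_lin (a : R) u v : inV L u -> inV L v -> inV L (a *: u + v).
Proof.
by move=> [G HG] [G' HG']; exists (a *: G + G'); exact: V_gradient_lin.
Qed.

Lemma V_gradient0 : V_gradient L 0 0.
Proof.
have T0 : forall j, trigfun L ((0 : vfield R) j) by move=> j; exact: trigfun0.
have S0 : solenoidal_trig_poly L 0.
  apply/solenoidalP; split=> // [x|j]; last exact: sip0l.
  rewrite big1// => i _.
  have := partialZ i 0 (trigfun0 L); rewrite (_ : (fun x => 0 * 0) = (fun=> 0 : R)).
    move=> E; rewrite -[partial i _]/(partial i (fun=> 0 : R)) E mul0r//.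
  by apply/funext => y; rewrite mul0r.
have := V_gradient_solenoidal S0.
move/(V_gradient_lin (-1)) => /(_ _ _ (V_gradient_solenoidal S0)).
by rewrite !scaleN1r !addNr.
Qed.

Lemma inV0 : inV L 0. Proof. by exists 0; exact: V_gradient0. Qed.

Lemma inVD u v : inV L u -> inV L v -> inV L (u + v).
Proof. by move=> hu hv; rewrite -(scale1r u); exact: inV_lin. Qed.
Lemma inVZ a u : inV L u -> inV L (a *: u).
Proof. by move=> hu; rewrite -(addr0 (a *: u)); exact: inV_lin inV0. Qed.
Lemma inVB u v : inV L u -> inV L v -> inV L (u - v).
Proof. by move=> hu hv; rewrite addrC -scaleN1r; exact: inV_lin. Qed.
Lemma inV_inL2 u : inV L u -> inL2 L u.
Proof. by move=> /gradV_gradient/V_gradient_inL2. Qed.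

Lemma sip_null f g h : sq L f -> sq L g -> sq L h -> snorm L (f - g) = 0 ->
  sip L f h = sip L g h.
Proof.
move=> sf sg sh fg0; apply/eqP; rewrite -subr_eq0 -sipB//.
have := sip_CS (sqB sf sg) sh; rewrite fg0 mul0r.
by rewrite normr_le0.
Qed.

(** [gradV] is an arbitrary choice; this allows any convenient gradient in its place, such as the
    classical one of a polynomial. *)
Lemma innerVE u w G G' : V_gradient L u G -> V_gradient L w G' ->
  innerV L u w = \sum_(i < 2) \sum_(j < 2) sip L (G i j) (G' i j).
Proof.
move=> HG HG'; have Hu := gradV_gradient (ex_intro _ G HG).
have Hw := gradV_gradient (ex_intro _ G' HG').
have [_ h1 _] := Hu; have [_ h2 _] := Hw; have [_ h3 _] := HG; have [_ h4 _] := HG'.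
apply: eq_bigr => i _; rewrite innerHE//; apply: eq_bigr => j _.
rewrite (sip_null (h1 i j) (h3 i j) (h2 i j) (V_gradient_unique i j Hu HG)).
rewrite sipC (sip_null (h2 i j) (h4 i j) (h3 i j) (V_gradient_unique i j Hw HG')).
by rewrite sipC.
Qed.

Lemma innerVC u w : innerV L u w = innerV L w u.
Proof. by apply: eq_bigr => i _; exact: innerHC. Qed.

Lemma innerV_lin a u v w : inV L u -> inV L v -> inV L w ->
  innerV L (a *: u + v) w = a * innerV L u w + innerV L v w.
Proof.
move=> /gradV_gradient Hu /gradV_gradient Hv /gradV_gradient Hw.
rewrite (innerVE (V_gradient_lin a Hu Hv) Hw) (innerVE Hu Hw) (innerVE Hv Hw).
have [_ h1 _] := Hu; have [_ h2 _] := Hv; have [_ h3 _] := Hw.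
rewrite mulr_sumr -big_split/=; apply: eq_bigr => i _.
rewrite mulr_sumr -big_split/=; apply: eq_bigr => j _.
rewrite -[(a *: gradV L u + gradV L v) i j]/(a *: gradV L u i j + gradV L v i j).
by rewrite (sipD (sqZ a (h1 i j)) (h2 i j) (h3 i j)) (sipZ a (h1 i j) (h3 i j)).
Qed.

Lemma innerVD u v w : inV L u -> inV L v -> inV L w ->
  innerV L (u + v) w = innerV L u w + innerV L v w.
Proof. by move=> hu hv hw; rewrite -{1}(scale1r u) innerV_lin// mul1r. Qed.

Lemma innerV_null w : inV L w -> innerV L 0 w = 0.
Proof.
move=> /gradV_gradient Hw; rewrite (innerVE V_gradient0 Hw) big1// => i _.
by rewrite big1// => j _; exact: sip0l.
Qed.

Lemma innerVZ a u w : inV L u -> inV L w -> innerV L (a *: u) w = a * innerV L u w.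
Proof.
move=> hu hw; rewrite -(addr0 (a *: u)) (innerV_lin a hu inV0 hw) innerV_null//.
by rewrite addr0.
Qed.

Lemma innerVB u v w : inV L u -> inV L v -> inV L w ->
  innerV L (u - v) w = innerV L u w - innerV L v w.
Proof.
by move=> hu hv hw; rewrite -scaleN1r innerVD ?innerVZ ?mulN1r//; exact: inVZ.
Qed.

Lemma innerV_ge0 u : inV L u -> 0 <= innerV L u u.
Proof.
move=> /gradV_gradient Hu; rewrite (innerVE Hu Hu).
have [_ h1 _] := Hu.
by apply: sumr_ge0 => i _; apply: sumr_ge0 => j _; exact: (sip_ge0 (h1 i j)).
Qed.

Lemma normV_ge0 u : 0 <= normV L u. Proof. exact: sqrtr_ge0. Qed.

Lemma normV_sqr u : inV L u -> normV L u ^+ 2 = innerV L u u.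
Proof. by move=> hu; rewrite sqr_sqrtr//; exact: innerV_ge0. Qed.

Lemma innerV_CS u w : inV L u -> inV L w -> `|innerV L u w| <= normV L u * normV L w.
Proof. exact: (seminner_CSn inVD inVZ innerVC innerVD innerVZ innerV_ge0). Qed.

Lemma normVD u w : inV L u -> inV L w -> normV L (u + w) <= normV L u + normV L w.
Proof. exact: (seminner_triangle inVD inVZ innerVC innerVD innerVZ innerV_ge0). Qed.

Lemma normVB u w : inV L u -> inV L w -> normV L (u - w) <= normV L u + normV L w.
Proof. exact: (seminner_triangleB inVD inVZ innerVC innerVD innerVZ innerV_ge0). Qed.

Lemma innerV_genergy u : inV L u ->
  innerV L u u = \sum_(j < 2) genergy L (fun i => gradV L u i j).
Proof.
by move=> /gradV_gradient Hu; rewrite (innerVE Hu Hu) exchange_big.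
Qed.

Lemma PN_inL2 N u : inL2 L (PN L N u).
Proof. by move=> j; rewrite PN_sPN; exact: (sq_trig L_gt0 (sPN_trig L N (u j))). Qed.

Lemma PNB N u w : inL2 L u -> inL2 L w -> PN L N (u - w) = PN L N u - PN L N w.
Proof.
move=> hu hw; apply/funext => j.
rewrite -[RHS]/(PN L N u j - PN L N w j) !PN_sPN.
have := sPN_lin L_gt0 N (-1) (hw j) (hu j); rewrite !scaleN1r addrC.
by rewrite [RHS]addrC => <-.
Qed.

Lemma innerH_PN N u w : inL2 L u -> inL2 L w ->
  innerH L (PN L N u) w = innerH L u (PN L N w).
Proof.
move=> hu hw; rewrite !innerHE//; try exact: PN_inL2.
by apply: eq_bigr => j _; rewrite !PN_sPN; exact: (sPN_sym L_gt0 N (hu j) (hw j)).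
Qed.

Lemma PN_idem N u : inL2 L u -> PN L N (PN L N u) = PN L N u.
Proof.
by move=> hu; apply/funext => j; rewrite !PN_sPN; exact: (sPN_idem L_gt0 N (hu j)).
Qed.

Lemma innerH_PN_PN N u w : inL2 L u -> inL2 L w ->
  innerH L (PN L N u) (PN L N w) = innerH L (PN L N u) w.
Proof. by move=> hu hw; rewrite -innerH_PN ?PN_idem//; exact: PN_inL2. Qed.

Lemma normH_PN_le N u : inL2 L u -> normH L (PN L N u) <= normH L u.
Proof.
move=> hu; apply: le_of_sqr; first exact: normH_ge0.
have hp := PN_inL2 N u.
rewrite !normH_sqr// !innerHE//; apply: ler_sum => j _.
by rewrite !PN_sPN; exact: (sip_sPN_le L_gt0 N (hu j)).
Qed.

Lemma normV_tail N w : 0 <= N -> inV L w ->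
  (kappa0 L * N) ^+ 2 * (normH L w ^+ 2 - normH L (PN L N w) ^+ 2) <= normV L w ^+ 2.
Proof.
move=> N0 hw; have hw2 := inV_inL2 hw; have hp := PN_inL2 N w.
rewrite normV_sqr// innerV_genergy// !normH_sqr// !innerHE// -sumrB mulr_sumr.
apply: ler_sum => j _; rewrite PN_sPN.
exact: (h1fun_tail L_gt0 N0 (V_gradient_h1fun j (gradV_gradient hw))).
Qed.

Lemma normV_poincare w : inV L w -> kappa0 L * normH L w <= normV L w.
Proof.
move=> hw; have := normV_tail ler01 hw; rewrite mulr1.
have -> : PN L 1 w = 0.
  apply/funext => j; rewrite PN_sPN.
  exact: (sPN1_mean0 (h1fun_mean0 L_gt0 (V_gradient_h1fun j (gradV_gradient hw)))).
rewrite normH0 expr0n subr0 -exprMn => H.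
by apply: le_of_sqr => //; exact: normV_ge0.
Qed.

(** The weak form of the divergence condition is what survives the L^2 limit of the approximants. *)
Lemma inV_weak_div u q : inV L u -> trigfun L q ->
  \sum_(i < 2) sip L (u i) (partial i q) = 0.
Proof.
move=> /gradV_gradient[hu _ [p [Sp pu _]]] Tq; rewrite sum2.
have pn n : inL2 L (p n) := solenoidal_inL2 (Sp n).
have sd i := sq_trig L_gt0 (trigfun_partial i Tq).
have l i := sip_cvg (pn^~ i) (hu i) (sd i) (snorm_cvg_comp i pn hu pu).
have : sip L (p n 0) (partial 0 q) + sip L (p n 1) (partial 1 q) @[n --> \oo] -->
    sip L (u 0) (partial 0 q) + sip L (u 1) (partial 1 q).
  by apply: cvgD; exact: l.
have -> : (fun n => sip L (p n 0) (partial 0 q) + sip L (p n 1) (partial 1 q)) = (fun=> 0).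
  apply/funext => n.
  have /solenoidalP[Tp dp _] := Sp n.
  have E i : sip L (p n i) (partial i q) = - sip L (partial i (p n i)) q.
    by rewrite (trig_wpartial L_gt0 i (Tp i) Tq) opprK.
  have sp i := sq_trig L_gt0 (trigfun_partial i (Tp i)).
  rewrite !E -opprD -sipD//; last exact: (sq_trig L_gt0 Tq).
  rewrite (_ : partial 0 _ + partial 1 _ = 0) ?sip0l ?oppr0//.
  by apply/funext => x; have := dp x; rewrite sum2.
by move/cvg_lim => <- //; rewrite lim_cst.
Qed.

End VectorFields.

Lemma sum_CS (R : realFieldType) (I : Type) (s : seq I) (x y : I -> R) :
  (\sum_(k <- s) x k * y k) ^+ 2 <= (\sum_(k <- s) x k ^+ 2) * (\sum_(k <- s) y k ^+ 2).
Proof.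
elim: s => [|k s IH]; first by rewrite !big_nil expr0n mulr0.
rewrite !big_cons; move: IH.
have : 0 <= \sum_(k <- s) x k ^+ 2 by apply: sumr_ge0 => j _; exact: sqr_ge0.
have : 0 <= \sum_(k <- s) y k ^+ 2 by apply: sumr_ge0 => j _; exact: sqr_ge0.
move: (\sum_(j <- s) x j ^+ 2) (\sum_(j <- s) y j ^+ 2) (\sum_(j <- s) x j * y j) (x k) (y k).
move=> X Y S a b Y0 X0 SXY.
(* The cross term of the induction: arithmetic-geometric mean together with [S^2 <= X Y]. *)
have H : 2 * (a * b * S) <= a ^+ 2 * Y + b ^+ 2 * X.
  apply: le_of_sqr; first by apply: addr_ge0; apply: mulr_ge0 => //; exact: sqr_ge0.
  have H1 : (2 * (a * b * S)) ^+ 2 <= 4 * (a * b) ^+ 2 * (X * Y).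
    have -> : (2 * (a * b * S)) ^+ 2 = 4 * (a * b) ^+ 2 * S ^+ 2 by ring.
    by rewrite ler_wpM2l// mulr_ge0// sqr_ge0.
  apply: (le_trans H1); rewrite -subr_ge0.
  have -> : (a ^+ 2 * Y + b ^+ 2 * X) ^+ 2 - 4 * (a * b) ^+ 2 * (X * Y) =
    (a ^+ 2 * Y - b ^+ 2 * X) ^+ 2 by ring.
  exact: sqr_ge0.
have -> : (a * b + S) ^+ 2 = a ^+ 2 * b ^+ 2 + 2 * (a * b * S) + S ^+ 2 by ring.
have -> : (a ^+ 2 + X) * (b ^+ 2 + Y) =
  a ^+ 2 * b ^+ 2 + (a ^+ 2 * Y + b ^+ 2 * X) + X * Y by ring.
by rewrite lerD// lerD2l.
Qed.

(** * The trilinear form *)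

Section Trilinear.
Variables (R : realType) (L : R).
Hypothesis L_gt0 : 0 < L.
Implicit Types (f g h q : R * R -> R) (u v w p : vfield R) (k : int * int) (i j : 'I_2).
Implicit Types G : 'I_2 -> vfield R.
Let mT := @measurable_torus R L.

Definition fsqr f x := f x ^+ 2.
Definition fmul f g x := f x * g x.

Lemma sq_fmul f h : sq L f -> sq L h -> sq L (fsqr f) -> sq L (fsqr h) ->
  sq L (fmul f h) /\ snorm L (fmul f h) ^+ 2 <= snorm L (fsqr f) * snorm L (fsqr h).
Proof.
move=> [mf _] [mh _] sf2 sh2.
have E x : fmul f h x ^+ 2 = fsqr f x * fsqr h x by rewrite /fmul exprMn.
split.
  split; first exact: measurable_funM.
  by under eq_fun do rewrite E; exact: (sqint_mul mT sf2 sh2).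
rewrite snorm_sqr; apply: le_trans (sip_CS sf2 sh2); apply: le_trans (ler_norm _).
rewrite le_eqVlt; apply/orP; left; apply/eqP; apply: eq_Rintegral => x _.
by rewrite -E expr2.
Qed.

Lemma inV_sq_sqr u i : inV L u -> sq L (fsqr (u i)).
Proof.
by move=> /gradV_gradient Hu; exact: (h1fun_L4 L_gt0 (V_gradient_h1fun L_gt0 i Hu)).1.
Qed.

Lemma inV_sq u i : inV L u -> sq L (u i).
Proof. by move=> hu; exact: (inV_inL2 hu i). Qed.

Lemma inV_sq_fmul u w i j : inV L u -> inV L w -> sq L (fmul (u i) (w j)).
Proof.
move=> hu hw; apply: (sq_fmul _ _ _ _).1.
- exact: inV_sq.
- exact: inV_sq.
- exact: inV_sq_sqr.
- exact: inV_sq_sqr.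
Qed.

Lemma inV_sq_grad u i j : inV L u -> sq L (gradV L u i j).
Proof. by move=> /gradV_gradient[_ hG _]; exact: (hG i j). Qed.

(** A quantity comparable to the square of the L^4 norm. As a sum over components, the product of
    two of them is exactly the double sum that occurs in [pairB_bound]. *)
Definition norm4 u := snorm L (fsqr (u 0)) + snorm L (fsqr (u 1)).

Lemma norm4_le u : inV L u -> norm4 u <= 2 * (normH L u * normV L u).
Proof.
move=> hu; have Hg := gradV_gradient hu.
pose e j := genergy L (fun i => gradV L u i j).
have e0 j : 0 <= e j := genergy_ge0 L _.
have H j : snorm L (fsqr (u j)) <= 2 * (snorm L (u j) * Num.sqrt (e j)).
  apply: le_of_sqr.
    by apply: mulr_ge0 => //; apply: mulr_ge0; exact: sqrtr_ge0.
  rewrite snorm_sqr !exprMn (sqr_sqrtr (e0 j)).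
  have -> : (2 : R) ^+ 2 = 4 by ring.
  exact: (h1fun_L4 L_gt0 (V_gradient_h1fun L_gt0 j Hg)).2.
rewrite /norm4; apply: (le_trans (lerD (H 0) (H 1))).
rewrite -mulrDr; apply: ler_wpM2l => //.
apply: le_of_sqr; first by apply: mulr_ge0; exact: sqrtr_ge0.
rewrite exprMn normV_sqr// innerV_genergy// normH_comp//; last exact: inV_inL2.
rewrite sum2 -!/(e _).
have := sum_CS [:: (0 : 'I_2); 1] (fun j => snorm L (u j)) (fun j => Num.sqrt (e j)).
by rewrite !big_cons !big_nil !addr0 !(sqr_sqrtr (e0 _)).
Qed.

(** The trilinear integrand grouped as a gradient entry times a product [u_i w_j], both square
    integrable, with the gradient [G] as a parameter instead of the chosen one. *)
Definition bform G u w := \sum_(i < 2) \sum_(j < 2) sip L (G i j) (fmul (u i) (w j)).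

Lemma pairBE u v w : inV L u -> inV L v -> inV L w ->
  pairB L u v w = bform (gradV L v) u w.
Proof.
move=> hu hv hw; rewrite /pairB /bform.
have I i j := sqint_mul mT (inV_sq_grad i j hv) (inV_sq_fmul i j hu hw).
have -> : (fun x => \sum_(i < 2) \sum_(j < 2) u i x * gradV L v i j x * w j x) =
  (fun x => (gradV L v 0 0 x * fmul (u 0) (w 0) x + gradV L v 0 1 x * fmul (u 0) (w 1) x) +
            (gradV L v 1 0 x * fmul (u 1) (w 0) x + gradV L v 1 1 x * fmul (u 1) (w 1) x)).
  by apply/funext => x; rewrite !sum2 /fmul; ring.
rewrite !sum2.
have ID i := integrableD mT (I i 0) (I i 1).
rewrite (RintegralD mT (ID 0) (ID 1)).
by rewrite (RintegralD mT (I 0 0) (I 0 1)) (RintegralD mT (I 1 0) (I 1 1)).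
Qed.

Lemma bform_gradient u v w G : inV L u -> inV L w -> V_gradient L v G ->
  bform (gradV L v) u w = bform G u w.
Proof.
move=> hu hw HG; have Hv := gradV_gradient (ex_intro _ G HG).
apply: eq_bigr => i _; apply: eq_bigr => j _.
have [_ h1 _] := Hv; have [_ h2 _] := HG.
apply: (sip_null (h1 i j) (h2 i j)); first exact: inV_sq_fmul.
exact: (V_gradient_unique L_gt0 i j Hv HG).
Qed.

Lemma pairB_gradient u v w G : inV L u -> inV L w -> V_gradient L v G ->
  pairB L u v w = bform G u w.
Proof.
move=> hu hw HG; rewrite -(bform_gradient hu hw HG); apply: pairBE => //.
by exists G.
Qed.

Lemma bformE G u w : bform G u w =
  \sum_(ij : 'I_2 * 'I_2) sip L (G ij.1 ij.2) (fmul (u ij.1) (w ij.2)).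
Proof. by rewrite /bform pair_big. Qed.

Lemma pairB_bound u v w : inV L u -> inV L v -> inV L w ->
  (pairB L u v w) ^+ 2 <= norm4 u * norm4 w * normV L v ^+ 2.
Proof.
move=> hu hv hw; rewrite pairBE// bformE.
have Hg := gradV_gradient hv.
pose X (ij : 'I_2 * 'I_2) := snorm L (gradV L v ij.1 ij.2).
pose Y (ij : 'I_2 * 'I_2) := snorm L (fmul (u ij.1) (w ij.2)).
have H1 : (\sum_(ij : 'I_2 * 'I_2) sip L (gradV L v ij.1 ij.2) (fmul (u ij.1) (w ij.2))) ^+ 2 <=
    (\sum_ij X ij * Y ij) ^+ 2.
  rewrite -real_normK ?num_real// lerXn2r ?nnegrE ?normr_ge0//.
    by apply: sumr_ge0 => ij _; rewrite mulr_ge0 ?sqrtr_ge0.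
  apply: (le_trans (ler_norm_sum _ _ _)); apply: ler_sum => ij _.
  by apply: sip_CS; [exact: inV_sq_grad|exact: inV_sq_fmul].
apply: (le_trans H1); apply: (le_trans (sum_CS _ _ _)).
have -> : \sum_ij X ij ^+ 2 = normV L v ^+ 2.
  rewrite normV_sqr// (innerVE L_gt0 Hg Hg) pair_big.
  by apply: eq_bigr => ij _; rewrite /X snorm_sqr.
rewrite mulrC; apply: ler_wpM2r; first exact: sqr_ge0.
have -> : norm4 u * norm4 w =
    \sum_(ij : 'I_2 * 'I_2) snorm L (fsqr (u ij.1)) * snorm L (fsqr (w ij.2)).
  rewrite -(pair_big xpredT xpredT (fun i j => snorm L (fsqr (u i)) * snorm L (fsqr (w j))))/=.
  by rewrite !sum2 /norm4; ring.
apply: ler_sum => -[i j] _; rewrite /Y /=.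
apply: (sq_fmul _ _ _ _).2.
- exact: inV_sq.
- exact: inV_sq.
- exact: inV_sq_sqr.
- exact: inV_sq_sqr.
Qed.

Lemma norm4_ge0 u : 0 <= norm4 u.
Proof. by apply: addr_ge0; exact: sqrtr_ge0. Qed.

Lemma pairB_le u v w : inV L u -> inV L v -> inV L w ->
  (pairB L u v w) ^+ 2 <=
  4 * (normH L u * normV L u) * (normH L w * normV L w) * normV L v ^+ 2.
Proof.
move=> hu hv hw; apply: (le_trans (pairB_bound hu hv hw)).
apply: ler_wpM2r; first exact: sqr_ge0.
have E (a b : R) : 4 * a * b = (2 * a) * (2 * b) by ring.
rewrite E; apply: ler_pM; [exact: norm4_ge0|exact: norm4_ge0|exact: norm4_le|exact: norm4_le].
Qed.

(** The term that remains in the energy estimate. Its factor 2 is Ladyzhenskaya's constant 4 under a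
    square root. *)
Lemma pairB_le_same u w : inV L u -> inV L w ->
  `|pairB L w u w| <= 2 * (normH L w * normV L w) * normV L u.
Proof.
move=> hu hw; apply: le_of_sqr.
  apply: mulr_ge0; last exact: normV_ge0.
  by apply: mulr_ge0 => //; apply: mulr_ge0; [exact: normH_ge0|exact: normV_ge0].
rewrite real_normK ?num_real//; apply: (le_trans (pairB_le hw hu hw)).
have E (a b : R) : 4 * a * a * b ^+ 2 = (2 * a * b) ^+ 2 by ring.
by rewrite E.
Qed.

(** Continuity of the form on V in all three arguments, by Poincare; it supports the density
    argument for antisymmetry and the Lipschitz bound in time. *)
Lemma pairB_leV u v w : inV L u -> inV L v -> inV L w ->
  `|pairB L u v w| <= 2 / kappa0 L * (normV L u * normV L w) * normV L v.
Proof.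
move=> hu hv hw; have k0 := kappa0_gt0 L_gt0.
have v0 := normV_ge0 L.
apply: le_of_sqr.
  by apply: mulr_ge0 => //; apply: mulr_ge0; [rewrite divr_ge0 ?ltW|exact: mulr_ge0].
rewrite real_normK ?num_real//; apply: (le_trans (pairB_le hu hv hw)).
have E (a b x y : R) : (2 / x * (a * b) * y) ^+ 2 = 4 * (a / x * a) * (b / x * b) * y ^+ 2.
  by ring.
rewrite E; apply: ler_wpM2r; first exact: sqr_ge0.
have H z : inV L z -> normH L z * normV L z <= normV L z / kappa0 L * normV L z.
  move=> hz; apply: ler_wpM2r => //.
  by rewrite ler_pdivlMr// mulrC; exact: normV_poincare.
have HV z : 0 <= normH L z * normV L z by apply: mulr_ge0 => //; exact: normH_ge0.
apply: ler_pM => //; first by apply: mulr_ge0.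
- by apply: ler_wpM2l => //; exact: H.
- exact: H.
Qed.

Lemma bform_linl (a : R) G u v w : (forall i j, sq L (G i j)) -> inV L u -> inV L v -> inV L w ->
  bform G (a *: u + v) w = a * bform G u w + bform G v w.
Proof.
move=> hG hu hv hw; rewrite /bform mulr_sumr -big_split/=; apply: eq_bigr => i _.
rewrite mulr_sumr -big_split/=; apply: eq_bigr => j _.
have s1 := inV_sq_fmul i j hu hw; have s2 := inV_sq_fmul i j hv hw.
have -> : fmul ((a *: u + v) i) (w j) = a *: fmul (u i) (w j) + fmul (v i) (w j).
  apply/funext => x; rewrite -[RHS]/(a * (u i x * w j x) + v i x * w j x).
  by rewrite -[LHS]/((a * u i x + v i x) * w j x); ring.
by rewrite sipC (sipD (sqZ a s1) s2 (hG i j)) (sipZ a s1 (hG i j)) ![sip L _ (G i j)]sipC.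
Qed.

Lemma bform_linr (a : R) G u v w : (forall i j, sq L (G i j)) -> inV L u -> inV L v -> inV L w ->
  bform G w (a *: u + v) = a * bform G w u + bform G w v.
Proof.
move=> hG hu hv hw; rewrite /bform mulr_sumr -big_split/=; apply: eq_bigr => i _.
rewrite mulr_sumr -big_split/=; apply: eq_bigr => j _.
have s1 := inV_sq_fmul i j hw hu; have s2 := inV_sq_fmul i j hw hv.
have -> : fmul (w i) ((a *: u + v) j) = a *: fmul (w i) (u j) + fmul (w i) (v j).
  apply/funext => x; rewrite -[RHS]/(a * (w i x * u j x) + w i x * v j x).
  by rewrite -[LHS]/(w i x * (a * u j x + v j x)); ring.
by rewrite sipC (sipD (sqZ a s1) s2 (hG i j)) (sipZ a s1 (hG i j)) ![sip L _ (G i j)]sipC.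
Qed.

Lemma pairB_linl (a : R) u v z w : inV L u -> inV L v -> inV L z -> inV L w ->
  pairB L (a *: u + v) z w = a * pairB L u z w + pairB L v z w.
Proof.
move=> hu hv hz hw; have huv := inV_lin L_gt0 a hu hv.
rewrite (pairBE huv hz hw) (pairBE hu hz hw) (pairBE hv hz hw)
  bform_linl// => i j; exact: inV_sq_grad.
Qed.

Lemma pairB_linr (a : R) u v z w : inV L u -> inV L v -> inV L z -> inV L w ->
  pairB L w z (a *: u + v) = a * pairB L w z u + pairB L w z v.
Proof.
move=> hu hv hz hw; have huv := inV_lin L_gt0 a hu hv.
rewrite (pairBE hw hz huv) (pairBE hw hz hu) (pairBE hw hz hv)
  bform_linr// => i j; exact: inV_sq_grad.
Qed.

Lemma pairB_linm (a : R) u v z w : inV L u -> inV L v -> inV L z -> inV L w ->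
  pairB L z (a *: u + v) w = a * pairB L z u w + pairB L z v w.
Proof.
move=> hu hv hz hw; have huv := inV_lin L_gt0 a hu hv.
have Hu := gradV_gradient hu; have Hv := gradV_gradient hv.
rewrite (pairB_gradient hz hw (V_gradient_lin L_gt0 a Hu Hv)).
rewrite (pairB_gradient hz hw Hu) (pairB_gradient hz hw Hv).
rewrite /bform mulr_sumr -big_split/=; apply: eq_bigr => i _.
rewrite mulr_sumr -big_split/=; apply: eq_bigr => j _.
have s1 := inV_sq_grad i j hu; have s2 := inV_sq_grad i j hv.
rewrite -[(a *: gradV L u + gradV L v) i j]/(a *: gradV L u i j + gradV L v i j).
have sf := inV_sq_fmul i j hz hw.
by rewrite (sipD (sqZ a s1) s2 sf) (sipZ a s1 sf).
Qed.

Lemma normV_cvg_approx v : inV L v -> exists p : nat -> vfield R,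
  (forall n, solenoidal_trig_poly L (p n)) /\ normV L (p n - v) @[n --> \oo] --> (0 : R).
Proof.
move=> hv; have Hv := gradV_gradient hv; have [_ hG [p [Sp _ pG]]] := Hv.
exists p; split=> //.
have E n : normV L (p n - v) =
  Num.sqrt (normH L (grad (p n) 0 - gradV L v 0) ^+ 2 + normH L (grad (p n) 1 - gradV L v 1) ^+ 2).
  have Hd := V_gradient_lin L_gt0 (-1) Hv (V_gradient_solenoidal L_gt0 (Sp n)).
  have -> : p n - v = -1 *: v + p n by rewrite scaleN1r addrC.
  rewrite /normV (innerVE L_gt0 Hd Hd) sum2.
  have hd i : inL2 L (grad (p n) i - gradV L v i).
    by apply: inL2B => //; exact: solenoidal_grad_inL2.
  have F i : normH L (grad (p n) i - gradV L v i) ^+ 2 =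
    \sum_(j < 2) sip L ((-1 *: gradV L v + grad (p n)) i j) ((-1 *: gradV L v + grad (p n)) i j).
    rewrite normH_sqr// innerHE//; apply: eq_bigr => j _.
    have -> : (-1 *: gradV L v + grad (p n)) i j = (grad (p n) i - gradV L v i) j.
      rewrite -[LHS]/(-1 *: gradV L v i j + grad (p n) i j) scaleN1r addrC //.
    by [].
  by rewrite !F.
have -> : (fun n => normV L (p n - v)) = _ := funext E.
rewrite -[X in _ --> X]sqrtr0 -[X in _ --> Num.sqrt X](addr0 (0 : R)).
apply: continuous_cvg; first exact: sqrt_continuous.
have H i : normH L (grad (p n) i - gradV L v i) ^+ 2 @[n --> \oo] --> (0 : R).
  by rewrite -[X in _ --> X](expr0n R 2) ; exact: cvg_sqr.
exact: (cvgD (H 0) (H 1)).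
Qed.

(** The sum is the integral of [u] against the gradient of the polynomial [v . w], which vanishes by
    the weak divergence condition on [u]. *)
Lemma pairB_anti_trig u v w : inV L u -> solenoidal_trig_poly L v -> solenoidal_trig_poly L w ->
  pairB L u v w + pairB L u w v = 0.
Proof.
move=> hu Sv Sw.
have Hv := V_gradient_solenoidal L_gt0 Sv; have Hw := V_gradient_solenoidal L_gt0 Sw.
have hv : inV L v by exists (grad v). have hw : inV L w by exists (grad w).
rewrite (pairB_gradient hu hw Hv) (pairB_gradient hu hv Hw).
have [Tv _ _] := (solenoidalP L_gt0 v).1 Sv; have [Tw _ _] := (solenoidalP L_gt0 w).1 Sw.
rewrite /bform -big_split/=; under eq_bigr do rewrite -big_split/=.
rewrite exchange_big/= big1// => j _.
rewrite -[RHS](inV_weak_div L_gt0 hu (trigfunM (Tv j) (Tw j))).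
apply: eq_bigr => i _.
rewrite (partialM i (Tv j) (Tw j)).
have su := inV_sq i hu.
have t1 := sq_trig L_gt0 (trigfunM (trigfun_partial i (Tv j)) (Tw j)).
have t2 := sq_trig L_gt0 (trigfunM (Tv j) (trigfun_partial i (Tw j))).
rewrite [RHS]sipC (sipD t1 t2 su); congr (_ + _).
  by apply: eq_Rintegral => x _; rewrite /grad /fmul; ring.
by apply: eq_Rintegral => x _; rewrite /grad /fmul; ring.
Qed.

Lemma pairB_anti u v w : inV L u -> inV L v -> inV L w ->
  pairB L u v w = - pairB L u w v.
Proof.
move=> hu hv hw; apply/eqP; rewrite -addr_eq0 -normr_le0.
pose T x y := pairB L u x y + pairB L u y x.
have [p [Sp pv]] := normV_cvg_approx hv.
have [r [Sr rw]] := normV_cvg_approx hw.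
have pV n : inV L (p n) by exists (grad (p n)); exact: V_gradient_solenoidal.
have rV n : inV L (r n) by exists (grad (r n)); exact: V_gradient_solenoidal.
pose C := 4 / kappa0 L * normV L u.
have TC x y : inV L x -> inV L y -> `|T x y| <= C * (normV L x * normV L y).
  move=> hx hy; apply: (le_trans (ler_normD _ _)).
  have := lerD (pairB_leV hu hx hy) (pairB_leV hu hy hx) => H.
  have E (k a b c : R) : 2 / k * (c * a) * b + 2 / k * (c * b) * a = 4 / k * c * (b * a).
    by ring.
  by rewrite (E (kappa0 L) (normV L y) (normV L x) (normV L u)) in H.
have A (a b c d : R) : (-1 * a + b) + (-1 * c + d) = (b + d) - (a + c) by ring.
(* [T] vanishes on the approximating pairs, so bilinearity leaves only terms containing one of the
   small differences. *)
have E n : T v w = - T (p n - v) w - T (p n) (r n - w).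
  have e1 : T (p n - v) w = T (p n) w - T v w.
    have -> : p n - v = -1 *: v + p n by rewrite scaleN1r addrC.
    by rewrite /T (pairB_linm _ hv (pV n) hu hw) (pairB_linr _ hv (pV n) hw hu) A.
  have e2 : T (p n) (r n - w) = T (p n) (r n) - T (p n) w.
    have -> : r n - w = -1 *: w + r n by rewrite scaleN1r addrC.
    by rewrite /T (pairB_linr _ hw (rV n) (pV n) hu) (pairB_linm _ hw (rV n) hu (pV n)) A.
  have e3 : T (p n) (r n) = 0 by exact: pairB_anti_trig.
  have B (a b : R) : a = - (b - a) - (0 - b) by ring.
  by rewrite e1 e2 e3 -B.
have step n : `|T v w| <= C * (normV L (p n - v) * normV L w) +
    C * ((normV L (p n - v) + normV L v) * normV L (r n - w)).
  rewrite (E n); apply: (le_trans (ler_normD _ _)); rewrite !normrN.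
  have h1 := inVB L_gt0 (pV n) hv; have h2 := inVB L_gt0 (rV n) hw.
  apply: lerD; first exact: TC.
  apply: (le_trans (TC _ _ (pV n) h2)).
  rewrite ler_wpM2l//.
    by rewrite /C !mulr_ge0 ?invr_ge0 ?normV_ge0// ltW// kappa0_gt0.
  apply: ler_wpM2r; first exact: normV_ge0.
  by have := normVD L_gt0 h1 hv; rewrite subrK.
have gen (a b : nat -> R) (V W : R) : a n @[n --> \oo] --> (0 : R) ->
    b n @[n --> \oo] --> (0 : R) ->
    C * (a n * W) + C * ((a n + V) * b n) @[n --> \oo] --> C * (0 * W) + C * ((0 + V) * 0).
  move=> ca cb; apply: cvgD.
    by apply: cvgM; [exact: cvg_cst|apply: cvgM => //; exact: cvg_cst].
  apply: cvgM; first exact: cvg_cst.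
  by apply: cvgM => //; apply: cvgD => //; exact: cvg_cst.
have H := ler_cvg_to (cvg_cst `|T v w|) (gen _ _ _ _ pv rw) (nearW _ step).
have Z (a b c : R) : a * (0 * b) + a * ((0 + c) * 0) = 0 by ring.
have H2 : `|T v w| <= C * (0 * normV L w) + C * ((0 + normV L v) * 0) by exact: H.
by rewrite (Z C (normV L w) (normV L v)) in H2.
Qed.

Lemma pairB_self u w : inV L u -> inV L w -> pairB L u w w = 0.
Proof. by move=> hu hw; have := pairB_anti hu hw hw; lra. Qed.

End Trilinear.

(** * The inverse Stokes operator on low modes *)

Section InverseStokes.
Variables (R : realType) (L : R).
Hypothesis L_gt0 : 0 < L.
Implicit Types (f g h q : R * R -> R) (u v w z p : vfield R) (k : int * int) (i j : 'I_2).
Let mT := @measurable_torus R L.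

Lemma partial_sum i (s : seq (int * int)) (F : int * int -> R * R -> R) :
  (forall k, trigfun L (F k)) ->
  partial i (fun x => \sum_(k <- s) F k x) = (fun x => \sum_(k <- s) partial i (F k) x).
Proof.
move=> TF; elim: s => [|k s IH].
  have -> : (fun x => \sum_(k <- [::]) F k x) = (fun x => 0 * ck L 0 x).
    by apply/funext => x; rewrite big_nil mul0r.
  rewrite (partialZ i 0 (ck_trig L 0)).
  by apply/funext => x; rewrite big_nil mul0r.
have -> : (fun x => \sum_(k0 <- k :: s) F k0 x) =
    (fun x => F k x + \sum_(k0 <- s) F k0 x).
  by apply/funext => x; rewrite big_cons.
rewrite (partialD i (TF k) (trigfun_sum s xpredT TF)) IH.
by apply/funext => x; rewrite big_cons.
Qed.

Definition eigA k : R := kappa0 L ^+ 2 * knorm R k ^+ 2.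

(* [psik] is the k-th mode of the Fourier multiplier [c] applied to [g], and
   [dpsik] its partial derivative. *)
Definition psik (c : int * int -> R) g k x := c k * (fcos L g k * ck L k x + fsin L g k * sk L k x).
Definition dpsik (c : int * int -> R) g i k x :=
  c k * (kappa0 L * wavenum R k i * (fsin L g k * ck L k x - fcos L g k * sk L k x)).

Lemma psik_trig c g k : trigfun L (psik c g k).
Proof. by apply/trigfunZ/trigfunD; apply: trigfunZ; [exact: ck_trig|exact: sk_trig]. Qed.

Lemma dpsik_trig c g i k : trigfun L (dpsik c g i k).
Proof.
apply/trigfunZ/trigfunZ/trigfunB; apply: trigfunZ; [exact: ck_trig|exact: sk_trig].
Qed.

Lemma partial_psik c g i k : partial i (psik c g k) = dpsik c g i k.
Proof.
have [Tc Ts] := (ck_trig L k, sk_trig L k).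
rewrite /psik (partialZ i _ (trigfunD (trigfunZ _ Tc) (trigfunZ _ Ts))).
rewrite (partialD i (trigfunZ _ Tc) (trigfunZ _ Ts)) (partialZ i _ Tc) (partialZ i _ Ts).
rewrite /ck /sk partial_cos partial_sin.
by apply/funext => x; rewrite /dpsik /ck /sk; ring.
Qed.

Lemma partial_dpsik c g i k : partial i (dpsik c g i k) =
  (fun x => - ((kappa0 L * wavenum R k i) ^+ 2 * psik c g k x)).
Proof.
have E : dpsik c g i k = (fun x => (c k * (kappa0 L * wavenum R k i) * fsin L g k) * ck L k x +
    (- (c k * (kappa0 L * wavenum R k i) * fcos L g k)) * sk L k x).
  by apply/funext => x; rewrite /dpsik; ring.
rewrite E (partialD i (trigfunZ _ (ck_trig L k)) (trigfunZ _ (sk_trig L k))).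
rewrite (partialZ i _ (ck_trig L k)) (partialZ i _ (sk_trig L k)).
rewrite /ck /sk partial_cos partial_sin.
by apply/funext => x; rewrite /psik /ck /sk; ring.
Qed.

(* [stokes_inv N u] is A^-1 P_N u; the zero mode gets the coefficient
   [0^-1 = 0]. *)
Definition stokes_inv (N : R) u : vfield R := fun j x =>
  \sum_(k <- modes N) psik (fun k => (eigA k)^-1) (u j) k x.

Lemma stokes_inv_trig N u j : trigfun L (stokes_inv N u j).
Proof. by apply: trigfun_sum => k; exact: psik_trig. Qed.

Lemma partial_stokes_inv N u i j : partial i (stokes_inv N u j) =
  (fun x => \sum_(k <- modes N) dpsik (fun k => (eigA k)^-1) (u j) i k x).
Proof.
rewrite /stokes_inv partial_sum; last by move=> k; exact: psik_trig.
by apply/funext => x; apply: eq_bigr => k _; rewrite partial_psik.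
Qed.

Lemma knorm_eq0 k : knorm R k = 0 -> k = 0.
Proof.
move=> k0; have : knorm R k ^+ 2 = 0 by rewrite k0 expr0n.
rewrite knorm_sqr => /eqP; rewrite paddr_eq0 ?sqr_ge0// !sqrf_eq0 !intr_eq0.
by case: k {k0} => a b /= /andP[/eqP-> /eqP->].
Qed.

Lemma eigA_neq0 k : k != 0 -> eigA k != 0.
Proof.
move=> k0; rewrite /eigA mulf_neq0// sqrf_eq0 ?(gt_eqF (kappa0_gt0 L_gt0))//.
by apply: contra k0 => /eqP /knorm_eq0->.
Qed.

(** The Laplacian multiplies mode [k] by [- eigA k], undoing the multiplier of [stokes_inv]. *)
Lemma laplace_stokes_inv N u j : inV L u ->
  (fun x => \sum_(i < 2) partial i (partial i (stokes_inv N u j)) x) =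
  (fun x => - PN L N u j x).
Proof.
move=> hu; have Hu := gradV_gradient hu.
have m0 := h1fun_mean0 L_gt0 (V_gradient_h1fun L_gt0 j Hu).
have E i : partial i (partial i (stokes_inv N u j)) =
    (fun x => \sum_(k <- modes N) - ((kappa0 L * wavenum R k i) ^+ 2 *
       psik (fun k => (eigA k)^-1) (u j) k x)).
  rewrite partial_stokes_inv partial_sum; last by move=> k; exact: dpsik_trig.
  by apply/funext => x; apply: eq_bigr => k _; rewrite partial_dpsik.
apply/funext => x; rewrite sum2 !E PN_sPN /sPN -big_split/= -sumrN.
apply: eq_bigr => k _.
(* The default [0^-1 = 0] removes the zero mode from [stokes_inv]; nothing is lost, since [u] has
   mean zero. *)
have [->|k0] := eqVneq k 0.
  have -> : fcos L (u j) 0 = 0 by rewrite fcosE m0 mulr0.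
  by rewrite /psik /sk phase0 sin0; ring.
have e0 := eigA_neq0 k0.
have e : (kappa0 L * wavenum R k 0) ^+ 2 + (kappa0 L * wavenum R k 1) ^+ 2 = eigA k.
  by rewrite /eigA knorm_sqr /wavenum /=; ring.
by rewrite /psik -opprD -mulrDl e mulVKf.
Qed.

(** The Fourier form of the divergence condition, read off by testing it with the sine and the
    cosine of mode [k]. *)
Lemma inV_div_coef u k : inV L u ->
  \sum_(i < 2) wavenum R k i * fcos L (u i) k = 0 /\
  \sum_(i < 2) wavenum R k i * fsin L (u i) k = 0.
Proof.
move=> hu; have k0 := kappa0_gt0 L_gt0; have a0 := area_gt0 L_gt0.
have Ks i (a : R) f : sq L f -> sip L (u i) (fun x => a * f x) = a * sip L f (u i).
  move=> sf; rewrite sipC -[(fun x => a * f x)]/(a *: f) sipZ//; exact: inV_sq.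
have Ec i : sip L (u i) (partial i (sk L k)) = kappa0 L * wavenum R k i * (area L * fcos L (u i) k).
  rewrite /sk partial_sin Ks; last exact: (sq_trig L_gt0 (ck_trig L k)).
  by rewrite -(sip_fcos L_gt0) sipC.
have Es i : sip L (u i) (partial i (ck L k)) =
    - (kappa0 L * wavenum R k i) * (area L * fsin L (u i) k).
  rewrite /ck partial_cos Ks; last exact: (sq_trig L_gt0 (sk_trig L k)).
  by rewrite -(sip_fsin L_gt0) sipC.
have H1 := inV_weak_div L_gt0 hu (sk_trig L k).
have H2 := inV_weak_div L_gt0 hu (ck_trig L k).
rewrite sum2 !Ec in H1; rewrite sum2 !Es in H2; rewrite !sum2.
have key (a b c d x y : R) : x != 0 -> y != 0 ->
    x * a * (y * b) + x * c * (y * d) = 0 -> a * b + c * d = 0.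
  move=> x0 y0 H; have : x * y * (a * b + c * d) = 0 by rewrite -[RHS]H; ring.
  by move/eqP; rewrite !mulf_eq0 (negbTE x0) (negbTE y0) => /eqP.
have kn0 : kappa0 L != 0 by rewrite gt_eqF.
have an0 : area L != 0 by rewrite gt_eqF.
split; first exact: key kn0 an0 H1.
by apply: (key _ _ _ _ (- kappa0 L) (area L)) => //; [rewrite oppr_eq0|rewrite !mulNr -H2 !mulNr].
Qed.

Lemma stokes_inv_solenoidal N u : inV L u -> solenoidal_trig_poly L (stokes_inv N u).
Proof.
move=> hu; have Hu := gradV_gradient hu.
apply/(solenoidalP L_gt0); split.
- by move=> j; exact: stokes_inv_trig.
- move=> x; rewrite sum2 !partial_stokes_inv -big_split/= big1// => k _.
  have [Ha Hb] := inV_div_coef k hu; rewrite !sum2 in Ha Hb.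
  have -> : dpsik (fun k => (eigA k)^-1) (u 0) 0 k x + dpsik (fun k => (eigA k)^-1) (u 1) 1 k x =
    (eigA k)^-1 * kappa0 L * (
      (wavenum R k 0 * fsin L (u 0) k + wavenum R k 1 * fsin L (u 1) k) * ck L k x -
      (wavenum R k 0 * fcos L (u 0) k + wavenum R k 1 * fcos L (u 1) k) * sk L k x).
    by rewrite /dpsik; ring.
  by rewrite Ha Hb !mul0r subrr mulr0.
- move=> j; have s0 := sq_trig L_gt0 (ck_trig L 0).
  have m0 := h1fun_mean0 L_gt0 (V_gradient_h1fun L_gt0 j Hu).
  rewrite /stokes_inv sip_sum//; last by move=> k; exact: (sq_trig L_gt0 (psik_trig _ _ k)).
  rewrite big1// => k _.
  have sc := sq_trig L_gt0 (ck_trig L k); have ss := sq_trig L_gt0 (sk_trig L k).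
  have -> : psik (fun k => (eigA k)^-1) (u j) k =
      (eigA k)^-1 *: (fcos L (u j) k *: ck L k + fsin L (u j) k *: sk L k) by [].
  rewrite (sipZ _ (sqD (sqZ _ sc) (sqZ _ ss)) s0) (sipD (sqZ _ sc) (sqZ _ ss) s0).
  rewrite (sipZ _ sc s0) (sipZ _ ss s0) (sip_sk_ck L_gt0) mulr0 addr0 (sip_ck_ck L_gt0).
  rewrite oppr0 (_ : ((k == 0)%:R + (k == 0)%:R : R) = 2 * (k == 0)%:R); last by ring.
  have [->|k0] := eqVneq k 0; last by rewrite !mulr0.
  by rewrite fcosE m0 !(mulr0, mul0r).
Qed.

Lemma stokes_inv_inV N u : inV L u -> inV L (stokes_inv N u).
Proof.
by move=> hu; exists (grad (stokes_inv N u));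
  apply/(V_gradient_solenoidal L_gt0)/stokes_inv_solenoidal.
Qed.

Lemma sip_psik c g h k : sq L h ->
  sip L h (psik c g k) = area L * (c k * (fcos L g k * fcos L h k + fsin L g k * fsin L h k)).
Proof.
move=> sh; have sc := sq_trig L_gt0 (ck_trig L k); have ss := sq_trig L_gt0 (sk_trig L k).
have -> : psik c g k = c k *: (fcos L g k *: ck L k + fsin L g k *: sk L k) by [].
rewrite sipC (sipZ _ (sqD (sqZ _ sc) (sqZ _ ss)) sh) (sipD (sqZ _ sc) (sqZ _ ss) sh).
rewrite (sipZ _ sc sh) (sipZ _ ss sh) [sip L _ h]sipC (sip_fcos L_gt0).
by rewrite [sip L _ h]sipC (sip_fsin L_gt0); ring.
Qed.

(** [stokes_inv] has only modes below [N]. This is how agreement of two low-mode parts becomes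
    agreement of their pairings with the test field. *)
Lemma innerH_stokes_inv N u z : inV L u -> inL2 L z ->
  innerH L z (stokes_inv N u) = innerH L (PN L N z) (stokes_inv N u).
Proof.
move=> hu hz; have hp : inL2 L (stokes_inv N u) := inV_inL2 (stokes_inv_inV N hu).
have hq := PN_inL2 L_gt0 N z.
rewrite !innerHE//; apply: eq_bigr => j _.
have E h : sq L h -> sip L h (stokes_inv N u j) =
    \sum_(k <- modes N) sip L h (psik (fun k => (eigA k)^-1) (u j) k).
  move=> sh; rewrite sipC /stokes_inv sip_sum//.
    by apply: eq_bigr => k _; rewrite sipC.
  by move=> k; exact: (sq_trig L_gt0 (psik_trig _ _ k)).
rewrite (E _ (hz j)) (E _ (hq j)) big_seq [RHS]big_seq; apply: eq_bigr => k.
rewrite mem_modes => kN; rewrite (sip_psik _ _ _ (hz j)) (sip_psik _ _ _ (hq j)) PN_sPN.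
by rewrite (fcos_sPN L_gt0 (hz j) kN) (fsin_sPN L_gt0 (hz j) kN).
Qed.

(** Two integrations by parts' worth of A cancel A^-1: weak differentiation of [z] moves the second
    derivative onto [stokes_inv], where the Laplacian returns [- P_N u]. *)
Lemma innerV_stokes_inv N u z : inV L u -> inV L z ->
  innerV L z (stokes_inv N u) = innerH L (PN L N z) (PN L N u).
Proof.
move=> hu hz; have Hz := gradV_gradient hz; have hz2 := inV_inL2 hz.
have hu2 := inV_inL2 hu; have hp := PN_inL2 L_gt0 N u.
have Sp := stokes_inv_solenoidal N hu.
rewrite (innerVE L_gt0 Hz (V_gradient_solenoidal L_gt0 Sp)) exchange_big/=.
rewrite (innerH_PN_PN L_gt0 N hz2 hu2) (innerH_PN L_gt0 N hz2 hu2) innerHE//.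
apply: eq_bigr => j _; have [sz _ wz _] := V_gradient_h1fun L_gt0 j Hz.
have Td i := trigfun_partial i (stokes_inv_trig N u j).
have sdd i := sq_trig L_gt0 (trigfun_partial i (Td i)).
have E i : sip L (gradV L z i j) (grad (stokes_inv N u) i j) =
    - sip L (partial i (partial i (stokes_inv N u j))) (z j).
  by rewrite /grad (wz i _ (Td i)) sipC.
rewrite sum2 !E -opprD -(sipD (sdd 0) (sdd 1) sz).
have -> : partial 0 (partial 0 (stokes_inv N u j)) + partial 1 (partial 1 (stokes_inv N u j)) =
    -1 *: PN L N u j.
  apply/funext => x; have := f_equal (fun F : R * R -> R => F x) (laplace_stokes_inv N j hu).
  by rewrite /= sum2 => H; rewrite -[RHS]/(-1 * PN L N u j x) mulN1r -H.
by rewrite (sipZ _ (hp j) sz) mulN1r opprK sipC.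
Qed.

(** The zero mode belongs to the index set but contributes 0, the default value of the inverse. *)
Definition modes_sum (N : R) : R := \sum_(k <- modes N) (knorm R k) ^- 2.

Lemma modes_sum_ge0 N : 0 <= modes_sum N.
Proof. by apply: sumr_ge0 => k _; rewrite invr_ge0 sqr_ge0. Qed.

Lemma grad_stokes_inv_bound N u x :
  \sum_(i < 2) \sum_(j < 2) (partial i (stokes_inv N u j) x) ^+ 2 <=
  modes_sum N / kappa0 L ^+ 2 * \sum_(k <- modes N) \sum_(j < 2) coefsq L (u j) k.
Proof.
have k0 := kappa0_gt0 L_gt0.
have X0 := modes_sum_ge0 N.
pose m j k := fsin L (u j) k * ck L k x - fcos L (u j) k * sk L k x.
pose be i j k := knorm R k * ((eigA k)^-1 * (kappa0 L * wavenum R k i * m j k)).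
have H i j : (partial i (stokes_inv N u j) x) ^+ 2 <=
    modes_sum N * \sum_(k <- modes N) be i j k ^+ 2.
  rewrite partial_stokes_inv.
  (* The weights [|k|^-1] and [|k|] are those of the Cauchy-Schwarz step; at [k = 0] both sides
     vanish by the default inverse. *)
  have -> : \sum_(k <- modes N) dpsik (fun k => (eigA k)^-1) (u j) i k x =
      \sum_(k <- modes N) (knorm R k)^-1 * be i j k.
    apply: eq_bigr => k _; rewrite /be /dpsik -/(m j k).
    have [kn0|kn0] := eqVneq (knorm R k) 0; last by rewrite mulKf.
    by rewrite /eigA kn0 (expr2 0) !(mulr0, invr0, mul0r).
  apply: (le_trans (sum_CS _ _ _)); rewrite /modes_sum.
  by under eq_bigr do rewrite exprVn.
have H2 : \sum_(i < 2) \sum_(j < 2) (partial i (stokes_inv N u j) x) ^+ 2 <=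
    modes_sum N * \sum_(k <- modes N) \sum_(i < 2) \sum_(j < 2) be i j k ^+ 2.
  have -> : \sum_(k <- modes N) \sum_(i < 2) \sum_(j < 2) be i j k ^+ 2 =
      (\sum_(k <- modes N) be 0 0 k ^+ 2 + \sum_(k <- modes N) be 0 1 k ^+ 2) +
      (\sum_(k <- modes N) be 1 0 k ^+ 2 + \sum_(k <- modes N) be 1 1 k ^+ 2).
    by rewrite -!big_split/=; apply: eq_bigr => k _; rewrite !sum2.
  by rewrite !sum2 !mulrDr; exact: (lerD (lerD (H 0 0) (H 0 1)) (lerD (H 1 0) (H 1 1))).
apply: (le_trans H2); rewrite -mulrA; apply: ler_wpM2l => //.
rewrite mulr_sumr; apply: ler_sum => k _.
(* [m j k] is one coordinate of the coefficient pair rotated by the phase, hence no longer than the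
   pair; this makes the bound uniform in [x]. *)
have mle j : m j k ^+ 2 <= coefsq L (u j) k.
  rewrite /m /coefsq; have := cos2Dsin2 (phase L k x); rewrite -/(ck L k x) -/(sk L k x).
  move: (ck L k x) (sk L k x) (fsin L (u j) k) (fcos L (u j) k) => a b s c ab.
  have -> : c ^+ 2 + s ^+ 2 = (c ^+ 2 + s ^+ 2) * (a ^+ 2 + b ^+ 2) by rewrite ab mulr1.
  by rewrite -subr_ge0; have := sqr_ge0 (c * a + s * b); lra.
have -> : \sum_(i < 2) \sum_(j < 2) be i j k ^+ 2 =
    kappa0 L ^+ 2 * (knorm R k ^+ 2 * (eigA k)^-1) ^+ 2 * (m 0 k ^+ 2 + m 1 k ^+ 2).
  have -> : (knorm R k ^+ 2 * (eigA k)^-1) ^+ 2 =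
      knorm R k ^+ 2 * (eigA k)^-1 ^+ 2 * (wavenum R k 0 ^+ 2 + wavenum R k 1 ^+ 2).
    have <- : knorm R k ^+ 2 = wavenum R k 0 ^+ 2 + wavenum R k 1 ^+ 2 by exact: knorm_sqr.
    by ring.
  by rewrite !sum2 /be; ring.
have c0 j : 0 <= coefsq L (u j) k by rewrite /coefsq addr_ge0// sqr_ge0.
rewrite sum2; have [kn0|kn0] := eqVneq (knorm R k) 0.
  rewrite kn0 expr0n /= mul0r expr0n /= mulr0 mul0r.
  by apply: mulr_ge0; [rewrite invr_ge0 sqr_ge0|apply: addr_ge0].
have -> : kappa0 L ^+ 2 * (knorm R k ^+ 2 * (eigA k)^-1) ^+ 2 = (kappa0 L ^+ 2)^-1.
  by rewrite /eigA; field; rewrite kn0 gt_eqF.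
by apply: ler_wpM2l; [rewrite invr_ge0 sqr_ge0|apply: lerD].
Qed.

Lemma sq_mul_trig f g : sq L f -> trigfun L g -> sq L (fmul g f).
Proof.
move=> [mf if2] Tg; have [C C0 HC] := trigfun_bounded Tg.
have mg : measurable_fun (torus L) (g : measurableTypeR R * measurableTypeR R -> R).
  exact: measurable_funS (trigfun_measurable Tg).
have mgf := measurable_funM mg mf.
split; first exact: mgf.
apply: (@le_integrable _ _ _ (area2 R) _ mT _ (EFin \o (fun x => C ^+ 2 * f x ^+ 2))).
- by apply/measurable_EFinP; exact: measurable_funX.
- move=> x _ /=; rewrite lee_fin !ger0_norm ?sqr_ge0 //; last by apply: mulr_ge0; exact: sqr_ge0.
  rewrite /fmul exprMn; apply: ler_wpM2r; first exact: sqr_ge0.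
  by rewrite -(real_normK (num_real (g x))) lerXn2r ?nnegrE.
- exact: (integrableZl mT (C ^+ 2) if2).
Qed.

(* The gradient falls on the trigonometric polynomial, so only its sup norm
   and the [L^2] norms of the other two arguments enter. *)
Lemma pairB_stokes_inv N u z w : inV L u -> inV L z -> inV L w ->
  `|pairB L z (stokes_inv N u) w| <=
  Num.sqrt (modes_sum N / kappa0 L ^+ 2 * (normH L (PN L N u) ^+ 2 / area L)) *
  normH L z * normH L w.
Proof.
move=> hu hz hw; have hz2 := inV_inL2 hz; have hw2 := inV_inL2 hw.
have hu2 := inV_inL2 hu; have hp := PN_inL2 L_gt0 N u.
have a0 := area_gt0 L_gt0.
have X0 := modes_sum_ge0 N.
set K2 := modes_sum N / _ * _.
(* Parseval: the squared coefficients below [N] sum to |P_N u|^2 divided by the area. *)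
have K2E : K2 = modes_sum N / kappa0 L ^+ 2 * \sum_(k <- modes N) \sum_(j < 2) coefsq L (u j) k.
  rewrite /K2; congr (_ * _); rewrite normH_sqr// innerHE// sum2 !PN_sPN.
  rewrite (sip_sPN_coef L_gt0 N (hu2 0)) (sip_sPN_coef L_gt0 N (hu2 1)) -mulrDr.
  rewrite mulrAC mulfV ?gt_eqF// mul1r -big_split/=.
  by apply: eq_bigr => k _; rewrite sum2.
have K20 : 0 <= K2.
  by apply: mulr_ge0; [rewrite divr_ge0 ?sqr_ge0|rewrite divr_ge0 ?sqr_ge0// ltW].
pose M i j := partial i (stokes_inv N u j).
have TM i j : trigfun L (M i j) := trigfun_partial i (stokes_inv_trig N u j).
pose y : vfield R := fun i x => M i 0 x * w 0 x + M i 1 x * w 1 x.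
have sMw i j := sq_mul_trig (hw2 j) (TM i j).
have hy : inL2 L y by move=> i; exact: (sqD (sMw i 0) (sMw i 1)).
have E : pairB L z (stokes_inv N u) w = innerH L z y.
  rewrite (pairB_gradient L_gt0 hz hw (V_gradient_solenoidal L_gt0 (stokes_inv_solenoidal N hu))).
  rewrite innerHE// /bform; apply: eq_bigr => i _.
  have -> : y i = fmul (M i 0) (w 0) + fmul (M i 1) (w 1) by [].
  rewrite [RHS]sipC (sipD (sMw i 0) (sMw i 1) (hz2 i)) sum2.
  by congr (_ + _); apply: eq_Rintegral => x _; rewrite /grad /fmul /M; ring.
have ny : normH L y <= Num.sqrt K2 * normH L w.
  apply: le_of_sqr; first by apply: mulr_ge0; exact: sqrtr_ge0.
  rewrite exprMn (sqr_sqrtr K20) (normH_sqr hy) (normH_sqr hw2).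
  rewrite (innerHE hy hy) (innerHE hw2 hw2) !sum2.
  have Iy i := sqint_mul mT (hy i) (hy i).
  have Iw i := sqint_mul mT (hw2 i) (hw2 i).
  have Iw2 := integrableD mT (Iw 0) (Iw 1).
  rewrite /sip /ipl2 -(RintegralD mT (Iy 0) (Iy 1)) -(RintegralD mT (Iw 0) (Iw 1)).
  rewrite -(RintegralZl K2 mT Iw2).
  apply: (le_Rintegral mT (integrableD mT (Iy 0) (Iy 1)) (integrableZl mT K2 Iw2)) => x _.
  have := grad_stokes_inv_bound N u x; rewrite -K2E !sum2 -/(M 0 0) -/(M 0 1) -/(M 1 0) -/(M 1 1).
  rewrite /y; move: (M 0 0 x) (M 0 1 x) (M 1 0 x) (M 1 1 x) (w 0 x) (w 1 x).
  move=> a b c d s t H.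
  (* A matrix acts on a vector with at most its Frobenius norm; the defect is a sum of two squares
     by Lagrange's identity. *)
  apply: (@le_trans _ _ ((a ^+ 2 + b ^+ 2 + (c ^+ 2 + d ^+ 2)) * (s * s + t * t))).
    rewrite -subr_ge0.
    have -> : (a ^+ 2 + b ^+ 2 + (c ^+ 2 + d ^+ 2)) * (s * s + t * t) -
      ((a * s + b * t) * (a * s + b * t) + (c * s + d * t) * (c * s + d * t)) =
      (a * t - b * s) ^+ 2 + (c * t - d * s) ^+ 2 by ring.
    by apply: addr_ge0; exact: sqr_ge0.
  by apply: ler_wpM2r => //; rewrite -!expr2; apply: addr_ge0; exact: sqr_ge0.
rewrite E; apply: (le_trans (innerH_CS hz2 hy)).
by rewrite mulrAC [_ * normH L z]mulrC; apply: ler_wpM2l => //; exact: normH_ge0.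
Qed.

Lemma modes_sum_le (N : R) :
  modes_sum N <= \sum_(k \in [set k : int * int | 0 < knorm R k <= N]) (knorm R k) ^- 2.
Proof.
have fD : finite_set [set k : int * int | knorm R k <= N].
  apply: sub_finite_set (finite_knorm_lt (N + 1)) => k /= kN.
  by apply: (le_lt_trans kN); rewrite ltrDl.
have -> : \sum_(k \in [set k : int * int | 0 < knorm R k <= N]) (knorm R k) ^- 2 =
    \sum_(k \in [set k : int * int | knorm R k <= N]) (knorm R k) ^- 2.
  apply: fsbig_widen => [k /= /andP[]//|k [/= kN nk]] /=.
  have -> : knorm R k = 0.
    apply/eqP; rewrite eq_le knorm_ge0 andbT leNgt; apply/negP => k0.
    by apply: nk; rewrite k0 kN.
  by rewrite expr0n /= invr0.
rewrite fsbig_finite// (bigID (fun k => knorm R k < N))/= /modes_sum.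
have -> : \sum_(k <- fset_set [set k : int * int | knorm R k <= N] | knorm R k < N) knorm R k ^- 2 =
    \sum_(k <- modes N) knorm R k ^- 2.
  rewrite -big_filter; apply: perm_big; apply: uniq_perm.
  - exact/filter_uniq/fset_uniq.
  - exact: fset_uniq.
  - move=> k; rewrite mem_filter mem_modes in_fset_set//.
    apply/andP/idP => [[]//|kN]; split=> //.
    by rewrite inE /=; exact: ltW.
by rewrite lerDl; apply: sumr_ge0 => k _; rewrite invr_ge0 sqr_ge0.
Qed.

End InverseStokes.

(** * Mean value estimates and negligible remainders *)

Section RealCalculus.
Variable R : realType.

Lemma is_derive_lipschitz (y dy : R -> R) (M : R) :
  (forall t : R, is_derive t (1:R) y (dy t)) -> (forall t, `|dy t| <= M) ->
  forall s t, `|y s - y t| <= M * `|s - t|.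
Proof.
move=> Hy HM s t; wlog st : s t / s < t => [H|].
  have [|ts|->] := ltgtP s t; [exact: H| |by rewrite !subrr normr0 mulr0].
  by rewrite (distrC (y s)) (distrC s); exact: H.
have Hc : {within `[s, t], continuous y}.
  apply: continuous_subspaceT => z.
  by apply: differentiable_continuous; apply/derivable1_diffP.
have [c _ E] := MVT st (fun x _ => Hy x) Hc.
by rewrite distrC E normrM (distrC s); apply: ler_wpM2r.
Qed.

Lemma is_derive_small (r e : R -> R) (t : R) :
  (forall s, `|r s| <= `|s - t| * e s) -> e s @[s --> t] --> (0 : R) ->
  is_derive t (1:R) r 0.
Proof.
move=> Hr He.
have rt : r t = 0.
  by apply/eqP; rewrite -normr_le0; have := Hr t; rewrite subrr normr0 mul0r.
have H : h^-1 *: ((r \o shift t) (h *: (1 : R)) - r t) @[h --> 0^'] --> (0 : R).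
  apply/cvgrPdist_le => d d0.
  move/cvgrPdist_le : He => /(_ _ d0) [eta /= eta0 Heta].
  exists eta => //= h hd hn0.
  have {}hd : `|h| < eta by move: hd; rewrite /ball_ /= sub0r normrN.
  rewrite sub0r normrN rt subr0 (_ : h%:A = h); last exact: mulr1.
  have : `|0 - e (h + t)| <= d.
    by apply: Heta; rewrite /ball_ /= opprD addrCA subrr addr0 normrN.
  rewrite sub0r normrN => eh.
  have nh : 0 < `|h| by rewrite normr_gt0.
  rewrite -[h^-1 *: _]/(h^-1 * r (h + t)) normrM normfV mulrC ler_pdivrMr//.
  apply: (le_trans (Hr _)); rewrite addrK mulrC; apply: ler_wpM2r => //.
  exact: (le_trans (ler_norm _)).
by split; [apply/cvg_ex; exists 0|exact: (cvg_lim (@Rhausdorff R) H)].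
Qed.

End RealCalculus.

(** Holds for unbounded or empty sets too, because their [sup] is 0 by default. *)
Lemma sup_nonneg (R : realType) (A : set R) : (forall x, A x -> 0 <= x) -> 0 <= sup A.
Proof.
move=> A0; have [hA|nA] := pselect (has_sup A); last by rewrite sup_out.
by have [x Ax] := hA.1; apply: (le_trans (A0 _ Ax)); exact: sup_upper_bound.
Qed.

(** * Energy identity *)

Section Energy.
Variables (R : realType) (L : R).
Hypothesis L_gt0 : 0 < L.

(* Testing the weak equation against the fixed field [z s - z t] and the mean
   value theorem make the quadratic remainder of [|z s|^2] negligible, so no
   time regularisation is needed. *)
Lemma energy_derive (z : R -> vfield R) (F : R -> vfield R -> R) (K : R) :
  (forall t, inV L (z t)) ->
  (forall t, normV L (z s - z t) @[s --> t] --> (0 : R)) ->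
  (forall (t : R) w, inV L w -> is_derive t (1:R) (fun s : R => innerH L (z s) w) (F t w)) ->
  (forall t w, inV L w -> `|F t w| <= K * normV L w) ->
  forall t : R, is_derive t (1:R) (fun s : R => normH L (z s) ^+ 2) (2 * F t (z t)).
Proof.
move=> hz cz dz Fb t; have hz2 s := inV_inL2 (hz s).
pose r s := innerH L (z s - z t) (z s - z t).
(* Expansion of |z s|^2 about time [t]: the linear term pairs with the fixed field [z t], so the
   weak equation differentiates it, and [r] is the remainder. *)
have E : (fun s : R => normH L (z s) ^+ 2) =
    (fun s : R => 2 * innerH L (z s) (z t) - innerH L (z t) (z t) + r s).
  apply/funext => s; rewrite normH_sqr// /r.
  rewrite (innerHB (hz2 s) (hz2 t) (inL2B (hz2 s) (hz2 t))).
  rewrite ![innerH L _ (z s - z t)]innerHC.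
  rewrite (innerHB (hz2 s) (hz2 t) (hz2 s)) (innerHB (hz2 s) (hz2 t) (hz2 t)).
  by rewrite [innerH L (z t) (z s)]innerHC; ring.
have dr : is_derive t (1:R) r 0.
  apply: (@is_derive_small _ _ (fun s => K * normV L (z s - z t))); last first.
    rewrite -[X in _ --> X](mulr0 K); apply: cvgM; [exact: cvg_cst|exact: cz].
  move=> s; have hw := inVB L_gt0 (hz s) (hz t).
  have := is_derive_lipschitz (fun x => dz x _ hw) (fun x => Fb x _ hw) s t.
  rewrite -(innerHB (hz2 s) (hz2 t) (inV_inL2 hw)) => H.
  by rewrite mulrC.
have dt := dz t _ (hz t).
rewrite E; apply: is_derive_eq; rewrite /GRing.scale/=; ring.
Qed.

Lemma normCbH_ge (phi : R -> vfield R) (C : R) : (forall t, normH L (phi t) <= C) ->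
  forall t, normH L (phi t) <= normCbH L phi.
Proof.
move=> HC t; apply: sup_upper_bound; last by exists t.
split; first by exists (normH L (phi t)), t.
by exists C => _ [s _ <-].
Qed.

Lemma normCbH_le (phi : R -> vfield R) (C : R) : (forall t, normH L (phi t) <= C) ->
  normCbH L phi <= C.
Proof.
move=> HC; apply: sup_le_ub; first by exists (normH L (phi 0)), 0.
by move=> _ [s _ <-].
Qed.

Lemma normCbH_ge0 (phi : R -> vfield R) : 0 <= normCbH L phi.
Proof. by apply: sup_nonneg => _ [s _ <-]; exact: sqrtr_ge0. Qed.

Lemma normCbV_ge0 (phi : R -> vfield R) : 0 <= normCbV L phi.
Proof. by apply: sup_nonneg => _ [s _ <-]; exact: sqrtr_ge0. Qed.

Lemma normCbV_ge (phi : R -> vfield R) : inCbV L phi ->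
  forall t, normV L (phi t) <= normCbV L phi.
Proof.
move=> [_ _ ub] t; apply: sup_upper_bound; last by exists t.
by split=> //; exists (normV L (phi t)), t.
Qed.

Lemma inCbV_normH (phi : R -> vfield R) : inCbV L phi ->
  forall t, normH L (phi t) <= normCbV L phi / kappa0 L.
Proof.
move=> Hphi t; have [hV _ _] := Hphi; rewrite ler_pdivlMr ?kappa0_gt0// mulrC.
exact: le_trans (normV_poincare L_gt0 (hV t)) (normCbV_ge Hphi t).
Qed.

Lemma inCbV_normH_Cb (phi : R -> vfield R) : inCbV L phi ->
  forall t, normH L (phi t) <= normCbH L phi.
Proof. by move=> /inCbV_normH/normCbH_ge. Qed.

End Energy.

(** * Scalar inequalities behind the energy estimates and the constants *)

Section Arithmetic.
Variable R : realType.
Implicit Types (a b x y : R).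

Lemma absorb_linear (A a n : R) : 0 < a -> 2 * (A * n - a * n ^+ 2) <= - a * n ^+ 2 + A ^+ 2 / a.
Proof.
move=> a0; rewrite -subr_ge0.
have -> : - a * n ^+ 2 + A ^+ 2 / a - 2 * (A * n - a * n ^+ 2) = (a * n - A) ^+ 2 / a.
  by field; rewrite gt_eqF.
by rewrite divr_ge0 ?sqr_ge0// ltW.
Qed.

(** [n], [p], [V] are |w|, |P_N w|, ||w||; [D] is the viscosity mismatch and [B] the trilinear term.
    Of [gam V^2], a quarter pays for [D] and an eighth for [B]; after doubling, the remaining 5/4,
    with nudging on the low modes, dominates [5/4 gam K^2 n^2]. *)
Lemma energy_arith (gam mu K U del n p V D B : R) : 0 < gam -> 0 <= K -> 0 <= U ->
  0 <= n -> 0 <= V -> gam * K ^+ 2 <= mu -> K ^+ 2 * (n ^+ 2 - p ^+ 2) <= V ^+ 2 ->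
  8 * U <= gam * K -> `|D| <= del * U * V -> `|B| <= 2 * (n * V) * U ->
  2 * (- mu * p ^+ 2 - gam * V ^+ 2 - D - B) <=
  - (gam * K ^+ 2) * n ^+ 2 + 2 * (del ^+ 2 * U ^+ 2 / gam).
Proof.
move=> g0 K0 U0 n0 V0 muK tail UK /ler_normlP[D1 _] /ler_normlP[B1 _].
have h1 : del * U * V <= gam * V ^+ 2 / 4 + del ^+ 2 * U ^+ 2 / gam.
  rewrite -subr_ge0.
  have -> : gam * V ^+ 2 / 4 + del ^+ 2 * U ^+ 2 / gam - del * U * V =
    (gam * V / 2 - del * U) ^+ 2 / gam by field; rewrite gt_eqF.
  by rewrite divr_ge0 ?sqr_ge0// ltW.
(* The smallness condition [8 U <= gam K] is spent here. *)
have h2 : 2 * (n * V) * U <= gam * (V ^+ 2 + K ^+ 2 * n ^+ 2) / 8.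
  have nV : 0 <= n * V by exact: mulr_ge0.
  have := ler_wpM2l nV UK.
  have : 0 <= gam * (V - K * n) ^+ 2 by rewrite mulr_ge0 ?sqr_ge0// ltW.
  nra.
have h3 : gam * (K ^+ 2 * (n ^+ 2 - p ^+ 2)) <= gam * V ^+ 2 by rewrite ler_wpM2l// ltW.
have h4 : gam * K ^+ 2 * p ^+ 2 <= mu * p ^+ 2 by rewrite ler_wpM2r// sqr_ge0.
have h5 : 0 <= gam * K ^+ 2 * p ^+ 2.
  by apply: mulr_ge0; [apply: mulr_ge0; [exact: ltW|exact: sqr_ge0]|exact: sqr_ge0].
lra.
Qed.

Lemma nudging_arith (gam mu k n p V uu ff i1 i2 : R) :
  mu * i1 <= mu * (uu * n) -> i2 <= ff * n ->
  gam * (k ^+ 2 * (n ^+ 2 - p ^+ 2)) <= gam * V ^+ 2 ->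
  gam * k ^+ 2 * p ^+ 2 <= mu * p ^+ 2 ->
  i2 + mu * (i1 - p ^+ 2) - gam * V ^+ 2 <= (ff + mu * uu) * n - gam * k ^+ 2 * n ^+ 2.
Proof.
have -> : gam * (k ^+ 2 * (n ^+ 2 - p ^+ 2)) = gam * k ^+ 2 * n ^+ 2 - gam * k ^+ 2 * p ^+ 2.
  by ring.
have -> : (ff + mu * uu) * n = ff * n + mu * (uu * n) by ring.
rewrite mulrBr; lra.
Qed.

Lemma le_sqrt2_sum (x y : R) : 0 <= x -> 0 <= y ->
  x + y <= Num.sqrt 2 * Num.sqrt (x ^+ 2 + y ^+ 2).
Proof.
move=> x0 y0; apply: le_of_sqr; first by rewrite mulr_ge0 ?sqrtr_ge0.
rewrite exprMn !sqr_sqrtr ?addr_ge0 ?sqr_ge0//.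
by have := sqr_ge0 (x - y); nra.
Qed.

Lemma le_sqrt2_weighted (X m x : R) : 0 <= X -> 1 <= m -> 0 <= x ->
  x <= Num.sqrt 2 * Num.sqrt (X + m ^+ 2 * x ^+ 2).
Proof.
move=> X0 m1 x0.
have m2 : 1 <= m ^+ 2 by rewrite expr_ge1// (le_trans ler01).
have H := ler_wpM2r (sqr_ge0 x) m2; rewrite mul1r in H.
have x20 := sqr_ge0 x.
apply: le_of_sqr; first by rewrite mulr_ge0 ?sqrtr_ge0.
rewrite exprMn !sqr_sqrtr//; lra.
Qed.

Lemma sqrt_factor (m k a q : R) : 0 <= m -> 0 < k -> 0 < a -> 0 <= q ->
  Num.sqrt (m / k ^+ 2 * (q ^+ 2 / a)) = Num.sqrt m / (k * Num.sqrt a) * q.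
Proof.
move=> m0 k0 a0 q0; have sa : 0 < Num.sqrt a by rewrite sqrtr_gt0.
have e0 : 0 <= Num.sqrt m / (k * Num.sqrt a) * q.
  by rewrite mulr_ge0// divr_ge0 ?sqrtr_ge0// mulr_ge0 ?sqrtr_ge0// ltW.
rewrite -[RHS]ger0_norm// -sqrtr_sqr; congr Num.sqrt.
rewrite exprMn expr_div_n [(k * _) ^+ 2]exprMn (sqr_sqrtr m0) (sqr_sqrtr (ltW a0)); field.
by rewrite !gt_eqF.
Qed.

(** [s], [sa], [q], [d] are the roots of the mode sum and of the area, |P_N u(t)| and |gam - nu|.
    The hypothesis is linear in [d] on both sides, so the viscosity gap cancels, together with one
    [q]. *)
Lemma low_modes_arith (s k sa q nu gam N d U MV MH : R) :
  0 <= s -> 0 < k -> 0 < sa -> 0 <= q -> 0 < nu -> nu <= gam -> 0 < N -> 0 < d ->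
  0 <= U -> U <= MV -> 0 <= MH ->
  d * q ^+ 2 <= 2 * (s / (k * sa) * q * MH) * (2 * (d * U) / (gam * (k * N))) ->
  N * q <= 4 * s / (nu * k ^+ 2 * sa) * (MH * MV).
Proof.
move=> s0 k0 sa0 q0 nu0 nug N0 d0 U0 UM M0 H.
have gam0 := lt_le_trans nu0 nug; have MV0 := le_trans U0 UM.
have c0 : 0 <= 4 * s / (k ^+ 2 * sa) * MH.
  by rewrite mulr_ge0// divr_ge0 ?mulr_ge0 ?sqr_ge0// ltW.
have H1 : U / gam <= MV / nu.
  by apply: (ler_pM U0 _ UM); rewrite ?invr_ge0 ?(ltW gam0)// lef_pV2 ?posrE.
have H2 := ler_wpM2l c0 H1.
have -> : 4 * s / (nu * k ^+ 2 * sa) * (MH * MV) = 4 * s / (k ^+ 2 * sa) * MH * (MV / nu).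
  by field; rewrite !gt_eqF.
(* [q] may vanish at a single time, since only its supremum over time is known to be positive. *)
apply: le_trans H2; have [->|qn] := eqVneq q 0.
  by rewrite mulr0; exact: mulr_ge0 c0 (divr_ge0 U0 (ltW gam0)).
have qp : 0 < q by rewrite lt_neqAle eq_sym qn.
have dq : 0 < d * q / N by rewrite divr_gt0// mulr_gt0.
rewrite -(ler_pM2l dq).
have -> : d * q / N * (N * q) = d * q ^+ 2 by field; rewrite gt_eqF.
apply: (le_trans H); rewrite le_eqVlt; apply/orP; left; apply/eqP.
by field; rewrite !gt_eqF.
Qed.

End Arithmetic.

#[local] Opaque kappa0 normH normV innerH innerV pairB normCbH normCbV PN stokes_inv modes_sum.

(** * The determining map *)

Section Flow.
Variables (R : realType) (L : R).
Hypothesis L_gt0 : 0 < L.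
Implicit Types (f g u v : R -> vfield R).

Definition rhs (gam : R) g v (t : R) w :=
  innerH L (g t) w - gam * innerV L (v t) w - pairB L (v t) (v t) w.

(** Provides the V' bound, uniform in time, that [energy_derive] requires. *)
Lemma rhs_bound gam g v (A : R) : inCbV L v -> (forall t, inL2 L (g t)) ->
  (forall t, normH L (g t) <= A) ->
  exists K, forall t w, inV L w -> `|rhs gam g v t w| <= K * normV L w.
Proof.
move=> Hv hg gA; have [hv _ _] := Hv; have k0 := kappa0_gt0 L_gt0.
set Vs := normCbV L v.
have Vs0 : 0 <= Vs := normCbV_ge0 L v.
exists (A / kappa0 L + `|gam| * Vs + 2 / kappa0 L * (Vs * Vs)) => t w hw.
have vt : normV L (v t) <= Vs := normCbV_ge Hv t.
have w0 : 0 <= normV L w := normV_ge0 L w.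
have v0 : 0 <= normV L (v t) := normV_ge0 L (v t).
have h1 : `|innerH L (g t) w| <= A / kappa0 L * normV L w.
  apply: (le_trans (innerH_CS (hg t) (inV_inL2 hw))).
  have -> : A / kappa0 L * normV L w = A * (normV L w / kappa0 L) by rewrite mulrAC mulrA.
  apply: ler_pM; [exact: normH_ge0|exact: normH_ge0|exact: gA|].
  by rewrite (ler_pdivlMr _ _ k0) mulrC; exact: (normV_poincare L_gt0 hw).
have h2 : `|gam * innerV L (v t) w| <= `|gam| * Vs * normV L w.
  rewrite normrM -mulrA; apply: ler_wpM2l => //.
  apply: (le_trans (innerV_CS L_gt0 (hv t) hw)); exact: (ler_wpM2r w0 vt).
have h3 : `|pairB L (v t) (v t) w| <= 2 / kappa0 L * (Vs * Vs) * normV L w.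
  apply: (le_trans (pairB_leV L_gt0 (hv t) (hv t) hw)).
  have E (a b : R) : 2 / kappa0 L * (a * b) * a = 2 / kappa0 L * (a * a) * b by ring.
  rewrite (E (normV L (v t)) (normV L w)); apply: (ler_wpM2r w0).
  apply: ler_wpM2l; first by rewrite divr_ge0// ltW.
  exact: (ler_pM v0 v0 vt vt).
rewrite 2!mulrDl; apply: (le_trans (ler_normB _ _)); apply: (lerD _ h3).
exact: (le_trans (ler_normB _ _) (lerD h1 h2)).
Qed.

Lemma PN_normH_cvg0 N (u v : vfield R) : inL2 L u -> inL2 L v -> normH L (v - u) = 0 ->
  normH L (PN L N v - PN L N u) = 0.
Proof.
move=> hu hv H; apply/eqP; rewrite eq_le normH_ge0 andbT -H -(PNB L_gt0 N hv hu).
by apply: (normH_PN_le L_gt0); exact: inL2B.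
Qed.

Variables (nu0 nu1 nu mu0 mu N : R) (f u : R -> vfield R).
Hypotheses (nu0_gt0 : 0 < nu0) (nu0_lt_nu1 : nu0 < nu1).
Hypothesis hf : inCbV L f.
Hypothesis hnu : nu \in `[nu0, nu1].
Hypothesis hu : NSE_solution L nu f u.
Hypothesis hmu0 : nu1 / nu0 <= mu0.
Hypothesis N_ge1 : 1 <= N.
Hypothesis hmu : mu = mu0 * nu0 * kappa0 L ^+ 2 * N ^+ 2.
Hypothesis hN : 8 / (nu0 * kappa0 L) * MV L nu0 mu0 f u < N.

Let K := kappa0 L * N.
Let U := normCbV L u.
Let hV t : inV L (u t). Proof. by have [[hV _ _] _] := hu. Qed.
Let uCb : inCbV L u. Proof. by have [] := hu. Qed.
Let f2 t : inL2 L (f t). Proof. by have [hfV _ _] := hf; exact: inV_inL2. Qed.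

Let mu0_ge1 : 1 <= mu0.
Proof. by apply: le_trans hmu0; rewrite ler_pdivlMr// mul1r ltW. Qed.

Let kap_gt0 : 0 < kappa0 L. Proof. exact: kappa0_gt0. Qed.

Let N_gt0 : 0 < N. Proof. exact: lt_le_trans N_ge1. Qed.

Let K_gt0 : 0 < K. Proof. exact: mulr_gt0. Qed.

Lemma normCbV_le_MV : U <= MV L nu0 mu0 f u.
Proof.
have U0 : 0 <= U := normCbV_ge0 L u.
rewrite /MV -/U; set X := 1 / _ * _ .
have X0 : 0 <= X by apply: mulr_ge0; [rewrite divr_ge0 ?sqr_ge0|exact: sqr_ge0].
exact: le_sqrt2_weighted.
Qed.

(** The first condition on [N] in the form used by the energy estimate, for every candidate
    viscosity at once. *)
Lemma U_small (gam : R) : nu0 <= gam -> 8 * U <= gam * K.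
Proof.
move=> g0; have := normCbV_le_MV => UM.
have H : 8 * MV L nu0 mu0 f u < nu0 * K.
  have nk : 0 < nu0 * kappa0 L by exact: mulr_gt0.
  by move: hN; rewrite mulrAC ltr_pdivrMr// /K [N * _]mulrC mulrA.
have h : nu0 * K <= gam * K by rewrite ler_wpM2r// ltW.
lra.
Qed.

(** [x] is the share of the forcing and [y] that of the data; [x + y <= sqrt 2 sqrt (x^2 + y^2)]
    accounts for the factor [sqrt 2] in M_H. *)
Lemma MH_ge (x y : R) : 0 <= x -> x <= normCbH L f / (nu0 * kappa0 L ^+ 2) ->
  0 <= y -> y <= mu0 * normCbH L u -> x + y <= MH L nu0 mu0 f u.
Proof.
move=> x0 xle y0 yle.
have a0 : 0 <= normCbH L f / (nu0 * kappa0 L ^+ 2) := le_trans x0 xle.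
have b0 : 0 <= mu0 * normCbH L u := le_trans y0 yle.
apply: (le_trans (lerD xle yle)); apply: (le_trans (le_sqrt2_sum a0 b0)).
rewrite /MH div1r [(mu0 * _) ^+ 2]exprMn expr_div_n [_ ^- 2 * _]mulrC; exact: lexx.
Qed.

Lemma normH_le_MH t : normH L (u t) <= MH L nu0 mu0 f u.
Proof.
have F0 := normCbH_ge0 L f; have U0 := normCbH_ge0 L u.
rewrite -[leLHS]add0r; apply: MH_ge => //.
- by rewrite divr_ge0// mulr_ge0 ?sqr_ge0// ltW.
- exact: normH_ge0.
- apply: (le_trans (inCbV_normH_Cb L_gt0 uCb t)).
  by rewrite -[leLHS]mul1r ler_wpM2r.
Qed.

(** * Estimates for one candidate viscosity *)

Section Viscosity.
Variables (gam : R) (v : R -> vfield R).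
Hypothesis hgam : gam \in `[nu0, nu1].
Hypothesis hv : determining_solution L mu N f gam (fun t => PN L N (u t)) v.

Let g t := f t + mu *: (PN L N (u t) - PN L N (v t)).
Let vV t : inV L (v t). Proof. by have [[h _ _] _] := hv. Qed.
Let vCb : inCbV L v. Proof. by have [] := hv. Qed.
Let gam_ge : nu0 <= gam. Proof. by move: hgam; rewrite in_itv/= => /andP[]. Qed.
Let gam_gt0 : 0 < gam. Proof. exact: lt_le_trans gam_ge. Qed.
Let u2 t : inL2 L (u t). Proof. exact: inV_inL2. Qed.
Let v2 t : inL2 L (v t). Proof. exact: inV_inL2. Qed.
Let pu t : inL2 L (PN L N (u t)). Proof. exact: PN_inL2. Qed.
Let pv t : inL2 L (PN L N (v t)). Proof. exact: PN_inL2. Qed.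
Let g2 t : inL2 L (g t).
Proof. by apply: inL2D => //; apply: inL2Z; exact: inL2B. Qed.

(** Here [mu0 >= nu1 / nu0] acts: nudging damps the low modes at least as strongly as viscosity
    [gam] damps the high ones, whatever [gam] in the interval. *)
Let mu_ge : gam * K ^+ 2 <= mu.
Proof.
rewrite hmu /K exprMn mulrA; apply: ler_wpM2r; first exact: sqr_ge0.
apply: ler_wpM2r; first exact: sqr_ge0.
have gle : gam <= nu1 by move: hgam; rewrite in_itv/= => /andP[].
by apply: (le_trans gle); rewrite -ler_pdivrMr.
Qed.

Let mu_ge0 : 0 <= mu.
Proof. by apply: le_trans mu_ge; apply: mulr_ge0; [exact: ltW|exact: sqr_ge0]. Qed.

Let g_bound : exists A, forall t, normH L (g t) <= A.
Proof.
exists (normCbH L f + `|mu| * (normCbH L u + normCbH L v)) => t.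
apply: (le_trans (normHD (f2 t) (inL2Z _ (inL2B (pu t) (pv t))))); apply: lerD.
  exact: (inCbV_normH_Cb L_gt0 hf).
rewrite normHZ; last exact: inL2B.
apply: ler_wpM2l => //; apply: (le_trans (normHB (pu t) (pv t))); apply: lerD.
  apply: (le_trans (normH_PN_le L_gt0 N (u2 t))); exact: (inCbV_normH_Cb L_gt0 uCb).
apply: (le_trans (normH_PN_le L_gt0 N (v2 t))); exact: (inCbV_normH_Cb L_gt0 vCb).
Qed.

Let dv (t : R) w : inV L w -> is_derive t (1:R) (fun s : R => innerH L (v s) w) (rhs gam g v t w).
Proof. by move=> hw; have [_] := hv; apply. Qed.

Let du (t : R) w : inV L w -> is_derive t (1:R) (fun s : R => innerH L (u s) w) (rhs nu f u t w).
Proof. by move=> hw; have [_] := hu; apply. Qed.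

Let innerH_g t w : inL2 L w -> innerH L (g t) w =
  innerH L (f t) w + mu * (innerH L (PN L N (u t)) w - innerH L (PN L N (v t)) w).
Proof.
move=> hw; have hd := inL2B (pu t) (pv t).
by rewrite (innerHD (f2 t) (inL2Z mu hd) hw) (innerHZ mu hd hw) (innerHB (pu t) (pv t) hw).
Qed.

(** Energy estimate for [v] itself. All modes are damped at rate [gam K^2], so |v| is at most (|f| +
    mu |u|) / (gam K^2), a bound in terms of the data alone. *)
Lemma normH_v_le_MH t : normH L (v t) <= MH L nu0 mu0 f u.
Proof.
have F0 := normCbH_ge0 L f; have U0 := normCbH_ge0 L u.
have [A gA] := g_bound.
have [C HC] := rhs_bound gam vCb g2 gA.
have [_ cv _] := vCb.
have dE := energy_derive L_gt0 vV cv dv HC.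
pose A1 := normCbH L f + mu * normCbH L u.
pose a := gam * K ^+ 2.
have a0 : 0 < a by rewrite mulr_gt0 ?exprn_gt0.
have A10 : 0 <= A1 by rewrite addr_ge0// mulr_ge0.
have key s : 2 * rhs gam g v s (v s) <= - a * normH L (v s) ^+ 2 + A1 ^+ 2 / a.
  apply: le_trans (absorb_linear A1 (normH L (v s)) a0).
  apply: ler_wpM2l => //.
  rewrite /rhs (innerH_g _ (v2 s)) (pairB_self L_gt0 (vV s) (vV s)) subr0 -normV_sqr//.
  rewrite -(innerH_PN_PN L_gt0 N (v2 s) (v2 s)) -(normH_sqr (pv s)).
  have t1 := normV_tail L_gt0 (ltW N_gt0) (vV s).
  have t2 := le_trans (ler_norm _) (innerH_CS (f2 s) (v2 s)).
  have t3 := le_trans (ler_norm _) (innerH_CS (pu s) (v2 s)).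
  have n0 : 0 <= normH L (v s) := normH_ge0 L (v s).
  have t4 : normH L (f s) * normH L (v s) <= normCbH L f * normH L (v s).
    by apply: ler_wpM2r => //; exact: (inCbV_normH_Cb L_gt0 hf).
  have t5 : normH L (PN L N (u s)) * normH L (v s) <= normCbH L u * normH L (v s).
    apply: ler_wpM2r => //; apply: (le_trans (normH_PN_le L_gt0 N (u2 s))).
    exact: (inCbV_normH_Cb L_gt0 uCb).
  have t6 := ler_wpM2l mu_ge0 (le_trans t3 t5).
  have t7 := le_trans t2 t4.
  have t8 := ler_wpM2l (ltW gam_gt0) t1.
  have t9 := ler_wpM2r (sqr_ge0 (normH L (PN L N (v s)))) mu_ge.
  exact: nudging_arith t6 t7 t8 t9.
have ub s : normH L (v s) ^+ 2 <= normCbH L v ^+ 2.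
  have := inCbV_normH_Cb L_gt0 vCb s => H.
  by rewrite lerXn2r ?nnegrE ?normH_ge0 ?normCbH_ge0.
have := bounded_gronwall a0 dE ub key t => H.
have {}H : normH L (v t) <= A1 / a.
  apply: le_of_sqr; first by rewrite divr_ge0// ltW.
  apply: (le_trans H); rewrite expr_div_n le_eqVlt; apply/orP; left; apply/eqP.
  by field; rewrite gt_eqF.
have nk0 : 0 < nu0 * kappa0 L ^+ 2 by rewrite mulr_gt0 ?exprn_gt0.
have ale : nu0 * kappa0 L ^+ 2 <= a.
  rewrite /a /K [(_ * N) ^+ 2]exprMn; apply: (ler_pM (ltW nu0_gt0) (sqr_ge0 _) gam_ge).
  by apply: ler_peMr; [exact: sqr_ge0|exact: exprn_ege1].
apply: (le_trans H); rewrite /A1 mulrDl; apply: MH_ge.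
- exact: divr_ge0 F0 (ltW a0).
- by apply: (ler_wpM2l F0); rewrite lef_pV2 ?posrE.
- exact: divr_ge0 (mulr_ge0 mu_ge0 U0) (ltW a0).
(* [mu / (gam K^2) = mu0 nu0 / gam <= mu0]: the factor [N^2] in [mu] cancels. *)
- have E : mu0 * a = mu0 * gam * kappa0 L ^+ 2 * N ^+ 2 by rewrite /a /K; ring.
  rewrite mulrAC; apply: (ler_wpM2r U0); rewrite (ler_pdivrMr _ _ a0) E hmu.
  apply: (ler_wpM2r (sqr_ge0 N)); apply: (ler_wpM2r (sqr_ge0 (kappa0 L))).
  exact: (ler_wpM2l (le_trans ler01 mu0_ge1) gam_ge).
Qed.

Let w t := v t - u t.
Let wV t : inV L (w t). Proof. exact: inVB. Qed.
Let w2 t : inL2 L (w t). Proof. exact: inV_inL2. Qed.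

(** This splitting keeps [v] as the transporting field of [w], so the first term disappears when
    tested with [w]. *)
Let pairB_diff t w' : inV L w' ->
  pairB L (v t) (v t) w' - pairB L (u t) (u t) w' =
  pairB L (v t) (w t) w' + pairB L (w t) (u t) w'.
Proof.
move=> hw'.
have E : v t = 1 *: w t + u t by rewrite scale1r /w subrK.
have -> : pairB L (v t) (v t) w' = pairB L (v t) (w t) w' + pairB L (v t) (u t) w'.
  by rewrite [X in pairB L _ X _ = _]E (pairB_linm L_gt0 1 (wV t) (hV t) (vV t) hw') mul1r.
have -> : pairB L (v t) (u t) w' = pairB L (w t) (u t) w' + pairB L (u t) (u t) w'.
  by rewrite [in LHS]E (pairB_linl L_gt0 1 (wV t) (hV t) (hV t) hw') mul1r.
by rewrite addrA addrK.
Qed.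

Let rhs_diff t w' : inV L w' -> rhs gam g v t w' - rhs nu f u t w' =
  - mu * innerH L (PN L N (w t)) w' - gam * innerV L (w t) w' - (gam - nu) * innerV L (u t) w'
  - (pairB L (v t) (w t) w' + pairB L (w t) (u t) w').
Proof.
move=> hw'; rewrite -(pairB_diff t hw') /rhs (innerH_g t (inV_inL2 hw')).
rewrite /w (PNB L_gt0 N (v2 t) (u2 t)) (innerHB (pv t) (pu t) (inV_inL2 hw')).
rewrite (innerVB L_gt0 (vV t) (hV t) hw').
have E (F PU PV IV IU BV BU m a b : R) :
  F + m * (PU - PV) - a * IV - BV - (F - b * IU - BU) =
  - m * (PV - PU) - a * (IV - IU) - (a - b) * IU - (BV - BU) by ring.
exact: E.
Qed.

Lemma normH_diff_le t : normH L (v t - u t) <= 2 * (`|gam - nu| * U) / (gam * K).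
Proof.
have [A gA] := g_bound.
have [C1 HC1] := rhs_bound gam vCb g2 gA.
have [C2 HC2] := rhs_bound nu uCb f2 (inCbV_normH_Cb L_gt0 hf).
pose F t w' := rhs gam g v t w' - rhs nu f u t w'.
have HF s w' : inV L w' -> `|F s w'| <= (C1 + C2) * normV L w'.
  move=> hw'; apply: (le_trans (ler_normB _ _)); rewrite mulrDl.
  by apply: lerD; [exact: HC1|exact: HC2].
have dw (s : R) w' : inV L w' -> is_derive s (1:R) (fun s : R => innerH L (w s) w') (F s w').
  move=> hw'.
  have -> : (fun s : R => innerH L (w s) w') =
      (fun s : R => innerH L (v s) w' - innerH L (u s) w').
    by apply/funext => x; rewrite -(innerHB (v2 x) (u2 x) (inV_inL2 hw')).
  exact: (@is_deriveB _ _ _ _ _ _ _ _ _ (dv s hw') (du s hw')).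
have cw s : normV L (w x - w s) @[x --> s] --> (0 : R).
  have [_ cv _] := vCb; have [_ cu _] := uCb.
  apply: (@squeeze_cvgr _ _ _ _ (fun=> 0) (fun x => normV L (v x - v s) + normV L (u x - u s))).
  - apply: nearW => x; rewrite normV_ge0/=.
    have -> : w x - w s = (v x - v s) - (u x - u s)
      by rewrite /w !opprB addrACA [RHS]addrACA [- u x + _]addrC.
    by apply: normVB => //; exact: inVB.
  - exact: cvg_cst.
  - by rewrite -[X in _ --> X](addr0 (0 : R)); apply: cvgD; [exact: cv|exact: cu].
have dE := energy_derive L_gt0 wV cw dw HF.
pose a := gam * K ^+ 2; pose b := 2 * (`|gam - nu| ^+ 2 * U ^+ 2 / gam).
have a0 : 0 < a by rewrite mulr_gt0 ?exprn_gt0.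
have U0 : 0 <= U := normCbV_ge0 L u.
have key s : 2 * F s (w s) <= - a * normH L (w s) ^+ 2 + b.
  rewrite /F (rhs_diff _ (wV s)) (pairB_self L_gt0 (vV s) (wV s)) add0r.
  rewrite -(innerH_PN_PN L_gt0 N (w2 s) (w2 s)) -(normH_sqr (PN_inL2 L_gt0 N _)).
  rewrite -(normV_sqr L_gt0 (wV s)).
  apply: (energy_arith gam_gt0 (ltW K_gt0) U0 (normH_ge0 L (w s)) (normV_ge0 L (w s)) mu_ge).
  - exact: (normV_tail L_gt0 (ltW N_gt0) (wV s)).
  - exact: U_small.
  - rewrite normrM -mulrA; apply: ler_wpM2l => //.
    apply: (le_trans (innerV_CS L_gt0 (hV s) (wV s))); apply: ler_wpM2r; first exact: normV_ge0.
    exact: normCbV_ge.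
  - apply: (le_trans (pairB_le_same L_gt0 (hV s) (wV s))); apply: ler_wpM2l.
      by apply: mulr_ge0 => //; apply: mulr_ge0; [exact: normH_ge0|exact: normV_ge0].
    exact: normCbV_ge.
have ub s : normH L (w s) ^+ 2 <= (normCbH L v + normCbH L u) ^+ 2.
  rewrite lerXn2r ?nnegrE ?normH_ge0 ?addr_ge0 ?normCbH_ge0//.
  apply: (le_trans (normHB (v2 s) (u2 s))); apply: lerD; exact: inCbV_normH_Cb.
have := bounded_gronwall a0 dE ub key t => H.
apply: le_of_sqr.
  exact: divr_ge0 (mulr_ge0 (ler0n R 2) (mulr_ge0 (normr_ge0 _) U0)) (ltW (mulr_gt0 gam_gt0 K_gt0)).
apply: (le_trans H).
(* Gronwall gives [b / a], half the square of the claimed bound. *)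
have -> : (2 * (`|gam - nu| * U) / (gam * K)) ^+ 2 = 2 * (b / a).
  by rewrite /a /b; field; rewrite !gt_eqF.
have : 0 <= b / a.
  apply: divr_ge0; last exact: ltW.
  by apply: mulr_ge0 => //; apply: divr_ge0; [apply: mulr_ge0; exact: sqr_ge0|exact: ltW].
lra.
Qed.

Lemma diff_normH0 : gam = nu -> forall t, normH L (PN L N (v t) - PN L N (u t)) = 0.
Proof.
move=> E t; apply: PN_normH_cvg0 => //; apply/eqP; rewrite eq_le normH_ge0 andbT.
by apply: (le_trans (normH_diff_le t)); rewrite E subrr normr0 mul0r mulr0 mul0r.
Qed.

(** Makes the supremum in the cost functional a genuine one, so that it dominates the value at each
    time. *)
Lemma PN_normH_bounded t :
  normH L (PN L N (v t) - PN L N (u t)) <= normCbH L v + normCbH L u.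
Proof.
apply: (le_trans (normHB (pv t) (pu t))); apply: lerD.
  by apply: (le_trans (normH_PN_le L_gt0 N (v2 t))); exact: inCbV_normH_Cb.
by apply: (le_trans (normH_PN_le L_gt0 N (u2 t))); exact: inCbV_normH_Cb.
Qed.

Lemma low_modes_bound : gam != nu -> (forall t, normH L (PN L N (v t) - PN L N (u t)) = 0) ->
  forall t, N * normH L (PN L N (u t)) <=
    4 * Num.sqrt (modes_sum N) / (nu0 * kappa0 L ^+ 2 * Num.sqrt (area L)) *
    (MH L nu0 mu0 f u * MV L nu0 mu0 f u).
Proof.
move=> gn same t; set q := normH L (PN L N (u t)).
have ar0 := area_gt0 L_gt0.
have q0 : 0 <= q := normH_ge0 L _.
have ms0 := modes_sum_ge0 N.
pose psi := stokes_inv L N (u t).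
have hpsi : inV L psi := stokes_inv_inV L_gt0 N (hV t).
have null s w' : inL2 L w' -> innerH L (PN L N (w s)) w' = 0.
  move=> hw'; apply/eqP; rewrite -normr_le0.
  apply: (le_trans (innerH_CS (PN_inL2 L_gt0 N _) hw')).
  by rewrite /w (PNB L_gt0 N (v2 s) (u2 s)) same mul0r.
(* [psi] is frozen at time [t] and has only modes below [N], where [v] and [u] agree at all times;
   the two pairings are one function of [s], with one derivative. *)
have Eq : rhs gam g v t psi = rhs nu f u t psi.
  have d1 := dv t hpsi; have d2 := du t hpsi.
  have E : (fun s : R => innerH L (v s) psi) = (fun s : R => innerH L (u s) psi).
    apply/funext => s; apply/eqP; rewrite -subr_eq0 -(innerHB (v2 s) (u2 s) (inV_inL2 hpsi)).
    by rewrite (innerH_stokes_inv L_gt0 N (hV t) (w2 s)) null//; exact: inV_inL2.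
  have := @derive_val _ _ _ _ _ _ _ d1; rewrite E => <-.
  exact: (@derive_val _ _ _ _ _ _ _ d2).
(* Tested with A^-1 P_N u, the viscous term of [w] becomes <P_N w, P_N u> = 0 and that of [u]
   becomes |P_N u|^2. *)
have Dq : (gam - nu) * q ^+ 2 = - (pairB L (v t) (w t) psi + pairB L (w t) (u t) psi).
  have := rhs_diff t hpsi; rewrite Eq subrr (null t _ (inV_inL2 hpsi)).
  rewrite (innerV_stokes_inv L_gt0 N (hV t) (wV t)) (innerV_stokes_inv L_gt0 N (hV t) (hV t)).
  rewrite (null t _ (pu t)) -(normH_sqr (pu t)) -/q.
  by rewrite !mulr0 subrr sub0r => /esym/eqP; rewrite subr_eq0 eqr_oppLR => /eqP.
pose S := Num.sqrt (modes_sum N / kappa0 L ^+ 2 * (q ^+ 2 / area L)).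
have SE : S = Num.sqrt (modes_sum N) / (kappa0 L * Num.sqrt (area L)) * q.
  exact: sqrt_factor ms0 kap_gt0 ar0 q0.
have S0 : 0 <= S by exact: sqrtr_ge0.
set MH' := MH L nu0 mu0 f u; set MV' := MV L nu0 mu0 f u.
have vM : normH L (v t) <= MH' := normH_v_le_MH t.
have uM : normH L (u t) <= MH' := normH_le_MH t.
(* Antisymmetry moves the gradient onto [psi], so that [v] and [w] enter only through their L^2
   norms. *)
have b1 : `|pairB L (v t) (w t) psi| <= S * MH' * normH L (w t).
  rewrite (pairB_anti L_gt0 (vV t) (wV t) hpsi) normrN.
  apply: (le_trans (pairB_stokes_inv L_gt0 N (hV t) (vV t) (wV t))).
  by apply: ler_wpM2r; [exact: normH_ge0|exact: ler_wpM2l].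
have b2 : `|pairB L (w t) (u t) psi| <= S * MH' * normH L (w t).
  rewrite (pairB_anti L_gt0 (wV t) (hV t) hpsi) normrN.
  apply: (le_trans (pairB_stokes_inv L_gt0 N (hV t) (wV t) (hV t))).
  rewrite mulrAC; apply: ler_wpM2r; [exact: normH_ge0|exact: ler_wpM2l].
have d0 : 0 < `|gam - nu| by rewrite normr_gt0 subr_eq0.
have MH0 : 0 <= MH' := le_trans (normH_ge0 L _) uM.
have b3 : `|gam - nu| * q ^+ 2 <= 2 * (S * MH') * (2 * (`|gam - nu| * U) / (gam * K)).
  have -> : `|gam - nu| * q ^+ 2 = `|(gam - nu) * q ^+ 2|.
    by rewrite normrM (ger0_norm (sqr_ge0 q)).
  rewrite Dq normrN; apply: (le_trans (ler_normD _ _)); apply: (le_trans (lerD b1 b2)).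
  rewrite -mulrDl -mulr2n -[_ *+ 2]mulr_natl; apply: ler_wpM2l; last exact: normH_diff_le.
  exact: mulr_ge0 (ler0n R 2) (mulr_ge0 S0 MH0).
rewrite SE in b3.
apply: (low_modes_arith (sqrtr_ge0 _) kap_gt0 _ q0 nu0_gt0 gam_ge N_gt0 d0 _ _ MH0 b3).
- by rewrite sqrtr_gt0.
- exact: normCbV_ge0.
- exact: normCbV_le_MV.
Qed.

End Viscosity.

End Flow.

(** * Positivity of the observed part and conclusion *)

(** From [ms <= c l] follows [4 sqrt ms = 2 sqrt (4 ms) <= 2 sqrt (5 c l)], which contradicts the
    strict second condition on [N]. *)
Lemma critical_arith (R : realType) (c ms l N Q X D : R) : 0 <= ms -> 0 < l -> 0 < Q -> 0 <= X ->
  0 < D -> ms <= c * l -> 0 <= c ->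
  N * Q <= 4 * Num.sqrt ms / D * X ->
  ~ 2 * Num.sqrt (5 * c) / D * (X / Q) < N / Num.sqrt l.
Proof.
move=> ms0 l0 Q0 X0 D0 msl c0 NQ H.
have sl : 0 < Num.sqrt l by rewrite sqrtr_gt0.
have Ql : 0 < Q * Num.sqrt l by exact: mulr_gt0.
move: H; rewrite -(ltr_pM2r Ql).
have -> : 2 * Num.sqrt (5 * c) / D * (X / Q) * (Q * Num.sqrt l) =
  2 * (Num.sqrt (5 * c) * Num.sqrt l) / D * X by field; rewrite !gt_eqF.
have -> : N / Num.sqrt l * (Q * Num.sqrt l) = N * Q by field; rewrite gt_eqF.
apply/negP; rewrite -leNgt; apply: (le_trans NQ); apply: (ler_wpM2r X0).
apply: ler_wpM2r; first by rewrite invr_ge0 ltW.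
have c50 : 0 <= 5 * c by rewrite mulr_ge0.
have -> : 4 * Num.sqrt ms = 2 * (2 * Num.sqrt ms) by ring.
apply: ler_wpM2l => //; apply: le_of_sqr; first by rewrite mulr_ge0 ?sqrtr_ge0.
rewrite !exprMn !sqr_sqrtr//; last exact: ltW.
have : 0 <= c * l by rewrite mulr_ge0// ltW.
by move: msl; rewrite -mulrA; lra.
Qed.

Lemma normCbH_PN_gt0 (R : realType) (L : R) (L_gt0 : 0 < L) (u : R -> vfield R) (N : R) :
  inCbV L u -> (exists t, normH L (u t) != 0) -> n0 L u < N ->
  0 < normCbH L (fun t => PN L N (u t)).
Proof.
move=> uCb [t ut] n0N; rewrite lt_neqAle normCbH_ge0 andbT eq_sym; apply/negP => /eqP Q0.
have [hV _ _] := uCb; have u2 s := inV_inL2 (hV s).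
pose S := [set n : R | normCbH L (fun t => PN L n (u t)) = 0].
(* [n0] is meaningful only if [S] is bounded above, [sup] being 0 otherwise; the second branch
   proves that boundedness. *)
have [hS|nS] := pselect (has_sup S).
  have : N <= n0 L u by exact: sup_upper_bound.
  by rewrite leNgt n0N.
have h0 : 0 < normH L (u t) by rewrite lt_neqAle eq_sym ut normH_ge0.
have k0 := kappa0_gt0 L_gt0.
have B0 : 0 <= normV L (u t) / (kappa0 L * normH L (u t)).
  by rewrite divr_ge0 ?normV_ge0// mulr_ge0 ?normH_ge0// ltW.
apply: nS; split; first by exists N.
(* If P_n u(t) vanishes, the tail estimate reads [kappa0 n |u(t)| <= ||u(t)||], which bounds [n]. *)
exists (normV L (u t) / (kappa0 L * normH L (u t))) => n Sn.
rewrite leNgt; apply/negP => Bn.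
have n_ge0 : 0 <= n by exact: le_trans (ltW Bn).
have pn0 : normH L (PN L n (u t)) = 0.
  apply/eqP; rewrite eq_le normH_ge0 andbT -Sn.
  apply: (normCbH_ge (C := normCbH L u) (phi := fun t => PN L n (u t))) => s.
  exact: le_trans (normH_PN_le L_gt0 n (u2 s)) (inCbV_normH_Cb L_gt0 uCb s).
have := normV_tail L_gt0 n_ge0 (hV t); rewrite pn0 expr0n subr0 -exprMn.
move/(le_of_sqr (normV_ge0 L (u t))); apply/negP; rewrite -ltNge.
by rewrite mulrAC mulrC -ltr_pdivrMr// mulr_gt0.
Qed.

Theorem theorem5p2 (R : realType) (L : R) (L_gt0 : 0 < L)
    (c : R) (hc : log_constant c)
    (nu0 nu1 : R) (nu0_gt0 : 0 < nu0) (nu0_lt_nu1 : nu0 < nu1)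
    (f : R -> vfield R) (hf : inCbV L f)
    (nu : R) (hnu : nu \in `[nu0, nu1])
    (u : R -> vfield R) (hu : NSE_solution L nu f u)
    (u_neq0 : exists t, normH L (u t) != 0)
    (mu0 : R) (hmu0 : nu1 / nu0 <= mu0)
    (N : R) (N_ge1 : 1 <= N)
    (mu : R) (hmu : mu = mu0 * nu0 * kappa0 L ^+ 2 * N ^+ 2)
    (W : R -> (R -> vfield R) -> R -> vfield R)
    (hW : forall gamma, gamma \in `[nu0, nu1] ->
       determining_solution L mu N f gamma (fun t => PN L N (u t))
         (W gamma (fun t => PN L N (u t))))
    (hN1 : Num.max (8 / (nu0 * kappa0 L) * MV L nu0 mu0 f u) (n0 L u) < N)
    (hN2 : 2 * Num.sqrt (5 * c) / (nu0 * kappa0 L ^+ 2 * Num.sqrt (area L))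
             * (MH L nu0 mu0 f u * MV L nu0 mu0 f u
                / normCbH L (fun t => PN L N (u t)))
           < N / Num.sqrt (ln (N + 1))) :
  unique_minimizer_on nu0 nu1 (cost L N W u) nu.
Proof.
move: hN1; rewrite gt_max => /andP[hNV hNn].
have uCb := hu.1.
have Q0 := normCbH_PN_gt0 L_gt0 uCb u_neq0 hNn.
have N0 : 0 < N := lt_le_trans ltr01 N_ge1.
have l0 : 0 < ln (N + 1) by rewrite ln_gt0// ltrDr.
have ms0 := modes_sum_ge0 N.
have /andP[hc1 hc2] := hc _ N_ge1.
have msc := le_trans (modes_sum_le N) (le_trans hc1 hc2).
(* The sign of [c] is recovered from [c ln (N + 1)] dominating a nonnegative mode sum. *)
have c0 : 0 <= c by rewrite -(pmulr_lge0 c l0); exact: le_trans msc.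
have costE gam t (hg : gam \in `[nu0, nu1]) :
    normH L (PN L N (W gam (fun s => PN L N (u s)) t) - PN L N (u t)) <= cost L N W u gam.
  apply: (normCbH_ge (C := normCbH L (W gam (fun s => PN L N (u s))) + normCbH L u)
    (phi := fun t => PN L N (W gam (fun s => PN L N (u s)) t) - PN L N (u t))) => s.
  exact: (PN_normH_bounded L_gt0 hu (hW gam hg)).
have cost_ge0 gam : 0 <= cost L N W u gam by exact: normCbH_ge0.
have cost_nu : cost L N W u nu = 0.
  apply/eqP; rewrite eq_le cost_ge0 andbT; apply: normCbH_le => t.
  by rewrite (diff_normH0 L_gt0 nu0_gt0 nu0_lt_nu1 hf hu hmu0 N_ge1 hmu hNV hnu (hW nu hnu) erefl).
split; [exact: hnu|by move=> y _; rewrite cost_nu; exact: cost_ge0|move=> y hy ymin].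
apply/eqP; apply: contraT => yn.
have cy : cost L N W u y <= 0 by rewrite -cost_nu; exact: ymin.
(* The minimal value is 0, so a second minimiser reproduces P_N u at every time. *)
have same t : normH L (PN L N (W y (fun s => PN L N (u s)) t) - PN L N (u t)) = 0.
  by apply/eqP; rewrite eq_le normH_ge0 andbT; exact: le_trans (costE y t hy) cy.
have low := low_modes_bound L_gt0 nu0_gt0 nu0_lt_nu1 hf hu hmu0 N_ge1 hmu hNV hy (hW y hy) yn same.
exfalso; apply: (critical_arith ms0 l0 Q0 _ _ msc c0 _ hN2).
- have m1 := normH_le_MH L_gt0 nu0_gt0 nu0_lt_nu1 hu hmu0 0.
  apply: mulr_ge0; first exact: le_trans (normH_ge0 L (u 0)) m1.
  exact: le_trans (normCbV_ge0 L u) (normCbV_le_MV L f u nu0_gt0 nu0_lt_nu1 hmu0).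
- apply: mulr_gt0; last by rewrite sqrtr_gt0; exact: (area_gt0 L_gt0).
  exact: (mulr_gt0 nu0_gt0 (exprn_gt0 2 (kappa0_gt0 L_gt0))).
(* The bound of [low_modes_bound] has a right side independent of time, hence passes to the
   supremum. *)
- rewrite mulrC -(ler_pdivlMr _ _ N0); apply: normCbH_le => t.
  by rewrite (ler_pdivlMr _ _ N0) mulrC; exact: low.
Qed.
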